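(* Let $r\ge2$. Suppose $Z(t)$, $t\ge0$, is a stochastic process with regenerative increments over the renewal times $T_n$ such that $\mu:=\mathbb{E}[T_1]$, $a:=\mathbb{E}[Z(T_1)]/\mu$, and $\sigma^2:=\operatorname{Var}[Z(T_1)-aT_1]$ are finite. Let $M_1:=\sup_{0\le t\le T_1}|Z(t)|$, assume $M_1<\infty$ almost surely, and assume in addition that $\mathbb{E}[T_1^r]<\infty$ and $\mathbb{E}[M_1^r]<\infty$. Then the family of random variables $$\left\{\left|\frac{Z(t)-at}{\sqrt t}\right|^r:\ t\ge1\right\}$$ is uniformly integrable, and consequently the convergence in distribution $$\frac{Z(t)-at}{\sqrt t}\longrightarrow N(0,\sigma^2/\mu)\qquad\text{as } t\to\infty$$ holds with convergence of all moments (absolute and ordinary) of orders $\le r$; that is, with $W\sim N(0,\sigma^2/\mu)$, $\mathbb{E}\bigl|(Z(t)-at)/\sqrt t\bigr|^s\to\mathbb{E}|W|^s$ for every real $0<s\le r$ and $\mathbb{E}\bigl[((Z(t)-at)/\sqrt t)^k\bigr]\to\mathbb{E}[W^k]$ for every integer $1\le k\le r$, as $t\to\infty$.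
   Context: Renewal times: $T_0:=0$ and $T_n:=\sum_{i=1}^n\xi_i$ for $n\ge 1$, where $(\xi_i)_{i\ge1}$ are i.i.d. strictly positive random variables (so $0<T_1<T_2<\cdots$ and $\xi_n=T_n-T_{n-1}$). $Z=(Z(t))_{t\ge0}$ is a real-valued stochastic process with continuous time parameter $t\in[0,\infty)$ and càdlàg (right-continuous with left limits) paths. The process $Z(t)$ has regenerative increments over the times $T_n$ if $Z(0)=0$ and the increments $$\zeta_n:=\bigl(\xi_n,\ \{Z(t+T_{n-1})-Z(T_{n-1}):0\le t\le\xi_n\}\bigr),\qquad n\ge1,$$ are i.i.d. Here the second component, defined on the random interval $[0,\xi_n]$, is regarded as a process on $[0,\infty)$ stopped at $\xi_n$, i.e. equal to $Z(\xi_n+T_{n-1})-Z(T_{n-1})$ for all $t\ge\xi_n$, so it is a random càdlàg function on $[0,\infty)$. The case $\sigma^2=0$ is included, with $N(0,0)$ denoting the distribution of the constant $0$. *)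

(* Defs.v *)
From HB Require Import structures.
From mathcomp Require Import all_boot all_order all_algebra finmap.
From mathcomp Require Import all_classical all_reals all_analysis.

Set Implicit Arguments.
Unset Strict Implicit.
Unset Printing Implicit Defensive.

Import Order.TTheory GRing.Theory Num.Theory.
Import numFieldNormedType.Exports.

Local Open Scope classical_set_scope.
Local Open Scope ring_scope.

Section iid.
Context {d d' : measure_display} {Omega : measurableType d}
  {S : measurableType d'} {R : realType}.
Variable P : probability Omega R.

Definition mutually_independent (X : nat -> Omega -> S) : Prop :=
  forall (J : {fset nat}) (A : nat -> set S), (forall i, measurable (A i)) ->
    P (\bigcap_(i in [set` J]) (X i @^-1` A i)) =
    (\prod_(i <- J) P (X i @^-1` A i))%E.

Definition identically_distributed (X : nat -> Omega -> S) : Prop :=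
  forall (i j : nat) (A : set S), measurable A ->
    P (X i @^-1` A) = P (X j @^-1` A).

Definition iid (X : nat -> Omega -> S) : Prop :=
  [/\ forall n, measurable_fun setT (X n),
      mutually_independent X & identically_distributed X].

End iid.

(* Real functions with the sigma-algebra generated by the evaluations at times
   t >= 0.  Its trace on the cadlag functions is the usual sigma-algebra of
   D[0, +oo) (the Borel sigma-algebra of the Skorokhod topology), and what a
   function does at negative times is invisible to it. *)
Definition evaluation_cylinders (R : realType) : set (set (R -> R)) :=
  [set C | exists t : R, 0 <= t /\
     exists2 B : set R, measurable B & C = (fun f => f t) @^-1` B].

Definition path_space (R : realType) :=
  g_sigma_algebraType (@evaluation_cylinders R).

HB.instance Definition _ (R : realType) := Measurable.on (path_space R).

Definition cadlag (R : realType) (f : R -> R) : Prop :=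
  (forall t, 0 <= t -> f x @[x --> t^'+] --> f t) /\
  (forall t, 0 < t -> cvg (f x @[x --> t^'-])).

(* Indices are shifted by one: [xi n] is the (n+1)-st interarrival time
   T_(n+1) - T_n, and [increment xi Z n] is the (n+1)-st increment, starting at
   T_n.  Processes are indexed by all of [R], but only the times t >= 0 are
   ever used. *)
Section renewal.
Context {d : measure_display} {Omega : measurableType d} {R : realType}.

Definition renewal_time (xi : nat -> Omega -> R) (n : nat) (w : Omega) : R :=
  \sum_(i < n) xi i w.

Definition at_time (Z : R -> Omega -> R) (tau : Omega -> R) (w : Omega) : R :=
  Z (tau w) w.

Definition increment (xi : nat -> Omega -> R) (Z : R -> Omega -> R)
    (n : nat) (w : Omega) : R * path_space R :=
  (xi n w,
   fun t => Z (Num.min t (xi n w) + renewal_time xi n w) w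
            - Z (renewal_time xi n w) w).

Definition renewal_process (P : probability Omega R) (xi : nat -> Omega -> R) :
    Prop :=
  iid P xi /\ forall n w, 0 < xi n w.

Definition regenerative_increments (P : probability Omega R)
    (xi : nat -> Omega -> R) (Z : R -> Omega -> R) : Prop :=
  (forall w, Z 0 w = 0) /\ iid P (increment xi Z).

Definition sup_norm_upto (Z : R -> Omega -> R) (tau : Omega -> R)
    (w : Omega) : \bar R :=
  ereal_sup [set (`|Z t w|)%:E | t in `[0, tau w]].

Definition uniformly_integrable (P : probability Omega R) (I : Type)
    (D : set I) (X : I -> Omega -> R) : Prop :=
  ereal_sup [set (\int[P]_(w in [set w | (c < `|X t w|)%R])
                    (`|X t w|)%:E)%E | t in D] @[c --> +oo] --> 0%E.

Definition cvg_in_distribution (P : probability Omega R) (X : R -> Omega -> R)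
    (nu : probability (measurableTypeR R) R) : Prop :=
  forall f : R -> R, continuous f -> (exists M : R, forall x, `|f x| <= M) ->
    ('E_P[fun w => f (X t w)])%E @[t --> +oo] --> ('E_nu[f])%E.

End renewal.

(* N(0, v).  The case v = 0 is separate because [normal_prob 0 0] is not the
   Dirac mass at 0: the library defaults to the uniform law on `[0, 1]. *)
Definition centered_normal (R : realType) (v : R) :
    probability (measurableTypeR R) R :=
  if v == 0 then (\d_(0 : measurableTypeR R) : probability (measurableTypeR R) R)
  else (normal_prob 0 (Num.sqrt v) : probability (measurableTypeR R) R).

(* Main.v *)
(* Let Y_i be the increment of Z over the i-th renewal interval minus a xi_i, S_n the sum of the first n
   of these i.i.d. centered variables, and tau the number of renewal intervals begun by time t.  Then
   Z(t) - a t differs from S_tau by at most 2 M + |a| xi, where M is the supremum of the path over the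
   interval straddling t and xi its length.

   Uniform integrability rests on E|S_tau|^p <= C t^(p/2) E|Y|^p for p >= 2.  Stopping is replaced by the
   weights exp(-T_n / t): the quantities E[exp(-T_n / t) |S_n|^p] satisfy a recursion contracting by the
   factor 1 - c / t up to a term of size t^(p/2 - 1), and exp(-T_n / t) dominates the indicator of
   T_n <= t up to the factor e.  Splitting Y into a bounded part, for which p = 2r, and a part with small
   r-th moment, for which p = r, gives the tails of |X_t|^r.

   For the limit law, orthogonality of the steps gives E(S_tau - S_n)^2 = E Y^2 E|tau - n| = O(sqrt t) for
   n = floor (t / mu), and E cos(theta S_n / sqrt t + b) converges to its Gaussian value.  Cosines are
   enough for weak convergence of tight families, since on a compact interval a continuous function is a
   uniform limit of polynomials in sin(c x).  Uniform integrability then carries weak convergence over to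
   the moments. *)
Require Import Defs.
From HB Require Import structures.
From mathcomp Require Import all_boot all_order all_algebra finmap.
From mathcomp Require Import all_classical all_reals all_analysis.
From mathcomp Require Import measurable_realfun ring lra.

Set Implicit Arguments.
Unset Strict Implicit.
Unset Printing Implicit Defensive.

Import Order.TTheory GRing.Theory Num.Theory.
Import numFieldNormedType.Exports.

Local Open Scope classical_set_scope.
Local Open Scope ring_scope.

(** * Real-valued expectations *)

(** The interval containing t is size-biased and correlated with the clock, so neither its index nor
    its marks have a tractable law. What is used instead is that the event T_i <= t and the walk up
    to i are functions of the steps before i, hence independent of step i. This yields Wald's
    identity, the orthogonality of the steps and all one-step recursions; marks of the straddling
    interval are bounded by sums over all intervals begun.

    Expanding E|S_tau|^p to second order leaves the sum over n of E|S_n|^(p-2) on T_n <= t. That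
    indicator does not factor over the steps, whereas the exponential weight does. The price is that
    a discounted step is no longer centered, and Young's inequality absorbs the resulting lower
    moments into the contraction.

    The moment bound has to be linear in E|Y|^p with a constant depending only on p and the law of
    the interval length: it is applied to pieces of Y that vary with a cut-off.

    All sums stop at a finite number m of steps, with bounds free of m; what happens when m
    intervals do not reach t is removed at the end, by letting m tend to infinity. *)

Section measurable_lambda.
Context {d : measure_display} {T : measurableType d} {R : realType}.
Implicit Types f g : T -> R.

Lemma mf_natb (b : T -> bool) :
  measurable_fun setT b -> measurable_fun setT (fun w => (b w)%:R : R).
Proof.
move=> mb; rewrite (_ : (fun w => _) = \1_(b @^-1` [set true])).
  by apply: measurable_indic; rewrite -[_ @^-1` _]setTI; exact: mb.
apply/funext => w; rewrite indicE; congr (_%:R).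
case bw: (b w); first by rewrite mem_set.
by rewrite memNset//= bw.
Qed.

Lemma mf_pow (p : R) f :
  measurable_fun setT f -> measurable_fun setT (fun w => f w `^ p).
Proof. by move=> mf; apply: (measurableT_comp (measurable_powR p)). Qed.

Lemma mf_cont (h : R -> R) f : continuous h ->
  measurable_fun setT f -> measurable_fun setT (fun w => h (f w)).
Proof.
by move=> ch mf; apply: (measurableT_comp _ mf); exact: continuous_measurable_fun.
Qed.

Lemma mf_norm f : measurable_fun setT f -> measurable_fun setT (fun w => `|f w|).
Proof. by move=> mf; apply: measurableT_comp. Qed.

Lemma mf_sg f : measurable_fun setT f -> measurable_fun setT (fun w => Num.sg (f w)).
Proof.
move=> mf; rewrite (_ : (fun w => _) = (fun w => (0 < f w)%R%:R - (f w < 0)%R%:R)).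
  apply: measurable_funB; apply: mf_natb; apply: measurable_fun_ltr => //;
    exact: measurable_cst.
apply/funext => w; case: (ltrgt0P (f w)) => [fw|fw|->].
- by rewrite gtr0_sg// subr0.
- by rewrite ltr0_sg// sub0r.
- by rewrite sgr0 subrr.
Qed.

Lemma mf_sum (I : Type) (s : seq I) (F : I -> T -> R) :
  (forall i, measurable_fun setT (F i)) ->
  measurable_fun setT (fun w => \sum_(i <- s) F i w).
Proof. by move=> mF; exact: measurable_sum. Qed.

End measurable_lambda.

(** Follows the syntax of a function given under a binder; the [mf_] lemmas state closure in this
    expanded form so that the second-order patterns find them. Measurability of the atoms has to be
    in the context. *)
Ltac meas := repeat first
  [ assumption
  | match goal with
    | |- measurable_fun _ (fun=> _) => apply: measurable_cst
    | |- measurable_fun _ (fun w => @?f w + - @?g w) => apply: measurable_funB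
    | |- measurable_fun _ (fun w => @?f w + @?g w) => apply: measurable_funD
    | |- measurable_fun _ (fun w => @?f w * @?g w) => apply: measurable_funM
    | |- measurable_fun _ (fun w => - @?f w) => apply: measurable_funN
    | |- measurable_fun _ (fun w => @?f w ^+ _) => apply: measurable_funX
    | |- measurable_fun _ (fun w => `|@?f w|) => apply: mf_norm
    | |- measurable_fun _ (fun w => Num.sg (@?f w)) => apply: mf_sg
    | |- measurable_fun _ (fun w => @?f w `^ _) => apply: mf_pow
    | |- measurable_fun _ (fun w => expR (@?f w)) => apply: (mf_cont (h := expR))
    | |- measurable_fun _ (fun w => cos (@?f w)) => apply: (mf_cont (h := cos))
    | |- measurable_fun _ (fun w => sin (@?f w)) => apply: (mf_cont (h := sin))
    | |- measurable_fun _ (fun w => Num.sqrt (@?f w)) =>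
        apply: (mf_cont (h := Num.sqrt))
    | |- measurable_fun _ (fun w => (@?f w)%:R) => apply: mf_natb
    | |- measurable_fun _ (fun w => (@?f w <= @?g w)%R) => apply: measurable_fun_ler
    | |- measurable_fun _ (fun w => (@?f w < @?g w)%R) => apply: measurable_fun_ltr
    | |- measurable_fun _ (fun w => \sum_(i <- _) _) => apply: mf_sum => ?
    | |- continuous expR => exact: continuous_expR
    | |- continuous cos => exact: continuous_cos
    | |- continuous sin => exact: continuous_sin
    | |- continuous Num.sqrt => exact: sqrt_continuous
    end ].

Section expectation_calculus.
Context {d : measure_display} {T : measurableType d} {R : realType}.
Variable P : probability T R.
Implicit Types f g : T -> R.

Definition L1 f := P.-integrable setT (EFin \o f).
(** The integral is read through [fine], so [Ex f] is 0 when the integral is infinite; this is why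
    the rules below carry [L1] hypotheses. *)
Definition Ex f := Rintegral P setT f.

Lemma L1_measurable f : L1 f -> measurable_fun setT f.
Proof. by move=> /measurable_int/measurable_EFinP. Qed.

Lemma L1_cst c : L1 (fun=> c).
Proof. exact: finite_measure_integrable_cst. Qed.

Lemma L1D f g : L1 f -> L1 g -> L1 (fun w => f w + g w).
Proof. by move=> Lf Lg; have := integrableD measurableT Lf Lg. Qed.

Lemma L1B f g : L1 f -> L1 g -> L1 (fun w => f w - g w).
Proof. by move=> Lf Lg; have := integrableB measurableT Lf Lg. Qed.

Lemma L1Z c f : L1 f -> L1 (fun w => c * f w).
Proof. by move=> Lf; have := integrableZl measurableT c Lf. Qed.

Lemma L1_sum (I : Type) (s : seq I) (F : I -> T -> R) :
  (forall i, L1 (F i)) -> L1 (fun w => \sum_(i <- s) F i w).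
Proof.
move=> LF; elim: s => [|i s IH].
  by under eq_fun do rewrite big_nil; exact: L1_cst.
by under eq_fun do rewrite big_cons; exact: L1D.
Qed.

Lemma L1_le f g : measurable_fun setT f -> (forall w, `|f w| <= g w) ->
  L1 g -> L1 f.
Proof.
move=> mf fg; apply: le_integrable => //; first exact/measurable_EFinP.
by move=> w _ /=; rewrite lee_fin (le_trans (fg w))// ler_norm.
Qed.

Lemma L1_bounded f c : measurable_fun setT f -> (forall w, `|f w| <= c) -> L1 f.
Proof. by move=> mf fc; apply: L1_le (L1_cst c). Qed.

Lemma L1_norm f : L1 f -> L1 (fun w => `|f w|).
Proof. by move=> Lf; exact: integrable_norm. Qed.

Lemma L1_ge0 f : measurable_fun setT f -> (forall w, 0 <= f w) ->
  (\int[P]_w (f w)%:E < +oo)%E -> L1 f.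
Proof.
move=> mf f0 fy; apply/integrableP; split; first exact/measurable_EFinP.
by under eq_integral do rewrite /= ger0_norm//.
Qed.

Lemma Ex_EFin f : L1 f -> (\int[P]_w (f w)%:E)%E = (Ex f)%:E.
Proof. by move=> Lf; rewrite fineK//; exact: integrable_fin_num. Qed.

Lemma Ex_cst c : Ex (fun=> c) = c.
Proof. by rewrite /Ex Rintegral_cst//= [P _]probability_setT mulr1. Qed.

Lemma ExD f g : L1 f -> L1 g -> Ex (fun w => f w + g w) = Ex f + Ex g.
Proof. exact: RintegralD. Qed.

Lemma ExB f g : L1 f -> L1 g -> Ex (fun w => f w - g w) = Ex f - Ex g.
Proof. exact: RintegralB. Qed.

Lemma ExZ c f : L1 f -> Ex (fun w => c * f w) = c * Ex f.
Proof. exact: RintegralZl. Qed.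

Lemma Ex_sum (I : Type) (s : seq I) (F : I -> T -> R) :
  (forall i, L1 (F i)) ->
  Ex (fun w => \sum_(i <- s) F i w) = \sum_(i <- s) Ex (F i).
Proof.
move=> LF; elim: s => [|i s IH].
  by under eq_fun do rewrite big_nil; rewrite big_nil Ex_cst.
under eq_fun do rewrite big_cons; rewrite ExD ?IH ?big_cons//.
exact: L1_sum.
Qed.

Lemma le_Ex f g : L1 f -> L1 g -> (forall w, f w <= g w) -> Ex f <= Ex g.
Proof. by move=> Lf Lg fg; apply: le_Rintegral. Qed.

Lemma Ex_ge0 f : (forall w, 0 <= f w) -> 0 <= Ex f.
Proof. by move=> f0; apply: Rintegral_ge0. Qed.

Lemma norm_Ex f : L1 f -> `|Ex f| <= Ex (fun w => `|f w|).
Proof. by move=> Lf; apply: le_normr_Rintegral. Qed.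

Lemma L1_dominated f g : measurable_fun setT f -> L1 g ->
  (forall w, 0 <= f w <= g w) -> L1 f.
Proof.
move=> mf Lg fg; apply: L1_le Lg => // w.
by have /andP[f0 ?] := fg w; rewrite ger0_norm.
Qed.

(** The variance of [|f|] is nonnegative: expand the square of [|f| - m] at the mean [m]. *)
Lemma Ex_sqr_le f : measurable_fun setT f -> L1 (fun w => f w ^+ 2) ->
  Ex (fun w => `|f w|) ^+ 2 <= Ex (fun w => f w ^+ 2).
Proof.
move=> mf Lf2.
have Lf : L1 (fun w => `|f w|).
  apply: (@L1_dominated _ (fun w => 1 + f w ^+ 2)).
  - exact: measurableT_comp.
  - by apply: L1D => //; exact: L1_cst.
  - move=> w; rewrite normr_ge0/= -real_normK ?num_real//.
    have := sqr_ge0 (`|f w| - 1); set u := `|f w|; nra.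
set m := Ex (fun w => `|f w|).
have : 0 <= Ex (fun w => (`|f w| - m) ^+ 2) by apply: Ex_ge0 => w; exact: sqr_ge0.
rewrite (_ : (fun w => _) = (fun w => (f w ^+ 2 - (2 * m) * `|f w|) + m ^+ 2)).
  have L2 := L1Z (2 * m) Lf.
  rewrite (ExD (L1B Lf2 L2) (L1_cst _)) (ExB Lf2 L2) (ExZ _ Lf) Ex_cst -/m; lra.
apply/funext => w; rewrite -[in RHS](real_normK (num_real (f w))); ring.
Qed.

Lemma L1_of_sqr f : measurable_fun setT f -> L1 (fun w => f w ^+ 2) -> L1 f.
Proof.
move=> mf Lf2; apply: (@L1_le _ (fun w => 1 + f w ^+ 2)) => //.
  move=> w; rewrite -real_normK ?num_real//.
  have := sqr_ge0 (`|f w| - 1); set u := `|f w|; nra.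
by apply: L1D => //; exact: L1_cst.
Qed.

(** Dominated convergence along integer levels; the tail decreases in the level, which covers all
    real [K]. The level is read on a second function [g], so that a power can be integrated over a
    tail of its base. *)
Lemma Ex_tail f g : measurable_fun setT g -> L1 f -> (forall w, 0 <= f w) ->
  forall e : R, 0 < e ->
  exists2 K0 : R, 0 < K0 &
  forall K : R, K0 <= K -> Ex (fun w => f w * (K < g w)%R%:R) < e.
Proof.
move=> mg Lf f0 e e0.
have mfK (K : R) : measurable_fun setT (fun w => f w * (K < g w)%R%:R).
  by have mf := L1_measurable Lf; meas.
have LfK (K : R) : L1 (fun w => f w * (K < g w)%R%:R).
  apply: (L1_dominated (mfK K) Lf) => w.
  by case: (_ < _); rewrite ?mulr1 ?mulr0 ?lexx ?f0.
have cv : (\int[P]_w (f w * ((n%:R : R) < g w)%R%:R)%:E)%E @[n --> \oo] --> 0%E.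
  have := @dominated_cvg _ _ _ P setT measurableT
     (fun n w => (f w * ((n%:R : R) < g w)%R%:R)%:E) (cst 0%E) (EFin \o f).
  rewrite integral0; apply => //.
  - by move=> n; apply/measurable_EFinP.
  - move=> w _; apply: cvg_near_cst; near=> n => /=.
    rewrite ltNge (_ : g w <= n%:R) ?mulr0//.
    by apply: ltW; near: n; exact: nbhs_infty_gtr.
  - move=> n w _ /=; rewrite lee_fin normrM (ger0_norm (f0 w)).
    by case: (_ < _); rewrite ?normr1 ?normr0 ?mulr1 ?mulr0.
move/fine_cvgP: cv => [_ /cvgrPdist_lt/(_ e e0)[n _ /(_ n (leqnn n))]].
rewrite /= sub0r normrN -[fine _]/(Ex _) ger0_norm; last first.
  by apply: Ex_ge0 => w; rewrite mulr_ge0.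
move=> En; exists n.+1%:R => // K nK; apply: le_lt_trans En.
apply: le_Ex => // w; apply: ler_wpM2l => //.
case: (ltP K) => [Kg|]; last by move=> _; exact: ler0n.
rewrite (lt_trans _ Kg)// (lt_le_trans _ nK)// ltr_nat//.
Unshelve. all: by end_near. Qed.

End expectation_calculus.

(** * Independence of the past *)

Section independence.
Context {d d1 d2 : measure_display} {Omega : measurableType d}
  {T1 : measurableType d1} {T2 : measurableType d2} {R : realType}.
Variables (P : probability Omega R) (U : Omega -> T1) (V : Omega -> T2).
Hypotheses (mU : measurable_fun setT U) (mV : measurable_fun setT V).
Hypothesis UV : forall A B, measurable A -> measurable B ->
  P (U @^-1` A `&` V @^-1` B) = (P (U @^-1` A) * P (V @^-1` B))%E.

Let Um : {RV P >-> T1} := mfun_Sub (mem_set mU).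
Let Vm : {RV P >-> T2} := mfun_Sub (mem_set mV).
Let UVm : {RV P >-> (T1 * T2)%type} :=
  mfun_Sub (mem_set (measurable_fun_pair mU mV)).

Let joint_distribution (X : set (T1 * T2)) : measurable X ->
  (distribution P Um \x distribution P Vm)%E X = distribution P UVm X.
Proof.
apply: product_measure_unique => A B mA mB.
by rewrite /= /pushforward -UV.
Qed.

(** The joint law is the product of the marginals, and Tonelli turns the integral of the absolute
    value into a product of two finite numbers. *)
Lemma independent_L1M (f : T1 -> R) (g : T2 -> R) :
  measurable_fun setT f -> measurable_fun setT g ->
  L1 P (f \o U) -> L1 P (g \o V) -> L1 P (fun w => f (U w) * g (V w)).
Proof.
move=> mf mg Lf Lg.
have mfg : measurable_fun setT (fun z : T1 * T2 => f z.1 * g z.2).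
  by apply: measurable_funM; exact: measurableT_comp.
apply/integrableP; split.
  by apply/measurable_EFinP/measurable_funM; exact: measurableT_comp.
have -> : (\int[P]_w `|(f (U w) * g (V w))%:E| =
    \int[distribution P UVm]_z `|f z.1 * g z.2|%:E)%E.
  rewrite ge0_integral_distribution//.
  by apply/measurable_EFinP; exact: measurableT_comp.
rewrite (eq_measure_integral (distribution P Um \x distribution P Vm)%E); last first.
  by move=> A mA _; apply/esym/joint_distribution.
rewrite fubini_tonelli1//; last first.
  by apply/measurable_EFinP; exact: measurableT_comp.
rewrite /fubini_F.
under eq_integral => x _.
  under eq_integral do rewrite /= normrM EFinM.
  rewrite ge0_integralZl//; last first.
    by apply/measurable_EFinP; exact: measurableT_comp.
  over.
rewrite ge0_integralZr//; last 2 first.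
- by apply/measurable_EFinP; exact: measurableT_comp.
- by apply: integral_ge0 => y _; rewrite lee_fin.
rewrite !ge0_integral_distribution//; last 2 first.
- by apply/measurable_EFinP; exact: measurableT_comp.
- by apply/measurable_EFinP; exact: measurableT_comp.
have fU := integrable_fin_num measurableT (L1_norm Lf).
have [_ gV] := integrableP _ _ _ Lg.
apply: lte_mul_pinfty => //.
by apply: integral_ge0 => w _; rewrite lee_fin.
Qed.

Lemma independent_ExM (f : T1 -> R) (g : T2 -> R) :
  measurable_fun setT f -> measurable_fun setT g ->
  L1 P (f \o U) -> L1 P (g \o V) ->
  Ex P (fun w => f (U w) * g (V w)) = Ex P (f \o U) * Ex P (g \o V).
Proof.
move=> mf mg Lf Lg.
have Lfg := independent_L1M mf mg Lf Lg.
have mfg : measurable_fun setT (fun z : T1 * T2 => f z.1 * g z.2).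
  by apply: measurable_funM; exact: measurableT_comp.
apply/EFin_inj; rewrite EFinM -!Ex_EFin//.
have -> : (\int[P]_w (f (U w) * g (V w))%:E =
    \int[distribution P UVm]_z (f z.1 * g z.2)%:E)%E.
  by rewrite integral_distribution//; exact/measurable_EFinP.
rewrite (eq_measure_integral (distribution P Um \x distribution P Vm)%E); last first.
  by move=> A mA _; apply/esym/joint_distribution.
rewrite -integral12_prod_meas1; last first.
  apply/integrableP; split; first exact/measurable_EFinP.
  rewrite (eq_measure_integral (distribution P UVm)); last first.
    by move=> A mA _; apply: joint_distribution.
  rewrite ge0_integral_distribution//.
    by case/integrableP : Lfg.
  by apply: measurableT_comp => //; exact/measurable_EFinP.
have LgV : (distribution P Vm).-integrable setT (EFin \o g).
  apply/integrableP; split; first exact/measurable_EFinP.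
  rewrite ge0_integral_distribution//; first by case/integrableP : Lg.
  by apply: measurableT_comp => //; exact/measurable_EFinP.
have LfU : (distribution P Um).-integrable setT (EFin \o f).
  apply/integrableP; split; first exact/measurable_EFinP.
  rewrite ge0_integral_distribution//; first by case/integrableP : Lf.
  by apply: measurableT_comp => //; exact/measurable_EFinP.
rewrite /fubini_F.
under eq_integral => x _.
  under eq_integral do rewrite /= EFinM.
  rewrite integralZl//.
  over.
rewrite -(fineK (integrable_fin_num measurableT LgV))// integralZr//.
rewrite (fineK (integrable_fin_num measurableT LgV))//.
by rewrite !integral_distribution//; exact/measurable_EFinP.
Qed.

End independence.

Section past.
Context {d dS : measure_display} {Omega : measurableType d}
  {S : measurableType dS} {R : realType}.
Variables (P : probability Omega R) (zeta : nat -> Omega -> S).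
Hypothesis zeta_iid : iid P zeta.

Let mzeta n : measurable_fun setT (zeta n).
Proof. by case: zeta_iid. Qed.

Definition cylinder (n : nat) (A : nat -> set S) : set Omega :=
  \bigcap_(i in `I_n) (zeta i @^-1` A i).

Definition past_cylinders (n : nat) : set (set Omega) :=
  [set E | exists2 A : nat -> set S,
     (forall i, measurable (A i)) & E = cylinder n A].

(* [past n] is [Omega] with the sigma-algebra of [zeta 0, ..., zeta n.-1]. *)
Definition past n := g_sigma_algebraType (past_cylinders n).

HB.instance Definition _ n := Measurable.on (past n).

Definition adapted n (U : Omega -> R) :=
  measurable_fun (setT : set (past n)) (U : past n -> R).

Let measurable_preimage n A : measurable A -> measurable (zeta n @^-1` A).
Proof. by move=> mA; rewrite -[_ @^-1` _]setTI; exact: mzeta. Qed.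

Let past_cylinders_measurable n : past_cylinders n `<=` measurable.
Proof.
move=> _ [A mA ->]; apply: bigcap_measurableType => i _; exact: measurable_preimage.
Qed.

Lemma past_measurable n E : <<s past_cylinders n >> E -> measurable E.
Proof.
exact: (smallest_sub (@sigma_algebra_measurable _ _) (@past_cylinders_measurable n)).
Qed.

Lemma adapted_measurable n U : adapted n U -> measurable_fun setT U.
Proof.
move=> aU _ B mB; rewrite setTI; apply: (@past_measurable n).
by rewrite -[_ @^-1` _]setTI; exact: aU.
Qed.

(** A cylinder over [k] steps becomes one over [n] steps when padded with [setT]. *)
Lemma adapted_le k n U : (k <= n)%N -> adapted k U -> adapted n U.
Proof.
move=> kn aU _ B mB; have : <<s past_cylinders k >> (U @^-1` B).
  by rewrite -[_ @^-1` _]setTI; exact: aU.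
rewrite setTI; apply: (@smallest_sub _ _ _ _ (smallest_sigma_algebra _ _)).
move=> _ [A mA ->]; apply: sub_sigma_algebra.
exists (fun i => if (i < k)%N then A i else setT); first by move=> i; case: ifP.
apply/seteqP; split => w wA i /= ni.
  by case: ifP => // ik; exact: wA.
by have := wA i (leq_trans ni kn); rewrite /= ni.
Qed.

Lemma adapted_zeta n i (v : S -> R) : (i < n)%N ->
  measurable_fun setT v -> adapted n (v \o zeta i).
Proof.
move=> ni mv _ B mB; rewrite setTI; apply: sub_sigma_algebra.
exists (fun j => if j == i then v @^-1` B else setT).
  move=> j; case: ifP => // _; rewrite -[_ @^-1` _]setTI; exact: mv.
apply/seteqP; split => w /=.
  by move=> vB j jn /=; case: eqP => // ->.
by move=> /(_ i ni) /=; rewrite eqxx.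
Qed.

Lemma cylinder_prob n (A : nat -> set S) : (forall i, measurable (A i)) ->
  P (cylinder n A) = (\prod_(0 <= i < n) P (zeta i @^-1` A i))%E.
Proof.
move=> mA; have [_ ind _] := zeta_iid.
have := ind [fset i in iota 0 n]%fset A mA.
rewrite (perm_big (iota 0 n))/=; last first.
  by apply: uniq_perm; rewrite ?fset_uniq ?iota_uniq// => i; rewrite inE.
rewrite /index_iota subn0 => <-; congr (P _).
by apply/seteqP; split => w wA i /= ni; apply: wA; move: ni; rewrite /= inE mem_iota.
Qed.

Let measure_setI (B : set Omega) (mB : measurable B) :
  {m : {measure set Omega -> \bar R} | forall A, m A = P (A `&` B)}.
Proof. by exists (mrestr P mB). Qed.

Let measure_mul (B : set Omega) (mB : measurable B) :
  {m : {measure set Omega -> \bar R} | forall A, m A = (P A * P B)%E}.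
Proof.
have B0 : (0 <= fine (P B))%R by exact: fine_ge0.
exists (mscale (NngNum B0) P) => A.
by rewrite /mscale/= muleC -[in RHS](fineK (fin_num_measure P B mB)).
Qed.

(** Both sides are finite measures in [E]. They agree on cylinders, which are stable under
    intersection, contain the whole space and generate the past. *)
Lemma past_independent n (E : set Omega) (B : set S) :
  <<s past_cylinders n >> E -> measurable B ->
  P (E `&` zeta n @^-1` B) = (P E * P (zeta n @^-1` B))%E.
Proof.
move=> nE mB; have mB' := measurable_preimage n mB.
have [m1 m1E] := measure_setI mB'; have [m2 m2E] := measure_mul mB'.
rewrite -m1E -m2E.
apply: (@g_sigma_algebra_measure_unique _ _ _ (past_cylinders n) _
  (fun=> setT)) => //.
- move=> _; exists (fun=> setT) => //.
  by apply/seteqP; split => w.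
- by apply/seteqP; split => w // _; exists 0%N.
- move=> _ _ [A mA ->] [A' mA' ->]; exists (fun i => A i `&` A' i).
    by move=> i; exact: measurableI.
  by rewrite /cylinder -bigcapI; apply: eq_bigcapr => i _; rewrite preimage_setI.
- move=> _ [A mA ->]; rewrite m1E m2E.
  have [_ ind _] := zeta_iid.
  (* With [B] in slot [n] the intersection is itself a cylinder, of length [n.+1], and its
     probability is a product. *)
  pose A' i := if i == n then B else A i.
  have mA' i : measurable (A' i) by rewrite /A'; case: ifP.
  have -> : cylinder n A = cylinder n A'.
    by apply: eq_bigcapr => i /= ni; rewrite /A' ltn_eqF.
  have -> : cylinder n A' `&` zeta n @^-1` B = cylinder n.+1 A'.
    apply/seteqP; split => [w [nA nB] i|w nA].
      rewrite /= ltnS leq_eqVlt => /predU1P[->|ni]; last exact: nA.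
      by rewrite /A' eqxx.
    split; first by move=> i /= ni; apply: nA; exact: ltnW.
    by have := nA n (ltnSn n); rewrite /A' eqxx.
  rewrite !cylinder_prob// big_nat_recr//=; congr (_ * _)%E.
  by rewrite /A' eqxx.
- by move=> k; rewrite m1E setTI (le_lt_trans (probability_le1 _ _))// ltry.
Qed.

Let zeta_rv n : {RV P >-> S} := mfun_Sub (mem_set (mzeta n)).

Let law_eq n A : measurable A ->
  distribution P (zeta_rv n) A = distribution P (zeta_rv 0%N) A.
Proof. by move=> mA; case: zeta_iid => _ _; apply. Qed.

Lemma iid_L1 n (v : S -> R) : measurable_fun setT v ->
  L1 P (v \o zeta 0%N) -> L1 P (v \o zeta n).
Proof.
move=> mv /integrableP[_ v0]; apply/integrableP; split.
  by apply/measurable_EFinP; exact: measurableT_comp.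
rewrite -(ge0_integral_distribution (zeta_rv n) (f := fun s => `|v s|%:E))//; last first.
  by apply/measurable_EFinP; exact: measurableT_comp.
rewrite (eq_measure_integral (distribution P (zeta_rv 0%N))); last first.
  by move=> A mA _; exact: law_eq.
rewrite ge0_integral_distribution//.
by apply/measurable_EFinP; exact: measurableT_comp.
Qed.

Lemma iid_Ex n (v : S -> R) : measurable_fun setT v ->
  L1 P (v \o zeta 0%N) -> Ex P (v \o zeta n) = Ex P (v \o zeta 0%N).
Proof.
move=> mv Lv; have Lvn := iid_L1 n mv Lv.
have mv' : measurable_fun setT (EFin \o v) by exact/measurable_EFinP.
congr fine.
rewrite -(integral_distribution (X := zeta_rv n) mv' Lvn).
rewrite (eq_measure_integral (distribution P (zeta_rv 0%N))); last first.
  by move=> A mA _; exact: law_eq.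
by rewrite (integral_distribution (X := zeta_rv 0%N) mv' Lv).
Qed.

Let measurable_id_past n : measurable_fun setT (id : Omega -> past n).
Proof. by move=> _ B mB; rewrite setTI; exact: (@past_measurable n). Qed.

Section product.
Variables (n : nat) (U : Omega -> R) (v : S -> R).
Hypotheses (aU : adapted n U) (mv : measurable_fun setT v)
  (LU : L1 P U) (Lv : L1 P (v \o zeta 0%N)).

(** The past enters as a single random variable, the identity from [Omega] to [past n]: an adapted
    [U] is a measurable function of it. *)
Lemma adapted_L1M : L1 P (fun w => U w * v (zeta n w)).
Proof.
apply: (@independent_L1M _ _ _ _ (past n) S _ P (id : Omega -> past n) (zeta n)) => //.
- by move=> A B mA mB; exact: past_independent.
- exact: iid_L1.
Qed.

Lemma adapted_ExM :
  Ex P (fun w => U w * v (zeta n w)) = Ex P U * Ex P (v \o zeta 0%N).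
Proof.
rewrite -(iid_Ex n mv Lv).
apply: (@independent_ExM _ _ _ _ (past n) S _ P (id : Omega -> past n) (zeta n)) => //.
- by move=> A B mA mB; exact: past_independent.
- exact: iid_L1.
Qed.

End product.

End past.

(** * Inequalities for real powers *)

Section real_inequalities.
Context {R : realType}.
Implicit Types (x y z p t u : R).

Lemma expRN_le_inv x : 0 <= x -> expR (- x) <= (1 + x)^-1.
Proof.
move=> x0; rewrite expRN lef_pV2 ?posrE ?expR_gt0 ?expR_ge1Dx//; lra.
Qed.

(** For [z >= 0] apply [expR z - 1 <= z * expR z] twice; for [z < 0] compare with [1 / (1 - z)]. *)
Lemma expR_le_quadratic z : expR z <= 1 + z + z ^+ 2 * expR `|z|.
Proof.
case: (ger0P z) => z0.
  have E : expR z - 1 <= z * expR z.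
    have := expR_ge1Dx (- z); rewrite expRN => h.
    have e0 := expR_gt0 z.
    have : (1 - z) * expR z <= (expR z)^-1 * expR z by rewrite ler_pM2r.
    by rewrite mulVf ?gt_eqF//; lra.
  have E2 : z * (expR z - 1) <= z * (z * expR z) by rewrite ler_wpM2l.
  rewrite expr2; nra.
have s0 : 0 <= - z by lra.
have := expRN_le_inv s0; rewrite opprK => h.
have h2 : (1 + - z)^-1 <= 1 + z + z ^+ 2.
  have z1 : 0 < 1 + - z by lra.
  rewrite -(ler_pM2r z1) mulVf ?gt_eqF//; nra.
have : z ^+ 2 * 1 <= z ^+ 2 * expR (- z).
  by rewrite ler_wpM2l ?sqr_ge0//; have := expR_ge1Dx (- z); lra.
lra.
Qed.

Lemma powR_mono p x y : 0 <= p -> 0 <= x -> x <= y -> x `^ p <= y `^ p.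
Proof.
move=> p0 x0 xy; apply: ge0_ler_powR => //; rewrite ?nnegrE//; exact: le_trans xy.
Qed.

Lemma powRS x p : 0 <= x -> 0 <= p -> x `^ (p + 1) = x * x `^ p.
Proof.
move=> x0 p0; rewrite -[in RHS](@addrK _ 1 p) mulr_powRB1//; lra.
Qed.

(** The first two terms pay for the left side and for the linear term when [|x| <= |y|], the third
    for the second-order remainder when [|y| < |x|]. *)
Definition taylor_cst p := 2 `^ p + p + p ^+ 2 * expR p.

Lemma taylor_cst_gt0 p : 2 <= p -> 0 < taylor_cst p.
Proof.
move=> p2; rewrite /taylor_cst.
have := powR_ge0 2 p; have := expR_ge0 p; nra.
Qed.

(** A Taylor bound with the linear term kept exact, because it integrates to 0 against an
    independent centered [y]. If [|x| <= |y|] every term is compared with the p-th power of [|y|].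
    Otherwise [y = x * u] with [|u| < 1], and the p-th power of [1 + u] is at most
    [expR (p * u)]. *)
Lemma powR_normD p x y : 2 <= p ->
  `|x + y| `^ p <= `|x| `^ p + p * (`|x| `^ (p - 1) * Num.sg x) * y
                   + taylor_cst p * (`|x| `^ (p - 2) * y ^+ 2 + `|y| `^ p).
Proof.
move=> p2; have p0 : 0 <= p by lra.
have C0 := taylor_cst_gt0 p2.
have Y2 : 0 <= `|x| `^ (p - 2) * y ^+ 2 by rewrite mulr_ge0 ?powR_ge0 ?sqr_ge0.
have Yp := powR_ge0 `|y| p; have Xp := powR_ge0 `|x| p.
have e0 := expR_ge0 p.
have [xy|yx] := lerP `|x| `|y|.
  have H1 : `|x + y| `^ p <= 2 `^ p * `|y| `^ p.
    rewrite -powRM//; apply: powR_mono => //; have := ler_normD x y; lra.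
  have H2 : `|(`|x| `^ (p - 1) * Num.sg x) * y| <= `|y| `^ p.
    rewrite !normrM ger0_norm ?powR_ge0//.
    rewrite -(@mulr_powRB1 _ `|y| p) //; last lra.
    rewrite mulrC ler_wpM2l// normr_sg.
    rewrite (@le_trans _ _ (`|x| `^ (p - 1)))//.
      by case: (_ != _); rewrite ?mulr1 ?mulr0 ?powR_ge0.
    by apply: powR_mono => //; lra.
  move: H2; rewrite ler_norml => /andP[H2 _].
  have := ler_wpM2l p0 H2; rewrite -mulrA /taylor_cst.
  have := mulr_ge0 (mulr_ge0 (sqr_ge0 p) e0) Yp.
  have := mulr_ge0 (ltW C0) Y2; rewrite /taylor_cst; nra.
have x0 : x != 0 by rewrite -normr_gt0 (le_lt_trans _ yx).
have x0' : 0 < `|x| by rewrite normr_gt0.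
set u := y / x.
have yE : y = x * u by rewrite /u mulrC divfK.
have u1 : `|u| < 1 by rewrite /u normf_div ltr_pdivrMr// mul1r.
have u1' : -1 < u < 1 by rewrite -ltr_norml.
clearbody u; subst y.
have -> : `|x + x * u| = `|x| * (1 + u).
  have -> : x + x * u = x * (1 + u) by ring.
  by rewrite normrM (ger0_norm (_ : 0 <= 1 + u))//; lra.
rewrite powRM//; [|lra].
have -> : `|x| `^ p + p * (`|x| `^ (p - 1) * Num.sg x) * (x * u) =
    `|x| `^ p * (1 + p * u).
  rewrite -(@mulr_powRB1 _ `|x| p)//; last lra.
  transitivity (`|x| * `|x| `^ (p - 1) + p * u * `|x| `^ (p - 1) * (Num.sg x * x)).
    by ring.
  by rewrite -normrEsg; ring.
have -> : `|x| `^ (p - 2) * (x * u) ^+ 2 = `|x| `^ p * u ^+ 2.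
  rewrite exprMn -[x ^+ 2]real_normK ?num_real// mulrA; congr (_ * _).
  rewrite -[in RHS](@mulr_powRB1 _ `|x| p)//; last lra.
  rewrite -[in RHS](@mulr_powRB1 _ `|x| (p - 1)) ?expr2; [|lra..].
  by rewrite (_ : p - 1 - 1 = p - 2); [ring|ring].
have H : (1 + u) `^ p <= 1 + p * u + p ^+ 2 * expR p * u ^+ 2.
  have u10 : 0 < 1 + u by lra.
  rewrite /powR gt_eqF//.
  have lnu : ln (1 + u) <= u by have := le_ln1Dx (x := u); apply; lra.
  apply: (@le_trans _ _ (expR (p * u))); first by rewrite ler_expR ler_wpM2l.
  apply: (le_trans (expR_le_quadratic _)).
  rewrite lerD2l exprMn mulrAC ler_wpM2r ?sqr_ge0// ler_wpM2l ?sqr_ge0//.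
  rewrite ler_expR normrM (ger0_norm p0).
  by rewrite ler_piMr// ltW.
have := ler_wpM2l Xp H.
have := mulr_ge0 (powR_ge0 2 p) (mulr_ge0 Xp (sqr_ge0 u)).
have := mulr_ge0 p0 (mulr_ge0 Xp (sqr_ge0 u)).
have := mulr_ge0 (ltW C0) Yp.
rewrite /taylor_cst; lra.
Qed.

End real_inequalities.

Lemma discount_distribute {R : realType} (r q e X D Y C A B : R) :
  e * q * (C * (A + B)) <= e * (C * (A + B)) ->
  e * q * (X + r * D * Y + C * (A + B)) <=
  e * X * q + r * (e * D * (q * Y)) + C * (e * A + e * B).
Proof. by move=> h; lra. Qed.

Lemma ler_sum_shift {R : realType} (f : nat -> R) m : f 0%N = 0 ->
  (forall i, 0 <= f i) -> \sum_(i < m) f i <= \sum_(i < m) f i.+1.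
Proof.
move=> f0 fge0; case: m => [|m]; first by rewrite !big_ord0.
by rewrite big_ord_recl f0 add0r big_ord_recr/= lerDl.
Qed.

(** Either [e] times the power [p - q] of [u] is at least 1, and the first term suffices, or [u]
    lies below the threshold where that product equals 1, and the second term does. *)
Lemma young_powR {R : realType} (u q p e : R) : 0 <= u -> 0 <= q < p -> 0 < e ->
  u `^ q <= e * u `^ p + e `^ (- (q / (p - q))).
Proof.
move=> u0 /andP[q0 qp] e0; have pq : 0 < p - q by lra.
have [h|h] := lerP 1 (e * u `^ (p - q)).
  have un0 : u != 0.
    apply/eqP => u00; move: h; rewrite u00 powR0 ?mulr0 ?ler10//.
    by rewrite gt_eqF.
  have -> : u `^ p = u `^ (p - q) * u `^ q.
    by rewrite -powRD ?un0 ?implybT// subrK.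
  have := ler_wpM2r (powR_ge0 u q) h; have := powR_ge0 e (- (q / (p - q))); lra.
have uq : u <= e `^ (- (p - q)^-1).
  have -> : e `^ (- (p - q)^-1) = (e^-1) `^ (p - q)^-1.
    by rewrite -(powR_inv1 (ltW e0)) -powRrM mulN1r.
  rewrite -[leLHS]powRr1// -(mulfV (lt0r_neq0 pq)) powRrM.
  apply: powR_mono; rewrite ?powR_ge0 ?invr_ge0//; first exact: ltW.
  by rewrite -(ler_pM2l e0) mulfV ?gt_eqF// ltW.
have := mulr_ge0 (ltW e0) (powR_ge0 u p).
have -> : - (q / (p - q)) = (- (p - q)^-1) * q by ring.
by rewrite powRrM; have := powR_mono q0 u0 uq; lra.
Qed.

Section moment_closure.
Context {d : measure_display} {T : measurableType d} {R : realType}.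
Variable P : probability T R.
Implicit Types f g : T -> R.

Lemma powR_le1D (u q p : R) : 0 <= u -> 0 <= q <= p -> u `^ q <= 1 + u `^ p.
Proof.
move=> u0 /andP[q0 qp]; have [u1|u1] := lerP 1 u.
  by apply: (le_trans (ler_powR u1 qp)); rewrite lerDr.
apply: (@le_trans _ _ (1 `^ q)); first by apply: powR_mono => //; exact: ltW.
by rewrite powR1 lerDl powR_ge0.
Qed.

Lemma powR_normD_le (p u v : R) : 0 <= p ->
  `|u + v| `^ p <= 2 `^ p * (`|u| `^ p + `|v| `^ p).
Proof.
move=> p0; have [uv|vu] := lerP `|u| `|v|.
  apply: (@le_trans _ _ ((2 * `|v|) `^ p)).
    by apply: powR_mono => //; have := ler_normD u v; lra.
  by rewrite powRM// ler_wpM2l ?powR_ge0// lerDr powR_ge0.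
apply: (@le_trans _ _ ((2 * `|u|) `^ p)).
  by apply: powR_mono => //; have := ler_normD u v; lra.
by rewrite powRM// ler_wpM2l ?powR_ge0// lerDl powR_ge0.
Qed.

Lemma L1_pow_le f q p : measurable_fun setT f -> 0 <= q <= p ->
  L1 P (fun w => `|f w| `^ p) -> L1 P (fun w => `|f w| `^ q).
Proof.
move=> mf qp Lf; apply: (@L1_dominated _ _ _ _ _ (fun w => 1 + `|f w| `^ p)).
- by meas.
- by apply: L1D => //; exact: L1_cst.
- by move=> w; rewrite powR_ge0/= powR_le1D.
Qed.

Lemma L1_powD f g p : measurable_fun setT f -> measurable_fun setT g -> 0 <= p ->
  L1 P (fun w => `|f w| `^ p) -> L1 P (fun w => `|g w| `^ p) ->
  L1 P (fun w => `|f w + g w| `^ p).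
Proof.
move=> mf mg p0 Lf Lg.
apply: (@L1_dominated _ _ _ _ _ (fun w => 2 `^ p * (`|f w| `^ p + `|g w| `^ p))).
- by meas.
- by apply: L1Z; exact: L1D.
- by move=> w; rewrite powR_ge0/= powR_normD_le.
Qed.

Lemma L1_sqr f p : measurable_fun setT f -> 2 <= p ->
  L1 P (fun w => `|f w| `^ p) -> L1 P (fun w => f w ^+ 2).
Proof.
move=> mf p2 Lf; rewrite (_ : (fun w => _) = (fun w => `|f w| `^ 2)).
  by apply: L1_pow_le Lf => //; lra.
by apply/funext => w; rewrite powR_mulrn// real_normK// num_real.
Qed.

Lemma L1_of_pow f p : measurable_fun setT f -> 1 <= p ->
  L1 P (fun w => `|f w| `^ p) -> L1 P f.
Proof.
move=> mf p1 Lf; apply: (@L1_le _ _ _ _ _ (fun w => `|f w| `^ 1)) => //.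
  by move=> w; rewrite powRr1.
by apply: L1_pow_le Lf => //; lra.
Qed.

Lemma L1_mul_bounded f g (c : R) : measurable_fun setT f ->
  (forall w, `|f w| <= c) -> L1 P g -> L1 P (fun w => f w * g w).
Proof.
move=> mf fc Lg; have mg := L1_measurable Lg.
apply: (@L1_le _ _ _ _ _ (fun w => c * `|g w|)).
- by meas.
- by move=> w; rewrite normrM ler_wpM2r.
- by apply: L1Z; exact: L1_norm.
Qed.

(** If the integral were 0, [f] would vanish almost everywhere and the whole space would be null. *)
Lemma Ex_gt0 f : L1 P f -> (forall w, 0 < f w) -> 0 < Ex P f.
Proof.
move=> Lf f0; rewrite lt_neqAle Ex_ge0 ?andbT; last by move=> w; exact: ltW.
apply/eqP => E0; have mf := L1_measurable Lf.
have : (\int[P]_w `|(f w)%:E| = 0)%E.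
  by under eq_integral do rewrite gee0_abs ?lee_fin ?ltW//; rewrite Ex_EFin// -E0.
have mf' : measurable_fun setT (EFin \o f) by exact/measurable_EFinP.
move=> /(ae_eq_integral_abs P measurableT mf').1 [N [mN N0 subN]].
have NT : N = setT.
  apply/seteqP; split => // w _; apply: subN => /= /(_ I) /eqP.
  by rewrite eqe gt_eqF.
by have := probability_setT P; rewrite -NT N0 => /eqP; rewrite eqe eq_sym oner_eq0.
Qed.

End moment_closure.

(** * Moments of the stopped walk *)

Section stopped_walk.
Context {d dS : measure_display} {Omega : measurableType d}
  {St : measurableType dS} {R : realType}.
Variables (P : probability Omega R) (zeta : nat -> Omega -> St).
Hypothesis zeta_iid : iid P zeta.

Definition walk (v : St -> R) n w := \sum_(i < n) v (zeta i w).

Let mzeta n : measurable_fun setT (zeta n).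
Proof. by case: zeta_iid. Qed.

Lemma walkS v n w : walk v n.+1 w = walk v n w + v (zeta n w).
Proof. by rewrite /walk big_ord_recr. Qed.

Lemma walk0 v w : walk v 0 w = 0.
Proof. by rewrite /walk big_ord0. Qed.

Lemma adapted_walk v n k : measurable_fun setT v -> (k <= n)%N ->
  adapted zeta n (walk v k).
Proof.
move=> mv kn; apply: mf_sum => i; apply: (@adapted_zeta _ _ _ _ _ zeta n i v) => //.
exact: leq_trans (ltn_ord i) kn.
Qed.

Lemma measurable_step (v : St -> R) n : measurable_fun setT v ->
  measurable_fun setT (fun w => v (zeta n w)).
Proof. by move=> mv; exact: measurableT_comp. Qed.

Lemma measurable_walk (v : St -> R) n : measurable_fun setT v -> measurable_fun setT (walk v n).
Proof. by move=> mv; apply: mf_sum => i; exact: measurable_step. Qed.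

Lemma L1_walk_pow (v : St -> R) n (p : R) : measurable_fun setT v -> 0 < p ->
  L1 P (fun w => `|v (zeta 0%N w)| `^ p) -> L1 P (fun w => `|walk v n w| `^ p).
Proof.
move=> mv p0 Lv; elim: n => [|n IH].
  rewrite (_ : (fun w => _) = (fun=> 0)); first exact: L1_cst.
  by apply/funext => w; rewrite walk0 normr0 powR0// gt_eqF.
rewrite (_ : (fun w => _) = (fun w => `|walk v n w + v (zeta n w)| `^ p)).
  apply: L1_powD => //; [exact: measurable_walk|exact: measurable_step|exact: ltW|].
  apply: (iid_L1 zeta_iid n (v := fun s => `|v s| `^ p)) => //.
  by meas.
by apply/funext => w; rewrite walkS.
Qed.

Section clock.
Variable x : St -> R.
Hypotheses (mx : measurable_fun setT x) (x_gt0 : forall i w, 0 < x (zeta i w)).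
Hypothesis Lx2 : L1 P (fun w => x (zeta 0%N w) ^+ 2).

(** It says that interval [i] has begun by time [t] and involves only the steps before [i]: it is
    independent of step [i], although that step may end after [t]. *)
Definition running (t : R) i w : R := (walk x i w <= t)%R%:R.

(* Once [walk x m > t] this is the walk at the end of the renewal interval containing
   [t], see [stopped_cases]; with [m] finite no summability question arises. *)
Definition stopped (t : R) (v : St -> R) m w := \sum_(i < m) running t i w * v (zeta i w).

Lemma stoppedS (t : R) v m w :
  stopped t v m.+1 w = stopped t v m w + running t m w * v (zeta m w).
Proof. by rewrite /stopped big_ord_recr. Qed.

Lemma stopped0 (t : R) v w : stopped t v 0 w = 0.
Proof. by rewrite /stopped big_ord0. Qed.

Lemma running_bound (t : R) i w : 0 <= running t i w <= 1.
Proof. by rewrite /running ler0n lern1 leq_b1. Qed.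

Lemma walk_ge0 n w : 0 <= walk x n w.
Proof. by apply: sumr_ge0 => i _; exact: ltW. Qed.

Lemma walk_lt n w : walk x n w < walk x n.+1 w.
Proof. by rewrite walkS ltrDl. Qed.

Lemma running_nonincreasing (t : R) i j w : (i <= j)%N -> running t j w <= running t i w.
Proof.
move=> ij; have T_nd : walk x i w <= walk x j w.
  elim: j ij => [|j IH]; first by rewrite leqn0 => /eqP->.
  rewrite leq_eqVlt => /predU1P[->//|ij].
  by rewrite (le_trans (IH ij))// ltW// walk_lt.
rewrite /running ler_nat; case: (lerP (walk x j w) t) => [jt|//].
by rewrite (le_trans T_nd jt).
Qed.

Lemma stopped_eq_walk (t : R) v m w : 0 < running t m w -> stopped t v m w = walk v m w.
Proof.
move=> rm; apply: eq_bigr => i _.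
have := running_nonincreasing t w (ltnW (ltn_ord i)).
move: rm; rewrite /running; case: (walk x m w <= t)%R; last by rewrite ltxx.
by case: (walk x i w <= t)%R => _; rewrite ?mul1r//= ler10.
Qed.

Lemma adapted_running (t : R) n k : (k <= n)%N -> adapted zeta n (running t k).
Proof.
move=> kn; have aw := adapted_walk mx kn.
by rewrite /adapted /running; unfold adapted in aw; meas.
Qed.

Lemma adapted_stopped (t : R) v n k : measurable_fun setT v -> (k <= n)%N ->
  adapted zeta n (stopped t v k).
Proof.
move=> mv kn; apply: mf_sum => i; apply: measurable_funM.
  apply: adapted_running; exact: leq_trans (ltnW (ltn_ord i)) kn.
apply: (@adapted_zeta _ _ _ _ _ zeta n i v) => //.
exact: leq_trans (ltn_ord i) kn.
Qed.

Lemma measurable_running (t : R) k : measurable_fun setT (running t k).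
Proof. exact: (adapted_measurable zeta_iid (adapted_running t (leqnn k))). Qed.

Lemma L1_running (t : R) k : L1 P (running t k).
Proof.
apply: (@L1_bounded _ _ _ _ _ 1); first exact: measurable_running.
by move=> w; have /andP[r0 r1] := running_bound t k w; rewrite ger0_norm.
Qed.

Lemma measurable_stopped (t : R) (v : St -> R) m : measurable_fun setT v ->
  measurable_fun setT (stopped t v m).
Proof. move=> mv; exact: (adapted_measurable zeta_iid (adapted_stopped t mv (leqnn m))). Qed.

Lemma L1_stopped_pow (t : R) (v : St -> R) m (p : R) : measurable_fun setT v -> 0 < p ->
  L1 P (fun w => `|v (zeta 0%N w)| `^ p) -> L1 P (fun w => `|stopped t v m w| `^ p).
Proof.
move=> mv p0 Lv; elim: m => [|m IH].
  rewrite (_ : (fun w => _) = (fun=> 0)); first exact: L1_cst.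
  by apply/funext => w; rewrite stopped0 normr0 powR0// gt_eqF.
under eq_fun do rewrite stoppedS.
have mr := measurable_running t m.
apply: L1_powD => //; [exact: measurable_stopped| |exact: ltW|].
  by apply: measurable_funM => //; exact: measurable_step.
apply: (@L1_dominated _ _ _ _ _ (fun w => `|v (zeta m w)| `^ p)).
- by have ? := measurable_step m mv; meas.
- apply: (iid_L1 zeta_iid m (v := fun s => `|v s| `^ p)) => //.
  by meas.
- move=> w; rewrite powR_ge0/=; apply: powR_mono => //; first exact: ltW.
  have /andP[r0 r1] := running_bound t m w.
  by rewrite normrM ger0_norm// ler_piMl.
Qed.

Let Lx : L1 P (fun w => x (zeta 0%N w)).
Proof. by apply: L1_of_sqr => //; exact: measurable_step. Qed.

Definition laplace (lam : R) := Ex P (fun w => expR (- (lam * x (zeta 0%N w)))).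

(** The contraction constant: discounting at rate [1 / t] multiplies expectations by at most
    [1 - laplace_gap / t]. *)
Definition laplace_gap := Ex P (fun w => 1 - expR (- x (zeta 0%N w))).

Let m_discount (lam : R) i : measurable_fun setT (fun w => expR (- (lam * x (zeta i w)))).
Proof. by have ? := measurable_step i mx; meas. Qed.

Let discount_bound (lam : R) i w : 0 < lam -> 0 < expR (- (lam * x (zeta i w))) <= 1.
Proof. by move=> l0; rewrite expR_gt0 expR_le1 oppr_le0 mulr_ge0 ?ltW. Qed.

Let L1_discount (lam : R) i : 0 < lam -> L1 P (fun w => expR (- (lam * x (zeta i w)))).
Proof.
move=> l0; apply: (@L1_bounded _ _ _ _ _ 1) => // w.
by have /andP[? ?] := discount_bound i w l0; rewrite ger0_norm// ltW.
Qed.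

Lemma laplace_gap_gt0 : 0 < laplace_gap.
Proof.
apply: Ex_gt0 => [|w]; last by rewrite subr_gt0 expR_lt1 oppr_lt0.
apply: L1B; first exact: L1_cst.
have := L1_discount 0 (@ltr01 R); rewrite /L1; congr (integrable _ _ _).
by apply/funext => w; rewrite /= mul1r.
Qed.

(** For fixed [u] the map [lam |-> expR (- lam * u)] is convex, hence below its chord on
    [[0, 1]]. *)
Lemma laplace_le (lam : R) : 0 < lam <= 1 -> laplace lam <= 1 - lam * laplace_gap.
Proof.
move=> /andP[l0 l1].
have L1' : L1 P (fun w => expR (- x (zeta 0%N w))).
  have := L1_discount 0 (@ltr01 R); rewrite /L1; congr (integrable _ _ _).
  by apply/funext => w; rewrite /= mul1r.
have L1'' : L1 P (fun w => 1 - expR (- x (zeta 0%N w))).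
  by apply: L1B => //; exact: L1_cst.
rewrite -[X in X - _](Ex_cst P 1) -ExZ// -ExB//; [|exact: L1_cst|exact: L1Z].
apply: le_Ex => [||w]; [exact: L1_discount|by apply: L1B; [exact: L1_cst|exact: L1Z]|].
set u := x _; set v := expR (- (lam * u)).
have v0 : 0 < v := expR_gt0 _.
(* [h1] and [h2] are the tangent at [lam] read at 1 and at 0; the weights [lam] and [1 - lam]
   recombine them to [v]. *)
have h1 : v * (1 - u + lam * u) <= expR (- u).
  rewrite (_ : - u = - (lam * u) + (- u + lam * u)); last by ring.
  rewrite expRD ler_pM2l//; have := expR_ge1Dx (- u + lam * u); lra.
have h2 : v * (1 + lam * u) <= 1.
  rewrite -[leRHS](expRxMexpNx_1 (- (lam * u))) opprK ler_pM2l//.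
  exact: expR_ge1Dx.
have := ler_wpM2l (ltW l0) h1.
have l1' : 0 <= 1 - lam by lra.
by have := ler_wpM2l l1' h2; lra.
Qed.


(** * Exponentially discounted moments, for a step with normalised p-th moment *)

Section discounted.
Variables (t p : R) (y : St -> R).
Hypotheses (t1 : 1 <= t) (p2 : 2 <= p) (my : measurable_fun setT y).
Hypothesis Ey0 : Ex P (fun w => y (zeta 0%N w)) = 0.
Hypothesis Lyp : L1 P (fun w => `|y (zeta 0%N w)| `^ p).
Hypothesis Eyp : Ex P (fun w => `|y (zeta 0%N w)| `^ p) <= 1.

Let t0 : 0 < t. Proof. exact: lt_le_trans t1. Qed.
Let ti : 0 < t^-1 <= 1. Proof. by rewrite invr_gt0 t0 invf_le1. Qed.
Let ti0 : 0 < t^-1. Proof. by case/andP: ti. Qed.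

(* A product of independent factors, unlike the indicator of [walk x n <= t], which it
   dominates up to the factor [expR 1]. *)
Let disc n w := expR (- (t^-1 * walk x n w)).

Let discS n w : disc n.+1 w = disc n w * expR (- (t^-1 * x (zeta n w))).
Proof. by rewrite /disc walkS mulrDr opprD expRD. Qed.

Let disc_bound n w : 0 <= disc n w <= 1.
Proof.
by rewrite /disc expR_ge0 expR_le1 oppr_le0 mulr_ge0 ?walk_ge0// ltW.
Qed.

Let adapted_disc n : adapted zeta n (disc n).
Proof.
have aw := adapted_walk mx (leqnn n); rewrite /adapted in aw *.
by rewrite /disc; meas.
Qed.

Let m_disc n : measurable_fun setT (disc n).
Proof. exact: (adapted_measurable zeta_iid (@adapted_disc n)). Qed.

Let L1_disc n : L1 P (disc n).
Proof.
apply: (@L1_bounded _ _ _ _ _ 1) => // w.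
by have /andP[? ?] := disc_bound n w; rewrite ger0_norm.
Qed.

Let mstep : measurable_fun setT (fun s => expR (- (t^-1 * x s))).
Proof. by meas. Qed.

Lemma Ex_disc n : Ex P (disc n) = laplace t^-1 ^+ n.
Proof.
elim: n => [|n IH].
  rewrite expr0 -[RHS](Ex_cst P); congr (Ex P); apply/funext => w.
  by rewrite /disc walk0 mulr0 oppr0 expR0.
rewrite (funext (discS n)).
rewrite (adapted_ExM zeta_iid (@adapted_disc n) mstep) ?IH ?exprSr//.
exact: L1_discount.
Qed.

(** A geometric series of ratio at most [1 - laplace_gap / t]: the total discounted mass is of order
    [t], uniformly in [m]. *)
Lemma sum_disc m : \sum_(i < m) Ex P (disc i) <= t / laplace_gap.
Proof.
have c0 := laplace_gap_gt0; have := laplace_le ti.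
have : 0 <= laplace t^-1 by apply: Ex_ge0 => w; exact: expR_ge0.
set q := laplace t^-1 => q0 qc.
have tc : 0 < t^-1 * laplace_gap by rewrite mulr_gt0.
under eq_bigr do rewrite Ex_disc -/q.
have : (1 - q) * (\sum_(i < m) q ^+ i) <= 1.
  rewrite -opprB mulNr -subrX1 opprB lerBlDr lerDl exprn_ge0//.
have s0 : 0 <= \sum_(i < m) q ^+ i by apply: sumr_ge0 => i _; exact: exprn_ge0.
move=> h; have : t^-1 * laplace_gap * (\sum_(i < m) q ^+ i) <= 1.
  apply: le_trans h; apply: ler_wpM2r => //; lra.
rewrite -ler_pdivlMl// mulr1 => /le_trans; apply.
by rewrite invfM invrK.
Qed.

Let Sp n (q : R) : 0 <= q <= p ->
  L1 P (fun w => `|walk y n w| `^ q).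
Proof.
move=> qp; apply: (L1_pow_le _ qp); first exact: measurable_walk.
have p0 : 0 < p by exact: lt_le_trans p2.
exact: (L1_walk_pow n my p0 Lyp).
Qed.

Let dSp n (q : R) : 0 <= q <= p -> L1 P (fun w => disc n w * `|walk y n w| `^ q).
Proof.
move=> qp; apply: (@L1_mul_bounded _ _ _ _ _ _ 1) => //; last exact: Sp.
by move=> w; have /andP[? ?] := disc_bound n w; rewrite ger0_norm.
Qed.

Definition discounted_moment (q : R) n := Ex P (fun w => disc n w * `|walk y n w| `^ q).

Let g := discounted_moment.

Lemma discounted_moment_ge0 q n : 0 <= g q n.
Proof.
by apply: Ex_ge0 => w; have /andP[? _] := disc_bound n w; rewrite mulr_ge0 ?powR_ge0.
Qed.

Let Ly2 : L1 P (fun w => y (zeta 0%N w) ^+ 2).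
Proof. by apply: (L1_sqr _ p2) => //; exact: measurable_step. Qed.

Let Ly : L1 P (fun w => y (zeta 0%N w)).
Proof. by apply: L1_of_sqr => //; exact: measurable_step. Qed.

Lemma Ex_sqr_le2 : Ex P (fun w => y (zeta 0%N w) ^+ 2) <= 2.
Proof.
apply: (@le_trans _ _ (Ex P (fun w => 1 + `|y (zeta 0%N w)| `^ p))).
  apply: le_Ex => // [|w]; first by apply: L1D => //; exact: L1_cst.
  rewrite -real_normK ?num_real// -powR_mulrn//; apply: powR_le1D => //.
  by rewrite ler0n.
rewrite (ExD (L1_cst P 1) Lyp) Ex_cst.
move: Eyp; set E := Ex _ _ => Eyp'.
lra.
Qed.

(* Discounting tilts the law of a step; its mean moves by O(1/t) only. *)
Lemma tilted_mean : `|Ex P (fun w => expR (- (t^-1 * x (zeta 0%N w))) * y (zeta 0%N w))|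
  <= t^-1 * (Ex P (fun w => x (zeta 0%N w) ^+ 2) + 2).
Proof.
have mx0 := measurable_step 0 mx; have my0 := measurable_step 0 my.
have b1 w : `|expR (- (t^-1 * x (zeta 0%N w)))| <= 1.
  by have /andP[? ?] := discount_bound 0 w ti0; rewrite ger0_norm// ltW.
have Lq : L1 P (fun w => expR (- (t^-1 * x (zeta 0%N w))) * y (zeta 0%N w)).
  by apply: (L1_mul_bounded _ b1) => //; exact: m_discount.
rewrite -[X in `|X| ]subr0 -Ey0 -ExB//.
have Lb : L1 P (fun w => t^-1 * (x (zeta 0%N w) ^+ 2 + y (zeta 0%N w) ^+ 2)).
  by apply: L1Z; exact: L1D.
apply: (le_trans (norm_Ex (L1B Lq Ly))).
apply: (@le_trans _ _ (Ex P (fun w => t^-1 * (x (zeta 0%N w) ^+ 2 + y (zeta 0%N w) ^+ 2)))).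
  apply: le_Ex => //; first by apply: L1_norm; exact: L1B.
  move=> w; set u := y _; set v := x _.
  have v0 : 0 < v by exact: x_gt0.
  set e := expR _.
  have e1 : e <= 1 by rewrite expR_le1 oppr_le0 mulr_ge0 ?ltW.
  have e2 : 1 - t^-1 * v <= e by have := expR_ge1Dx (- (t^-1 * v)); rewrite /e; lra.
  rewrite -{2}[u]mul1r -mulrBl normrM ler0_norm; last by lra.
  apply: (@le_trans _ _ (t^-1 * v * `|u|)).
    by apply: ler_wpM2r => //; lra.
  rewrite -mulrA ler_pM2l//.
  have := sqr_ge0 (v - `|u|); rewrite -[u ^+ 2]real_normK ?num_real//.
  have := sqr_ge0 v; have := sqr_ge0 `|u|; rewrite !expr2; nra.
by rewrite (ExZ _ (L1D Lx2 Ly2)) (ExD Lx2 Ly2) ler_pM2l// lerD2l Ex_sqr_le2.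
Qed.

Let adapted_dpow n (q : R) :
  adapted zeta n (fun w => disc n w * `|walk y n w| `^ q).
Proof.
have ad := @adapted_disc n; have aw := adapted_walk my (leqnn n).
by rewrite /adapted in ad aw *; meas.
Qed.

Let adapted_dsg n (q : R) :
  adapted zeta n (fun w => disc n w * (`|walk y n w| `^ q * Num.sg (walk y n w))).
Proof.
have ad := @adapted_disc n; have aw := adapted_walk my (leqnn n).
by rewrite /adapted in ad aw *; meas.
Qed.

Let norm_sg_le1 (u : R) : `|Num.sg u| <= 1.
Proof. by rewrite normr_sg; case: (_ != _); rewrite ?lexx ?ler01. Qed.

Let dsg_le n (q : R) w :
  `|disc n w * (`|walk y n w| `^ q * Num.sg (walk y n w))|
    <= disc n w * `|walk y n w| `^ q.
Proof.
have /andP[d0 _] := disc_bound n w.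
rewrite !normrM (ger0_norm d0) ler_wpM2l// ger0_norm ?powR_ge0//.
by rewrite ler_piMr ?powR_ge0.
Qed.

Let L1_dsg n (q : R) : 0 <= q <= p ->
  L1 P (fun w => disc n w * (`|walk y n w| `^ q * Num.sg (walk y n w))).
Proof.
move=> qp; apply: (@L1_le _ _ _ _ _ (fun w => disc n w * `|walk y n w| `^ q)).
- exact: (adapted_measurable zeta_iid (@adapted_dsg n q)).
- exact: dsg_le.
- exact: dSp.
Qed.

Let K : R := Ex P (fun w => x (zeta 0%N w) ^+ 2) + 2.
Let K1 : 2 <= K.
Proof.
have : 0 <= Ex P (fun w => x (zeta 0%N w) ^+ 2) by apply: Ex_ge0 => w; exact: sqr_ge0.
by rewrite /K lerDr.
Qed.

(** Integrate [powR_normD] at the walk and its next step. The new discount factor gives [laplace] on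
    the leading term, tilts the step in the linear term, where [tilted_mean] leaves a factor
    [K / t], and is bounded by 1 in the remainder. *)
Lemma discounted_step n :
  g p n.+1 <= laplace t^-1 * g p n + p * (t^-1 * K * g (p - 1) n)
              + taylor_cst p * (2 * g (p - 2) n + Ex P (disc n)).
Proof.
have p20 := p2; have pp : 0 <= p <= p by lra.
have p1 : 0 <= p - 1 <= p by lra.
have p2' : 0 <= p - 2 <= p by lra.
have C0 := ltW (taylor_cst_gt0 p2).
pose q s := expR (- (t^-1 * x s)).
pose F1 w := (disc n w * `|walk y n w| `^ p) * q (zeta n w).
pose F2 w := (disc n w * (`|walk y n w| `^ (p - 1) * Num.sg (walk y n w)))
             * (q (zeta n w) * y (zeta n w)).
pose F3 w := (disc n w * `|walk y n w| `^ (p - 2)) * y (zeta n w) ^+ 2.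
pose F4 w := disc n w * `|y (zeta n w)| `^ p.
have Lqy : L1 P (fun w => q (zeta 0%N w) * y (zeta 0%N w)).
  apply: (L1_mul_bounded (c := 1)) => //; first exact: m_discount.
  by move=> w; have /andP[? ?] := discount_bound 0 w ti0; rewrite ger0_norm// ltW.
have mqy : measurable_fun setT (fun s => q s * y s) by rewrite /q; meas.
have my2 : measurable_fun setT (fun s => y s ^+ 2) by meas.
have myp : measurable_fun setT (fun s => `|y s| `^ p) by meas.
have LF1 : L1 P F1.
  exact: (adapted_L1M zeta_iid (@adapted_dpow n p) mstep (dSp n pp) (L1_discount 0 ti0)).
have LF2 : L1 P F2.
  exact: (adapted_L1M zeta_iid (@adapted_dsg n (p - 1)) mqy (L1_dsg n p1) Lqy).
have LF3 : L1 P F3.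
  exact: (adapted_L1M zeta_iid (@adapted_dpow n (p - 2)) my2 (dSp n p2') Ly2).
have LF4 : L1 P F4.
  exact: (adapted_L1M zeta_iid (@adapted_disc n) myp (L1_disc n) Lyp).
have EF1 : Ex P F1 = g p n * laplace t^-1.
  exact: (adapted_ExM zeta_iid (@adapted_dpow n p) mstep (dSp n pp) (L1_discount 0 ti0)).
have EF2 : Ex P F2 <= t^-1 * K * g (p - 1) n.
  have -> := (adapted_ExM zeta_iid (@adapted_dsg n (p - 1)) mqy (L1_dsg n p1) Lqy).
  apply: le_trans (ler_norm _) _; rewrite normrM mulrC.
  apply: ler_pM => //; first exact: tilted_mean.
  apply: le_trans (norm_Ex (L1_dsg n p1)) _.
  exact: (le_Ex (L1_norm (L1_dsg n p1)) (dSp n p1) (dsg_le n (p - 1))).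
have EF3 : Ex P F3 <= 2 * g (p - 2) n.
  have -> := (adapted_ExM zeta_iid (@adapted_dpow n (p - 2)) my2 (dSp n p2') Ly2).
  by rewrite mulrC; apply: ler_wpM2r; [exact: discounted_moment_ge0|exact: Ex_sqr_le2].
have EF4 : Ex P F4 <= Ex P (disc n).
  have -> := (adapted_ExM zeta_iid (@adapted_disc n) myp (L1_disc n) Lyp).
  apply: ler_piMr => //; apply: Ex_ge0 => w.
  by have /andP[] := disc_bound n w.
have LF34 := L1D LF3 LF4.
have LF2' := L1Z p LF2.
have LF34' := L1Z (taylor_cst p) LF34.
apply: (@le_trans _ _ (Ex P (fun w => F1 w + p * F2 w + taylor_cst p * (F3 w + F4 w)))).
  apply: le_Ex.
  - exact: dSp.
  - by apply: L1D => //; exact: L1D.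
  move=> w; rewrite discS walkS.
  have /andP[d0 d1] := disc_bound n w.
  have /andP[q0 q1] := discount_bound n w ti0.
  rewrite -/(q (zeta n w)) in q0 q1 *.
  set dn := disc n w in d0 d1 *; set qn := q (zeta n w) in q0 q1 *.
  have H := powR_normD (walk y n w) (y (zeta n w)) p2.
  have dq0 : 0 <= dn * qn by rewrite mulr_ge0// ltW.
  apply: (le_trans (ler_wpM2l dq0 H)).
  rewrite /F1 /F2 /F3 /F4 -/dn -/qn.
  set A := `|walk y n w| `^ (p - 2) * y (zeta n w) ^+ 2.
  set B := `|y (zeta n w)| `^ p.
  have A0 : 0 <= A by rewrite mulr_ge0 ?powR_ge0 ?sqr_ge0.
  have B0 : 0 <= B by exact: powR_ge0.
  rewrite -[dn * `|walk y n w| `^ (p - 2) * _]mulrA -/A.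
  have : dn * qn * (taylor_cst p * (A + B)) <= dn * (taylor_cst p * (A + B)).
    apply: ler_wpM2r; first by rewrite mulr_ge0// addr_ge0.
    by rewrite ler_piMr// ltW.
  exact: discount_distribute.
rewrite (ExD (L1D LF1 LF2') LF34') (ExD LF1 LF2') !ExZ// (ExD LF3 LF4) EF1.
have p0 : 0 <= p by exact: le_trans p20.
rewrite [laplace _ * _]mulrC -addrA -[leRHS]addrA lerD2l.
by apply: lerD; apply: ler_wpM2l => //; exact: lerD.
Qed.

Lemma discounted_young n q e : 0 <= q < p -> 0 < e ->
  g q n <= e * g p n + e `^ (- (q / (p - q))) * Ex P (disc n).
Proof.
move=> qp e0; have qp' : 0 <= q <= p by lra.
have p20 := p2; have pp : 0 <= p <= p by lra.
have L1' := L1Z e (dSp n pp); have L2' := L1Z (e `^ (- (q / (p - q)))) (L1_disc n).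
rewrite -(ExZ _ (dSp n pp)) -(ExZ _ (L1_disc n)) -(ExD L1' L2').
apply: le_Ex; [exact: dSp|exact: L1D|move=> w].
have /andP[d0 _] := disc_bound n w.
have := ler_wpM2l d0 (young_powR (normr_ge0 (walk y n w)) qp e0); lra.
Qed.

Let a := (p - 2) / 2.

(** The two bases are Young parameters: [laplace_gap / (4 * p * K)] for the moment of order [p - 1],
    and [laplace_gap / (8 * taylor_cst p)], to be divided by [t], for the order [p - 2]. *)
Definition discounted_cst :=
  p * K * (laplace_gap / (4 * p * K)) `^ (- (p - 1))
  + taylor_cst p * (2 * (laplace_gap / (8 * taylor_cst p)) `^ (- a) + 1).

Let ta1 : 1 <= t `^ a.
Proof.
rewrite -[leLHS](powRr0 t); apply: ler_powR => //.
rewrite /a; have := p2; lra.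
Qed.

Lemma powRVN b : (t^-1) `^ (- b) = t `^ b.
Proof.
by rewrite -(powR_inv1 (ltW t0)) -powRrM mulN1r opprK.
Qed.

(** Young's inequality charges each of the two lower moments [laplace_gap / (4 * t)] times the p-th
    one, so half of the contraction survives. The power [a] of [t] comes from the order [p - 2],
    whose Young parameter is of order [1 / t]. *)
Lemma discounted_rec n :
  g p n.+1 <= (1 - t^-1 * laplace_gap / 2) * g p n
              + discounted_cst * t `^ a * Ex P (disc n).
Proof.
apply: (le_trans (discounted_step n)).
have c0 := laplace_gap_gt0; have lc := laplace_le ti.
have C0 := taylor_cst_gt0 p2.
have p20 := p2; have K20 := K1; have ti00 := ti0; have ta10 := ta1.
have g0 := discounted_moment_ge0 p n.
have D0 : 0 <= Ex P (disc n).
  by apply: Ex_ge0 => w; have /andP[] := disc_bound n w.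
have pn0 : p != 0 by rewrite gt_eqF//; lra.
have Kn0 : K != 0 by rewrite gt_eqF//; lra.
have tn0 : t != 0 by rewrite gt_eqF.
have Cn0 : taylor_cst p != 0 by rewrite gt_eqF.
have pK0 : 0 < 4 * p * K by rewrite !mulr_gt0//; lra.
have e1 : 0 < laplace_gap / (4 * p * K) by rewrite divr_gt0.
have e2 : 0 < t^-1 * (laplace_gap / (8 * taylor_cst p)).
  by rewrite mulr_gt0// divr_gt0// mulr_gt0.
have q1 : 0 <= p - 1 < p by lra.
have q2 : 0 <= p - 2 < p by lra.
have h1 := discounted_young n q1 e1.
have h2 := discounted_young n q2 e2.
move: h1; rewrite (_ : p - (p - 1) = 1) ?divr1; last by ring.
move: h2; rewrite (_ : p - (p - 2) = 2) -/a; last by ring.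
have e20 : 0 <= laplace_gap / (8 * taylor_cst p).
  by apply: divr_ge0; rewrite ?mulr_ge0// ltW.
rewrite powRM ?powRVN//; last by rewrite invr_ge0 ltW.
rewrite /discounted_cst.
set A1 := _ `^ (- (p - 1)); set A2 := _ `^ (- a).
have A10 : 0 <= A1 := powR_ge0 _ _.
have A20 : 0 <= A2 := powR_ge0 _ _.
move: lc D0 g0; set G := g p n; set D := Ex P (disc n).
set g1 := g (p - 1) n; set g2 := g (p - 2) n => lc D0 G0 h2 h1.
have pK : 0 <= p * (t^-1 * K) by rewrite !mulr_ge0 ?(ltW ti00)//; lra.
have H1 : p * (t^-1 * K * g1) <= t^-1 * (laplace_gap / 4) * G + p * K * A1 * (t `^ a) * D.
  rewrite mulrA; apply: (le_trans (ler_wpM2l pK h1)).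
  rewrite (_ : _ * (_ + _) = t^-1 * (laplace_gap / 4) * G + p * K * A1 * D * t^-1); last first.
    by field; rewrite ?pn0 ?Kn0 ?tn0 ?Cn0.
  rewrite lerD2l [leRHS](_ : _ = p * K * A1 * D * t `^ a); last by ring.
  apply: ler_wpM2l; first by rewrite !mulr_ge0//; lra.
  by have /andP[_] := ti; lra.
have H2 : taylor_cst p * (2 * g2 + D) <= t^-1 * (laplace_gap / 4) * G
     + taylor_cst p * (2 * A2 + 1) * t `^ a * D.
  have C02 : 0 <= taylor_cst p * 2 by rewrite mulr_ge0 ?ltW.
  have := ler_wpM2l C02 h2.
  rewrite (_ : taylor_cst p * 2 * (_ + _) = t^-1 * (laplace_gap / 4) * G
     + taylor_cst p * (2 * A2) * t `^ a * D); last first.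
    by field; rewrite ?pn0 ?Kn0 ?tn0 ?Cn0.
  have : taylor_cst p * D * 1 <= taylor_cst p * D * t `^ a.
    by apply: ler_wpM2l => //; rewrite mulr_ge0// ltW.
  lra.
have := ler_wpM2r G0 lc.
lra.
Qed.

(** The moment at index 0 vanishes, so the sum is at most the shifted sum; the recursion then bounds
    the sum by a contraction of itself plus a source, and the inequality is solved for it. *)
Lemma discounted_sum m :
  \sum_(i < m) g p i <= 2 * discounted_cst / laplace_gap ^+ 2 * t `^ a * t ^+ 2.
Proof.
have c0 := laplace_gap_gt0.
have g00 : g p 0%N = 0.
  rewrite /g /discounted_moment -[RHS](Ex_cst P 0); congr (Ex P).
  apply/funext => w; rewrite walk0 normr0 powR0 ?mulr0// gt_eqF//.
  exact: lt_le_trans p2.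
have C0 : 0 <= discounted_cst.
  have C0 := ltW (taylor_cst_gt0 p2); have pp := p2; have KK := K1.
  rewrite /discounted_cst addr_ge0// mulr_ge0 ?powR_ge0//.
    by apply: mulr_ge0; lra.
  by have := powR_ge0 (laplace_gap / (8 * taylor_cst p)) (- a); lra.
have ta0 : 0 <= t `^ a := powR_ge0 _ _.
set s := \sum_(i < m) g p i.
have H : s <= (1 - t^-1 * laplace_gap / 2) * s
              + discounted_cst * t `^ a * (t / laplace_gap).
  apply: (@le_trans _ _ (\sum_(i < m) g p i.+1)).
    by apply: ler_sum_shift => // i; exact: discounted_moment_ge0.
  apply: (@le_trans _ _ (\sum_(i < m) ((1 - t^-1 * laplace_gap / 2) * g p i
              + discounted_cst * t `^ a * Ex P (disc i)))).
    by apply: ler_sum => i _; exact: discounted_rec.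
  rewrite big_split/= -!mulr_sumr lerD2l ler_wpM2l ?sum_disc//.
  exact: mulr_ge0.
have H' : t^-1 * laplace_gap / 2 * s <= discounted_cst * t `^ a * (t / laplace_gap).
  by lra.
have tc : 0 < t^-1 * laplace_gap / 2 by rewrite !mulr_gt0.
move: H'; rewrite -ler_pdivlMl// => /le_trans; apply.
rewrite le_eqVlt; apply/orP; left; apply/eqP; field.
by rewrite !gt_eqF.
Qed.

Let running_disc m w : running t m w <= expR 1 * disc m w.
Proof.
rewrite /running; case: (lerP (walk x m w) t) => [Tt|_]; last first.
  by rewrite mulr_ge0 ?expR_ge0//; have /andP[] := disc_bound m w.
rewrite -expRD -[leLHS]expR0 ler_expR subr_ge0.
by rewrite mulrC ler_pdivrMr// mul1r.
Qed.

Lemma sum_running m : \sum_(i < m) Ex P (running t i) <= expR 1 * (t / laplace_gap).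
Proof.
apply: (@le_trans _ _ (\sum_(i < m) expR 1 * Ex P (disc i))).
  apply: ler_sum => i _; rewrite -ExZ//; apply: le_Ex.
  - exact: L1_running.
  - exact: L1Z.
  - exact: running_disc.
by rewrite -mulr_sumr; apply: ler_wpM2l; [exact: expR_ge0|exact: sum_disc].
Qed.

Let running_cases m w : running t m w = 0 \/ running t m w = 1.
Proof. by rewrite /running; case: (_ <= t)%R; [right|left]. Qed.

Let stopped_pow_running m q w :
  running t m w * `|stopped t y m w| `^ q = running t m w * `|walk y m w| `^ q.
Proof.
by case: (running_cases m w) => r; rewrite ?r ?mul0r// stopped_eq_walk// r.
Qed.

Let p_gt0 : 0 < p. Proof. exact: lt_le_trans p2. Qed.

Let Lst n (q : R) : 0 <= q <= p -> L1 P (fun w => `|stopped t y n w| `^ q).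
Proof.
move=> qp; apply: (L1_pow_le _ qp); first exact: measurable_stopped.
exact: L1_stopped_pow.
Qed.

Let adapted_rst n (q : R) :
  adapted zeta n (fun w => running t n w * `|stopped t y n w| `^ q).
Proof.
have ad := adapted_running t (leqnn n); have aw := adapted_stopped t my (leqnn n).
by rewrite /adapted in ad aw *; meas.
Qed.

Let adapted_rsg n (q : R) : adapted zeta n (fun w =>
  running t n w * (`|stopped t y n w| `^ q * Num.sg (stopped t y n w))).
Proof.
have ad := adapted_running t (leqnn n); have aw := adapted_stopped t my (leqnn n).
by rewrite /adapted in ad aw *; meas.
Qed.

Let L1_rst n (q : R) : 0 <= q <= p ->
  L1 P (fun w => running t n w * `|stopped t y n w| `^ q).
Proof.
move=> qp; apply: (@L1_mul_bounded _ _ _ _ _ _ 1); last exact: Lst.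
  exact: measurable_running.
by move=> w; have /andP[? ?] := running_bound t n w; rewrite ger0_norm.
Qed.

Let L1_rsg n (q : R) : 0 <= q <= p -> L1 P (fun w =>
  running t n w * (`|stopped t y n w| `^ q * Num.sg (stopped t y n w))).
Proof.
move=> qp; apply: (@L1_le _ _ _ _ _ (fun w => running t n w * `|stopped t y n w| `^ q)).
- exact: (adapted_measurable zeta_iid (@adapted_rsg n q)).
- move=> w; have /andP[r0 _] := running_bound t n w.
  rewrite !normrM (ger0_norm r0) ler_wpM2l// ger0_norm ?powR_ge0//.
  by rewrite ler_piMr ?powR_ge0.
- exact: L1_rst.
Qed.

(** Without discount the linear term has mean exactly 0, because [running] and the stopped walk are
    independent of the next step; no moment of order [p - 1] appears. *)
Lemma stopped_step n :
  Ex P (fun w => `|stopped t y n.+1 w| `^ p) <= Ex P (fun w => `|stopped t y n w| `^ p)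
   + taylor_cst p * (2 * Ex P (fun w => running t n w * `|stopped t y n w| `^ (p - 2))
                     + Ex P (running t n)).
Proof.
have p20 := p2; have pp : 0 <= p <= p by lra.
have p1 : 0 <= p - 1 <= p by lra.
have p2' : 0 <= p - 2 <= p by lra.
have C0 := ltW (taylor_cst_gt0 p2).
pose F2 w := (running t n w * (`|stopped t y n w| `^ (p - 1)
  * Num.sg (stopped t y n w))) * y (zeta n w).
pose F3 w := (running t n w * `|stopped t y n w| `^ (p - 2)) * y (zeta n w) ^+ 2.
pose F4 w := running t n w * `|y (zeta n w)| `^ p.
have my2 : measurable_fun setT (fun s => y s ^+ 2) by meas.
have myp : measurable_fun setT (fun s => `|y s| `^ p) by meas.
have LF2 : L1 P F2.
  exact: (adapted_L1M zeta_iid (@adapted_rsg n (p - 1)) my (L1_rsg n p1) Ly).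
have LF3 : L1 P F3.
  exact: (adapted_L1M zeta_iid (@adapted_rst n (p - 2)) my2 (L1_rst n p2') Ly2).
have LF4 : L1 P F4.
  exact: (adapted_L1M zeta_iid (adapted_running t (leqnn n)) myp (L1_running t n) Lyp).
have EF2 : Ex P F2 = 0.
  have -> := (adapted_ExM zeta_iid (@adapted_rsg n (p - 1)) my (L1_rsg n p1) Ly).
  by rewrite [X in _ * X](_ : _ = 0) ?mulr0.
have EF3 : Ex P F3 <= 2 * Ex P (fun w => running t n w * `|stopped t y n w| `^ (p - 2)).
  have -> := (adapted_ExM zeta_iid (@adapted_rst n (p - 2)) my2 (L1_rst n p2') Ly2).
  rewrite mulrC; apply: ler_wpM2r; last exact: Ex_sqr_le2.
  by apply: Ex_ge0 => w; rewrite mulr_ge0 ?powR_ge0.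
have EF4 : Ex P F4 <= Ex P (running t n).
  have -> := (adapted_ExM zeta_iid (adapted_running t (leqnn n)) myp (L1_running t n) Lyp).
  apply: ler_piMr => //; apply: Ex_ge0 => w.
  by have /andP[] := running_bound t n w.
have LF2' := L1Z p LF2; have LF34 := L1D LF3 LF4.
have LF34' := L1Z (taylor_cst p) LF34; have Lp := Lst n pp.
apply: (@le_trans _ _ (Ex P (fun w => `|stopped t y n w| `^ p + p * F2 w
                          + taylor_cst p * (F3 w + F4 w)))).
  apply: le_Ex; [exact: Lst|by apply: L1D => //; exact: L1D|move=> w].
  rewrite stoppedS; apply: (le_trans (powR_normD _ _ p2)).
  rewrite -[leLHS]addrA -[leRHS]addrA lerD2l /F2 /F3 /F4.
  case: (running_cases n w) => ->; last by rewrite !mul1r !mulrA.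
  rewrite !mul0r !mulr0 normr0 powR0 ?addr0; last by rewrite gt_eqF.
  by rewrite expr0n !mulr0 ?addr0 ?mulr0.
rewrite (ExD (L1D Lp LF2') LF34') (ExD Lp LF2') !ExZ// (ExD LF3 LF4) EF2 mulr0 addr0.
by rewrite lerD2l; apply: ler_wpM2l => //; exact: lerD.
Qed.

(** Where step [n] runs, the stopped walk is the walk and the indicator is at most [expR 1] times
    the discount. Young's inequality with parameter [1 / t] then raises the order from [p - 2] to
    [p]. *)
Lemma stopped_step_discounted n :
  Ex P (fun w => `|stopped t y n.+1 w| `^ p) <= Ex P (fun w => `|stopped t y n w| `^ p)
   + taylor_cst p * expR 1 * (2 * t^-1 * g p n + 3 * t `^ a * Ex P (disc n)).
Proof.
have p20 := p2; have C0 := ltW (taylor_cst_gt0 p2).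
have p2' : 0 <= p - 2 <= p by lra.
have e0 : 0 <= expR 1 :> R := expR_ge0 _.
apply: (le_trans (stopped_step n)); rewrite lerD2l -mulrA; apply: ler_wpM2l => //.
have H1 : Ex P (running t n) <= expR 1 * Ex P (disc n).
  rewrite -ExZ//; apply: le_Ex; [exact: L1_running|exact: L1Z|exact: running_disc].
have H2 : Ex P (fun w => running t n w * `|stopped t y n w| `^ (p - 2))
    <= expR 1 * g (p - 2) n.
  rewrite -ExZ; last exact: dSp.
  apply: le_Ex; [exact: L1_rst|by apply: L1Z; exact: dSp|move=> w].
  by rewrite stopped_pow_running mulrA; apply: ler_wpM2r; rewrite ?powR_ge0.
have q2 : 0 <= p - 2 < p by lra.
have := discounted_young n q2 ti0.
rewrite (_ : p - (p - 2) = 2) -/a; last by ring.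
rewrite powRVN => H3.
have D0 : 0 <= Ex P (disc n).
  by apply: Ex_ge0 => w; have /andP[] := disc_bound n w.
have H4 : Ex P (disc n) <= t `^ a * Ex P (disc n) by rewrite ler_peMl.
apply: (@le_trans _ _ (2 * (expR 1 * (t^-1 * g p n + t `^ a * Ex P (disc n)))
   + expR 1 * (t `^ a * Ex P (disc n)))).
  apply: lerD; last by apply: (le_trans H1); exact: ler_wpM2l.
  by rewrite ler_pM2l//; apply: (le_trans H2); exact: ler_wpM2l.
by rewrite le_eqVlt; apply/orP; left; apply/eqP; ring.
Qed.

Definition stopped_cst :=
  taylor_cst p * expR 1 * (4 * discounted_cst / laplace_gap ^+ 2 + 3 / laplace_gap).

(** Summing the steps, the discounted moments contribute order [a + 2] in [t] before division by
    [t], and the masses order 1 before multiplication by the power [a]: both give order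
    [a + 1 = p / 2]. *)
Lemma stopped_moment_normalized n :
  Ex P (fun w => `|stopped t y n w| `^ p) <= stopped_cst * t `^ (p / 2).
Proof.
have c0 := laplace_gap_gt0; have C0 := ltW (taylor_cst_gt0 p2).
have e0 : 0 <= expR 1 :> R := expR_ge0 _.
have H : Ex P (fun w => `|stopped t y n w| `^ p) <=
    taylor_cst p * expR 1 * (2 * t^-1 * (\sum_(i < n) g p i)
      + 3 * t `^ a * (\sum_(i < n) Ex P (disc i))).
  elim: n => [|n IH].
    rewrite !big_ord0 !mulr0 addr0 mulr0 -[leRHS](Ex_cst P 0).
    rewrite le_eqVlt; apply/orP; left; apply/eqP; congr (Ex P).
    by apply/funext => w; rewrite stopped0 normr0 powR0// gt_eqF.
  apply: (le_trans (stopped_step_discounted n)).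
  apply: (le_trans (lerD IH (lexx _))); rewrite !big_ord_recr/=.
  by rewrite le_eqVlt; apply/orP; left; apply/eqP; ring.
apply: (le_trans H); rewrite /stopped_cst -[leRHS]mulrA; apply: ler_wpM2l.
  exact: mulr_ge0.
have -> : t `^ (p / 2) = t `^ a * t.
  have -> : p / 2 = a + 1 by rewrite /a; field.
  by rewrite powRS ?(ltW t0) 1?mulrC// /a divr_ge0// subr_ge0.
have h1 := ler_wpM2l (ltW ti0) (discounted_sum n).
have h2 : 3 * t `^ a * (\sum_(i < n) Ex P (disc i)) <= 3 * t `^ a * (t / laplace_gap).
  by apply: ler_wpM2l; [rewrite mulr_ge0 ?powR_ge0|exact: sum_disc].
apply: (@le_trans _ _ (2 * (t^-1 * (2 * discounted_cst / laplace_gap ^+ 2 * t `^ a * t ^+ 2))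
   + 3 * t `^ a * (t / laplace_gap))).
  by apply: lerD => //; rewrite -[leLHS]mulrA ler_pM2l.
rewrite le_eqVlt; apply/orP; left; apply/eqP; field.
by rewrite !gt_eqF.
Qed.

End discounted.

(** Homogeneity: scaling [y] by the power [- p^-1] of [A] normalises its moment. [stopped_cst]
    involves [p] and the law of [x] only, so it is unchanged by the scaling. *)
Theorem stopped_moment (t p A : R) (y : St -> R) n : 1 <= t -> 2 <= p -> 0 < A ->
  measurable_fun setT y -> Ex P (fun w => y (zeta 0%N w)) = 0 ->
  L1 P (fun w => `|y (zeta 0%N w)| `^ p) ->
  Ex P (fun w => `|y (zeta 0%N w)| `^ p) <= A ->
  Ex P (fun w => `|stopped t y n w| `^ p) <= stopped_cst p * A * t `^ (p / 2).
Proof.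
move=> t1 p2 A0 my Ey Lyp EA.
have p0 : 0 < p by exact: lt_le_trans p2.
pose b := A `^ (- p^-1).
have b0 : 0 < b by exact: powR_gt0.
have bp : b `^ p = A^-1.
  by rewrite /b -powRrM mulNr mulVf ?gt_eqF// powR_inv1// ltW.
have Ly : L1 P (fun w => y (zeta 0%N w)).
  apply: (L1_of_pow _ _ Lyp); first exact: measurable_step.
  by apply: le_trans p2; rewrite ler1n.
have scal (f : Omega -> R) :
    (fun w => `|b * f w| `^ p) = (fun w => A^-1 * `|f w| `^ p).
  by apply/funext => w; rewrite normrM powRM// ger0_norm ?bp// ltW.
have := @stopped_moment_normalized t p (fun s => b * y s) t1 p2 _ _ _ _ n.
rewrite (_ : (fun w => `|stopped t (fun s => b * y s) n w| `^ p) =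
             (fun w => `|b * stopped t y n w| `^ p)); last first.
  apply/funext => w; congr (`|_| `^ _); rewrite /stopped mulr_sumr.
  by apply: eq_bigr => i _; rewrite mulrCA.
rewrite !scal (ExZ b Ly) (ExZ _ Lyp) (ExZ _ (L1_stopped_pow t n my p0 Lyp)).
move=> h; rewrite [_ * A]mulrC -mulrA -ler_pdivrMl//; apply: h.
- by meas.
- by rewrite Ey mulr0.
- exact: L1Z.
- by rewrite ler_pdivrMl// mulr1.
Qed.

End clock.
End stopped_walk.

(** * The stopped walk in mean square *)

Section stopped_walk_L2.
Context {d dS : measure_display} {Omega : measurableType d}
  {St : measurableType dS} {R : realType}.
Variables (P : probability Omega R) (zeta : nat -> Omega -> St).
Hypothesis zeta_iid : iid P zeta.

Let mstep (v : St -> R) n : measurable_fun setT v ->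
  measurable_fun setT (fun w => v (zeta n w)).
Proof. exact: (measurable_step zeta_iid). Qed.

Definition transform (H : nat -> Omega -> R) (y : St -> R) m w :=
  \sum_(i < m) H i w * y (zeta i w).

Section predictable_transform.
Variables (H : nat -> Omega -> R) (y : St -> R).
Hypotheses (aH : forall i, adapted zeta i (H i)) (H1 : forall i w, `|H i w| <= 1).
Hypothesis my : measurable_fun setT y.

Let transformS n w : transform H y n.+1 w = transform H y n w + H n w * y (zeta n w).
Proof. by rewrite /transform big_ord_recr. Qed.

Let adapted_transform n : adapted zeta n (transform H y n).
Proof.
apply: mf_sum => i; apply: measurable_funM.
  exact: (adapted_le (ltnW (ltn_ord i)) (@aH i)).
exact: (@adapted_zeta _ _ _ _ _ zeta n i y).
Qed.

(** The cross term vanishes: [H m] times the transform so far is known before step [m], which is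
    centered. *)
Lemma Ex_transform_sqr m : Ex P (fun w => y (zeta 0%N w)) = 0 ->
  L1 P (fun w => y (zeta 0%N w) ^+ 2) ->
  L1 P (fun w => transform H y m w ^+ 2) /\
  Ex P (fun w => transform H y m w ^+ 2) =
  (\sum_(i < m) Ex P (fun w => H i w ^+ 2)) * Ex P (fun w => y (zeta 0%N w) ^+ 2).
Proof.
move=> Ey Ly2.
have Ly : L1 P (fun w => y (zeta 0%N w)) by apply: L1_of_sqr => //; exact: mstep.
have my2 : measurable_fun setT (fun s => y s ^+ 2) by meas.
have mH i : measurable_fun setT (H i) := adapted_measurable zeta_iid (@aH i).
have LH2 i : L1 P (fun w => H i w ^+ 2).
  apply: (@L1_bounded _ _ _ _ _ 1); first by have := mH i => ?; meas.
  by move=> w; rewrite normrX expr_le1.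
elim: m => [|m [LA EA]].
  have A0 : (fun w => transform H y 0 w ^+ 2) = (fun=> 0).
    by apply/funext => w; rewrite /transform big_ord0 expr0n.
  by rewrite A0 big_ord0 mul0r Ex_cst; split => //; exact: L1_cst.
have mA := adapted_measurable zeta_iid (@adapted_transform m).
have LAm : L1 P (transform H y m) by exact: L1_of_sqr.
have aAH : adapted zeta m (fun w => H m w * transform H y m w).
  by apply: measurable_funM; [exact: (@aH m)|exact: adapted_transform].
have aH2 : adapted zeta m (fun w => H m w ^+ 2).
  by apply: measurable_funX; exact: (@aH m).
have LAH : L1 P (fun w => H m w * transform H y m w).
  exact: (L1_mul_bounded (mH m) (H1 m) LAm).
have L2 := adapted_L1M zeta_iid aAH my LAH Ly.
have E2 := adapted_ExM zeta_iid aAH my LAH Ly.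
have L3 := adapted_L1M zeta_iid aH2 my2 (LH2 m) Ly2.
have E3 := adapted_ExM zeta_iid aH2 my2 (LH2 m) Ly2.
have -> : (fun w => transform H y m.+1 w ^+ 2) = (fun w => (transform H y m w ^+ 2
    + 2 * (H m w * transform H y m w * y (zeta m w))) + H m w ^+ 2 * y (zeta m w) ^+ 2).
  by apply/funext => w; rewrite transformS; ring.
have L2' := L1Z 2 L2; have L12 := L1D LA L2'.
split; first exact: L1D.
rewrite (ExD L12 L3) (ExD LA L2') ExZ// E2 E3 EA [Ex P (y \o _)]Ey.
by rewrite big_ord_recr/=; ring.
Qed.

End predictable_transform.

Section clock.
Variable x : St -> R.
Hypotheses (mx : measurable_fun setT x) (x_gt0 : forall i w, 0 < x (zeta i w)).
Hypothesis Lx2 : L1 P (fun w => x (zeta 0%N w) ^+ 2).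
Local Notation running := (running zeta x).
Local Notation stopped := (stopped zeta x).
Local Notation walk := (walk zeta).
Local Notation gap := (laplace_gap P zeta x).

(** Wald's identity for the truncated count: each [running t i] is independent of step [i]. *)
Lemma Ex_stopped (t : R) (v : St -> R) m : measurable_fun setT v ->
  L1 P (fun w => v (zeta 0%N w)) ->
  L1 P (stopped t v m) /\
  Ex P (stopped t v m) =
  (\sum_(i < m) Ex P (running t i)) * Ex P (fun w => v (zeta 0%N w)).
Proof.
move=> mv Lv.
have L i := adapted_L1M zeta_iid (adapted_running mx t (leqnn i)) mv
  (L1_running zeta_iid mx t i) Lv.
split; first exact: L1_sum.
rewrite /stopped Ex_sum; last by move=> i; exact: L.
rewrite mulr_suml.
apply: eq_bigr => i _.
exact: (adapted_ExM zeta_iid (adapted_running mx t (leqnn i)) mv (L1_running zeta_iid mx t i)).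
Qed.

Lemma Ex_stopped_le (t : R) (v : St -> R) m : 1 <= t -> measurable_fun setT v ->
  L1 P (fun w => v (zeta 0%N w)) -> (forall s, 0 <= v s) ->
  Ex P (stopped t v m) <= expR 1 / gap * Ex P (fun w => v (zeta 0%N w)) * t.
Proof.
move=> t1 mv Lv v0; have [_ ->] := Ex_stopped t m mv Lv.
have Ev0 : 0 <= Ex P (fun w => v (zeta 0%N w)) by apply: Ex_ge0.
have := ler_wpM2r Ev0 (sum_running zeta_iid mx x_gt0 t1 m).
by move=> /le_trans; apply; rewrite le_eqVlt; apply/orP; left; apply/eqP; ring.
Qed.

Lemma running_01 (t : R) i w : running t i w = 0 \/ running t i w = 1.
Proof. by rewrite /running; case: (_ <= t)%R; [right|left]. Qed.

Lemma running1 (t : R) i w : running t i w = 1 -> walk x i w <= t.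
Proof.
by rewrite /running; case: (walk x i w <= t)%R => //= /esym/eqP; rewrite oner_eq0.
Qed.

Lemma running0 (t : R) i w : running t i w = 0 -> t < walk x i w.
Proof. by rewrite /running; case: (leP (walk x i w) t) => //= _ /eqP; rewrite oner_eq0. Qed.

(** Here [k] is the interval containing [t], and the index [k.+1] means that this interval is
    counted in full. The first alternative is that [m] intervals do not get past [t]. *)
Lemma stopped_cases (t : R) m w : 0 <= t -> running t m w = 1 \/
  exists2 k, (k < m)%N & walk x k w <= t < walk x k.+1 w /\
    forall v, stopped t v m w = walk v k.+1 w.
Proof.
move=> t0; elim: m => [|m [r|[k km [kt kv]]]].
- by left; rewrite /running walk0 t0.
- case: (running_01 t m.+1 w) => r'; [right|by left].
  exists m => //; split.
    by rewrite running1//= running0.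
  move=> v; rewrite stoppedS r mul1r walkS; congr (_ + _).
  by apply: stopped_eq_walk => //; rewrite r.
- right; exists k; [exact: ltnW|split => // v].
  case: (running_01 t m w) => r; first by rewrite stoppedS r mul0r addr0.
  have := running_nonincreasing x_gt0 t w km; rewrite r.
  case: (running_01 t k.+1 w) => r'; first by rewrite r' ler10.
  by have := running1 r'; rewrite leNgt; case/andP: kt => _ ->.
Qed.

(** Applied with [k] the straddling interval: a mark of a size-biased interval is traded for a sum
    over all begun intervals, whose mean is given by Wald's identity. *)
Lemma le_stopped (t : R) (v : St -> R) m k w : (forall s, 0 <= v s) ->
  (k < m)%N -> running t k w = 1 -> v (zeta k w) <= stopped t v m w.
Proof.
move=> v0 km r; rewrite /stopped (bigD1 (Ordinal km))//= r mul1r lerDl.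
by apply: sumr_ge0 => i _; rewrite mulr_ge0.
Qed.

Let mu := Ex P (fun w => x (zeta 0%N w)).

Definition steps (t : R) m w := \sum_(i < m) running t i w.

Let Lx : L1 P (fun w => x (zeta 0%N w)).
Proof. by apply: L1_of_sqr => //; exact: mstep. Qed.

Lemma mean_gt0 : 0 < mu. Proof. exact: Ex_gt0. Qed.

(** [mu * steps - t] is the overshoot of the clock minus the centered clock. The overshoot is at
    most the last step, hence at most the root of the sum of squares of all running steps. *)
Lemma steps_overshoot (t : R) m w : 0 <= t -> t <= mu * m%:R ->
  `|mu * steps t m w - t| <=
    `|stopped t (fun s => x s - mu) m w| + Num.sqrt (stopped t (fun s => x s ^+ 2) m w).
Proof.
move=> t0 tm.
have -> : stopped t (fun s => x s - mu) m w = stopped t x m w - mu * steps t m w.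
  rewrite /stopped /steps mulr_sumr -sumrB; apply: eq_bigr => i _; ring.
have q0 := sqrtr_ge0 (stopped t (fun s => x s ^+ 2) m w).
have H1 : stopped t x m w <= t + Num.sqrt (stopped t (fun s => x s ^+ 2) m w).
  case: (stopped_cases m w t0) => [r|[k km [/andP[kt _] kv]]].
    rewrite stopped_eq_walk ?r//.
    by rewrite (le_trans (running1 r))// lerDl.
  rewrite kv walkS; apply: lerD => //.
  rewrite -[leLHS]ger0_norm ?(ltW (x_gt0 _ _))// -sqrtr_sqr ler_sqrt.
    apply: (@le_stopped t (fun s => x s ^+ 2)) => //; first by move=> s; exact: sqr_ge0.
    by rewrite /running kt.
  apply: sumr_ge0 => i _; rewrite mulr_ge0 ?sqr_ge0//.
have H2 : running t m w = 1 \/ t <= stopped t x m w.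
  case: (stopped_cases m w t0) => [r|[k km [/andP[_ /ltW kt] kv]]]; [by left|right].
  by rewrite kv.
have H3 : running t m w = 1 -> steps t m w = m%:R.
  move=> r; rewrite /steps -[m in RHS]card_ord -sumr_const; apply: eq_bigr => i _.
  have := running_nonincreasing x_gt0 t w (ltnW (ltn_ord i)); rewrite r.
  by case: (running_01 t i w) => // ->; rewrite ler10.
(* If the clock has not passed [t] within [m] steps, all of them are counted and [t <= mu * m] takes
   over. *)
have H4 : t <= mu * steps t m w \/ t <= stopped t x m w.
  by case: H2 => [/H3 ->|]; [left|right].
move: H1 H4 q0; set u := mu * _; set v := stopped t x m w; set q := Num.sqrt _.
clearbody u v q => H1 H4 q0.
have h1 := ler_norm (v - u).
have h2 := ler_norm (- (v - u)); rewrite normrN in h2.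
have n0 := normr_ge0 (v - u).
by rewrite ler_norml; apply/andP; split; case: H4 => H4; lra.
Qed.

Lemma Ex_sqrt_le (f : Omega -> R) : L1 P f -> (forall w, 0 <= f w) ->
  L1 P (fun w => Num.sqrt (f w)) /\
  Ex P (fun w => Num.sqrt (f w)) <= Num.sqrt (Ex P f).
Proof.
move=> Lf f0; have mf := L1_measurable Lf.
have ms : measurable_fun setT (fun w => Num.sqrt (f w)) by meas.
have E : (fun w => Num.sqrt (f w) ^+ 2) = f by apply/funext => w; rewrite sqr_sqrtr.
have L2 : L1 P (fun w => Num.sqrt (f w) ^+ 2) by rewrite E.
split; first exact: L1_of_sqr.
have := Ex_sqr_le ms L2; rewrite E.
rewrite (_ : (fun w => `|Num.sqrt (f w)|) = (fun w => Num.sqrt (f w))); last first.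
  by apply/funext => w; rewrite ger0_norm ?sqrtr_ge0.
move=> h; rewrite -[leLHS]ger0_norm; last by apply: Ex_ge0 => w; exact: sqrtr_ge0.
rewrite -sqrtr_sqr ler_sqrt//; exact: Ex_ge0.
Qed.

Lemma Ex_norm_le_sqrt (f : Omega -> R) : measurable_fun setT f ->
  L1 P (fun w => f w ^+ 2) ->
  Ex P (fun w => `|f w|) <= Num.sqrt (Ex P (fun w => f w ^+ 2)).
Proof.
move=> mf Lf; rewrite -[leLHS]ger0_norm; last exact: Ex_ge0.
rewrite -sqrtr_sqr ler_sqrt; first exact: Ex_sqr_le.
by apply: Ex_ge0 => w; exact: sqr_ge0.
Qed.

Lemma L1_steps (t : R) m : L1 P (steps t m).
Proof. by apply: L1_sum => i; exact: (L1_running zeta_iid). Qed.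

Let centered := fun s => x s - mu.

Let Ex_centered : Ex P (fun w => centered (zeta 0%N w)) = 0.
Proof. by rewrite ExB ?Ex_cst ?subrr//; exact: L1_cst. Qed.

Let L1_centered : L1 P (fun w => centered (zeta 0%N w) ^+ 2).
Proof.
have Lx' := Lx; have mx0 := mstep 0%N mx.
apply: (@L1_dominated _ _ _ _ _ (fun w => 2 * (x (zeta 0%N w) ^+ 2 + mu ^+ 2))).
- by rewrite /centered; meas.
- by apply: L1Z; apply: L1D => //; exact: L1_cst.
- move=> w; rewrite sqr_ge0/= /centered.
  have := sqr_ge0 (x (zeta 0%N w) + mu); set u := x _; move: mu => c; lra.
Qed.

Definition overshoot_cst :=
  Num.sqrt (expR 1 / gap * Ex P (fun w => centered (zeta 0%N w) ^+ 2))
  + Num.sqrt (expR 1 / gap * Ex P (fun w => x (zeta 0%N w) ^+ 2)).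

(** First moments are bounded by roots of second ones, and both second moments are of order [t] by
    Wald's identity. *)
Lemma Ex_steps_overshoot (t : R) m : 1 <= t -> t <= mu * m%:R ->
  Ex P (fun w => `|mu * steps t m w - t|) <= overshoot_cst * Num.sqrt t.
Proof.
move=> t1 tm; have t0 : 0 <= t by exact: le_trans t1.
have mc : measurable_fun setT centered by rewrite /centered; meas.
have mx2 : measurable_fun setT (fun s => x s ^+ 2) by meas.
have B0 : 0 <= expR 1 / gap.
  by rewrite divr_ge0 ?expR_ge0// ltW// (laplace_gap_gt0 zeta_iid mx x_gt0).
have r1 i w : `|running t i w| <= 1.
  by have /andP[? ?] := running_bound zeta x t i w; rewrite ger0_norm.
have [L2 E2] := Ex_transform_sqr (fun i => adapted_running mx t (leqnn i)) r1 mc m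
  Ex_centered L1_centered.
have mS : measurable_fun setT (stopped t centered m) by exact: (measurable_stopped zeta_iid mx).
have [L3 E3] := Ex_stopped t m mx2 Lx2.
have S0 w : 0 <= stopped t (fun s => x s ^+ 2) m w.
  by apply: sumr_ge0 => i _; rewrite mulr_ge0 ?sqr_ge0.
have [L4 E4] := Ex_sqrt_le L3 S0.
have L5 : L1 P (stopped t centered m) by exact: L1_of_sqr.
apply: (@le_trans _ _ (Ex P (fun w => `|stopped t centered m w|
    + Num.sqrt (stopped t (fun s => x s ^+ 2) m w)))).
  apply: le_Ex.
  - apply: L1_norm; apply: L1B; last exact: L1_cst.
    by apply: L1Z; exact: L1_steps.
  - by apply: L1D => //; exact: L1_norm.
  - by move=> w; exact: steps_overshoot.
rewrite (ExD (L1_norm L5) L4) /overshoot_cst mulrDl -!sqrtrM; last 2 first.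
- by rewrite mulr_ge0//; apply: Ex_ge0 => w; exact: sqr_ge0.
- by rewrite mulr_ge0//; apply: Ex_ge0 => w; exact: sqr_ge0.
apply: lerD.
  apply: (le_trans (Ex_norm_le_sqrt mS L2)); apply: ler_wsqrtr.
  have mc2 : measurable_fun setT (fun s => centered s ^+ 2) by meas.
  apply: le_trans (Ex_stopped_le m t1 mc2 L1_centered (fun s => sqr_ge0 _)).
  have [_ ->] := Ex_stopped t m mc2 L1_centered.
  rewrite E2; apply: ler_wpM2r; first by apply: Ex_ge0 => w; exact: sqr_ge0.
  apply: ler_sum => i _; rewrite le_eqVlt; apply/orP; left; apply/eqP.
  congr (Ex P); apply/funext => w.
  by case: (running_01 t i w) => ->; rewrite ?expr0n ?expr1n.
apply: (le_trans E4); apply: ler_wsqrtr.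
exact: (Ex_stopped_le m t1 mx2 Lx2 (fun s => sqr_ge0 _)).
Qed.

Let before n (i : nat) : R := (i < n)%N%:R.

Let sum_before n m (F : nat -> R) : (n <= m)%N ->
  \sum_(i < m) before n i * F i = \sum_(i < n) F i.
Proof.
move=> nm; rewrite (big_ord_widen _ F nm) [RHS]big_mkcond/=.
by apply: eq_bigr => i _; rewrite /before; case: (i < n)%N; rewrite ?mul1r ?mul0r.
Qed.

(** Both sequences are nonincreasing with values 0 and 1, so their differences all have one sign,
    and squares of such differences are their absolute values. *)
Let sum_sqr_diff (t : R) n m w : (n <= m)%N ->
  \sum_(i < m) (running t i w - before n i) ^+ 2 <= `|steps t m w - n%:R|.
Proof.
move=> nm.
have nE : n%:R = \sum_(i < m) before n i.
  have := sum_before (fun=> 1) nm; rewrite sumr_const card_ord => <-.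
  by apply: eq_bigr => i _; rewrite mulr1.
case: (running_01 t n w) => r; last first.
  apply: le_trans (ler_norm _); rewrite nE /steps -sumrB.
  apply: ler_sum => i _; rewrite /before; case: ltnP => [ni|ni].
    have := running_nonincreasing x_gt0 t w (ltnW ni); rewrite r.
    case: (running_01 t i w) => ->; first by rewrite ler10.
    by rewrite subrr expr0n.
  by rewrite subr0; case: (running_01 t i w) => ->; rewrite ?expr0n ?expr1n.
rewrite distrC; apply: le_trans (ler_norm _); rewrite nE /steps -sumrB.
apply: ler_sum => i _; rewrite /before; case: ltnP => ni.
  case: (running_01 t i w) => ->; first by rewrite sub0r sqrrN expr1n subr0.
  by rewrite subrr expr0n.
have := running_nonincreasing x_gt0 t w ni; rewrite r.
case: (running_01 t i w) => ->; last by rewrite ler10.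
by rewrite subrr expr0n.
Qed.

(* The difference is a predictable transform of the steps with coefficients in {-1, 0, 1},
   so its second moment is the one of [y] times the mean of [`|steps t m - n|]. *)
Lemma Ex_stopped_sub_walk (t : R) (y : St -> R) m n : 1 <= t -> t <= mu * m%:R ->
  n%:R <= t / mu < n.+1%:R -> (n <= m)%N ->
  measurable_fun setT y -> Ex P (fun w => y (zeta 0%N w)) = 0 ->
  L1 P (fun w => y (zeta 0%N w) ^+ 2) ->
  L1 P (fun w => (stopped t y m w - walk y n w) ^+ 2) /\
  Ex P (fun w => (stopped t y m w - walk y n w) ^+ 2) <=
   (overshoot_cst / mu * Num.sqrt t + 1) * Ex P (fun w => y (zeta 0%N w) ^+ 2).
Proof.
move=> t1 tm /andP[nt tn] nm my Ey Ly2; have mu0 := mean_gt0.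
have E : (fun w => (stopped t y m w - walk y n w) ^+ 2) =
    (fun w => transform (fun i w => running t i w - before n i) y m w ^+ 2).
  apply/funext => w; congr (_ ^+ 2).
  rewrite /transform /stopped /walk -(sum_before (fun i => y (zeta i w)) nm) -sumrB.
  by apply: eq_bigr => i _; rewrite mulrBl.
have aH i : adapted zeta i (fun w => running t i w - before n i).
  have ar : adapted zeta i (running t i) := adapted_running mx t (leqnn i).
  by rewrite /adapted in ar *; meas.
have H1 i w : `|running t i w - before n i| <= 1.
  rewrite /before; case: (running_01 t i w) => ->; case: (i < n)%N => /=;
  by rewrite ?subrr ?subr0 ?sub0r ?normrN ?normr1 ?normr0 ?ler01.
have [L2 E2] := Ex_transform_sqr aH H1 my m Ey Ly2.
rewrite E; split => //; rewrite E2; apply: ler_wpM2r.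
  by apply: Ex_ge0 => w; exact: sqr_ge0.
have LH i : L1 P (fun w => (running t i w - before n i) ^+ 2).
  apply: (@L1_bounded _ _ _ _ _ 1).
    by have mr := measurable_running zeta_iid mx t i; meas.
  by move=> w; rewrite normrX expr_le1.
have Lo : L1 P (fun w => `|mu * steps t m w - t|).
  apply: L1_norm; apply: L1B; last exact: L1_cst.
  by apply: L1Z; exact: L1_steps.
rewrite -(Ex_sum _ (fun i : 'I_m => LH i)).
(* The [+ 1] covers the rounding of [t / mu] to [n]. *)
apply: (@le_trans _ _ (Ex P (fun w => mu^-1 * `|mu * steps t m w - t| + 1))).
  apply: le_Ex.
  - by apply: L1_sum => i; exact: LH.
  - by apply: L1D; [exact: L1Z|exact: L1_cst].
  move=> w; apply: (le_trans (sum_sqr_diff t w nm)).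
  rewrite -[X in X * _]ger0_norm ?invr_ge0 ?(ltW mu0)// -normrM mulrBr mulKf ?gt_eqF//.
  rewrite -(subrKA (mu^-1 * t)); apply: (le_trans (ler_normD _ _)).
  rewrite lerD2l [mu^-1 * t]mulrC; move: nt tn; rewrite -natr1.
  move: (t / mu) => v h1 h2; rewrite ger0_norm; lra.
have Lo' := L1Z mu^-1 Lo.
rewrite (ExD Lo' (L1_cst P 1)) (ExZ _ Lo) Ex_cst lerD2r.
rewrite mulrAC [leRHS]mulrC ler_pM2l ?invr_gt0//.
exact: Ex_steps_overshoot.
Qed.

End clock.
End stopped_walk_L2.

(** * Central limit theorem for cosines *)

Ltac nonneg := repeat first [ assumption | exact: sqr_ge0 | exact: expR_ge0
  | exact: powR_ge0 | exact: ler0n | exact: normr_ge0 | apply: divr_ge0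
  | apply: mulr_ge0 | apply: addr_ge0 | apply: exprn_ge0 | apply: ltW; assumption ].

Section trigonometric_bounds.
Context {R : realType}.
Implicit Types u v : R.

Lemma norm_sin_le u : `|sin u| <= `|u|.
Proof.
wlog u0 : u / 0 <= u.
  move=> H; have [/H//|u0] := lerP 0 u.
  by rewrite -normrN -sinN -[leRHS]normrN; apply: H; rewrite oppr_ge0 ltW.
have [->|un0] := eqVneq u 0; first by rewrite sin0.
have u_gt0 : 0 < u by rewrite lt_neqAle eq_sym un0.
have [c _ E] := @MVT R sin cos 0 u u_gt0 (fun x _ => is_derive_sin x)
  (continuous_subspaceT (@continuous_sin R)).
move: E; rewrite sin0 !subr0 => ->; rewrite normrM ler_piMl//.
by rewrite ler_norml cos_geN1 cos_le1.
Qed.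

Lemma oneBcos_le u : 0 <= 1 - cos u <= u ^+ 2 / 2.
Proof.
rewrite subr_ge0 cos_le1/=.
have -> : cos u = 1 - 2 * sin (u / 2) ^+ 2.
  rewrite {1}(splitr u) cosD -!expr2 cos2sin2; ring.
have := norm_sin_le (u / 2); rewrite -(@ler_pXn2r _ 2) ?nnegrE// !real_normK ?num_real//.
lra.
Qed.

Lemma norm_sin_sub_cubic u : `|sin u - u| <= `|u| ^+ 3 / 2.
Proof.
wlog u0 : u / 0 <= u.
  move=> H; have [/H//|u0] := lerP 0 u.
  have := H (- u); rewrite sinN normrN -opprD normrN; apply.
  by rewrite oppr_ge0 ltW.
have [->|un0] := eqVneq u 0; first by rewrite sin0 subr0 normr0 expr0n mul0r.
have u_gt0 : 0 < u by rewrite lt_neqAle eq_sym un0.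
have dsin (z : R) : is_derive z 1 (fun x => sin x - x) (cos z - 1).
  exact: is_deriveB.
have csin : {within `[0, u], continuous (fun x => sin x - x)}.
  apply: continuous_subspaceT => z; apply: cvgB; first exact: continuous_sin.
  exact: cvg_id.
have [c] := MVT u_gt0 (fun z _ => dsin z) csin.
rewrite in_itv/= => /andP[c0 cu]; rewrite sin0 !subr0 => ->.
have /andP[h1 h2] := oneBcos_le c.
rewrite normrM distrC (ger0_norm h1) (ger0_norm u0).
have : c ^+ 2 <= u ^+ 2 by rewrite ler_sqr ?nnegrE// ltW.
rewrite exprS => h3; have := ler_wpM2r u0 (le_trans h2 (_ : _ <= u ^+ 2 / 2)); nra.
Qed.

Lemma norm_sin_sub_linear u : `|sin u - u| <= 2 * `|u|.
Proof. have := ler_normB (sin u) u; have := norm_sin_le u; lra. Qed.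

(** Cubic bound for small [|u|], linear bound for large. In this form two moments suffice, since the
    indicator integrates to a tail of the second moment, as in Lindeberg's condition. *)
Lemma sin_taylor u (e : R) : 0 < e <= 1 ->
  `|sin u - u| <= u ^+ 2 * (e + 2 * (e < `|u|)%R%:R).
Proof.
move=> /andP[e0 e1].
have h1 := norm_sin_sub_cubic u; have h2 := norm_sin_sub_linear u.
rewrite -[u ^+ 2]real_normK ?num_real//.
have u0 := normr_ge0 u; move: h1 h2 u0; set v := `|u| => h1 h2 u0.
case: (ltP e v) => ev; rewrite ?mulr1 ?mulr0.
  case: (lerP 1 v) => v1; nra.
by apply: (le_trans h1); nra.
Qed.

Lemma cos_taylor u (e : R) : 0 < e <= 1 ->
  `|cos u - (1 - u ^+ 2 / 2)| <= u ^+ 2 * (e + 2 * (e < `|u|)%R%:R).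
Proof.
move=> /andP[e0 e1].
(* The half-angle formula makes a difference of squares, which reduces the cosine to the bounds for
   the sine. *)
have E : cos u - (1 - u ^+ 2 / 2) = 2 * (u / 2 - sin (u / 2)) * (u / 2 + sin (u / 2)).
  by rewrite {1}(splitr u) cosD -!expr2 cos2sin2; field.
have h1 := norm_sin_sub_cubic (u / 2); have h2 := norm_sin_sub_linear (u / 2).
have h3 : `|u / 2 + sin (u / 2)| <= `|u|.
  have := ler_normD (u / 2) (sin (u / 2)); have := norm_sin_le (u / 2).
  rewrite normrM (ger0_norm (_ : 0 <= 2^-1)); lra.
have n2 : `|u / 2| = `|u| / 2 by rewrite normrM (ger0_norm (_ : 0 <= 2^-1)).
rewrite E !normrM distrC (ger0_norm (_ : 0 <= 2))//.
move: h1 h2; rewrite n2 => h1 h2.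
rewrite -[u ^+ 2]real_normK ?num_real//.
have s0 := normr_ge0 (sin (u / 2) - u / 2).
have t0 := normr_ge0 (u / 2 + sin (u / 2)).
have u0 := normr_ge0 u; move: h1 h2 h3 u0; set v := `|u|.
move: `|sin (u / 2) - u / 2| `|u / 2 + sin (u / 2)| s0 t0 => a b a0 b0 h1 h2 h3 u0.
have ab : 2 * a * b <= 2 * a * v by apply: ler_wpM2l => //; lra.
apply: (le_trans ab).
case: (ltP e v) => ev; rewrite ?mulr1 ?mulr0; first nra.
have : 2 * a * v <= 2 * ((v / 2) ^+ 3 / 2) * v by apply: ler_wpM2r => //; lra.
move/le_trans; apply.
have v2 : v ^+ 2 <= 1 by rewrite expr_le1// (le_trans ev).
have : v ^+ 3 <= e * 1 by rewrite exprS; apply: ler_pM => //; exact: sqr_ge0.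
rewrite (_ : 2 * _ * v = v ^+ 2 * (v ^+ 2 / 8)); last by field.
rewrite addr0 => h; apply: ler_wpM2l; first exact: sqr_ge0.
rewrite expr2; nra.
Qed.

Lemma expRN_taylor2 u : 0 <= u -> `|(1 - u) - expR (- u)| <= u ^+ 2.
Proof.
move=> u0; have a1 := expR_ge1Dx (- u); have a2 := expRN_le_inv u0.
have a3 : (1 + u)^-1 <= 1 - u + u ^+ 2.
  have u1 : 0 < 1 + u by lra.
  by rewrite -(ler_pM2r u1) mulVf ?gt_eqF//; have := mulr_ge0 u0 (sqr_ge0 u); nra.
by rewrite distrC ger0_norm; lra.
Qed.

Lemma expRN_lipschitz (a b : R) : 0 <= a -> 0 <= b ->
  `|expR (- a) - expR (- b)| <= `|a - b|.
Proof.
wlog ab : a b / a <= b.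
  move=> H a0 b0; have [ab|/ltW ba] := leP a b; first exact: H.
  by rewrite distrC [leRHS]distrC; exact: H.
move=> a0 b0; have e0 := expR_ge0 (- a).
rewrite ger0_norm ?subr_ge0 ?ler_expR ?lerN2// distrC ger0_norm ?subr_ge0//.
have e1 : expR (- a) <= 1 by rewrite expR_le1 oppr_le0.
have := expR_ge1Dx (a - b) => h.
rewrite (_ : - b = - a + (a - b)); last by ring.
rewrite expRD; have := ler_wpM2l e0 h; nra.
Qed.

End trigonometric_bounds.

Section walk_cosine.
Context {d dS : measure_display} {Omega : measurableType d}
  {St : measurableType dS} {R : realType}.
Variables (P : probability Omega R) (zeta : nat -> Omega -> St).
Hypothesis zeta_iid : iid P zeta.
Variable y : St -> R.
Hypotheses (my : measurable_fun setT y) (Ey : Ex P (fun w => y (zeta 0%N w)) = 0)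
  (Ly2 : L1 P (fun w => y (zeta 0%N w) ^+ 2)).

Let s2 := Ex P (fun w => y (zeta 0%N w) ^+ 2).

Let Y := fun w => y (zeta 0%N w).
Let mY : measurable_fun setT Y. Proof. exact: (measurable_step zeta_iid 0 my). Qed.
Let LY : L1 P Y. Proof. exact: L1_of_sqr. Qed.

Let s2_ge0 : 0 <= s2. Proof. by apply: Ex_ge0 => w; exact: sqr_ge0. Qed.

Let L1_cosf (f : Omega -> R) : measurable_fun setT f -> L1 P (fun w => cos (f w)).
Proof.
move=> mf; apply: (@L1_bounded _ _ _ _ _ 1); first by meas.
by move=> w; rewrite ler_norml cos_geN1 cos_le1.
Qed.

Let L1_sinf (f : Omega -> R) : measurable_fun setT f -> L1 P (fun w => sin (f w)).
Proof.
move=> mf; apply: (@L1_bounded _ _ _ _ _ 1); first by meas.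
by move=> w; rewrite ler_norml sin_geN1 sin_le1.
Qed.

(** The second-order expansion at 0 of the characteristic function of one centered step, real and
    imaginary parts apart. *)
Lemma Ex_cos_sin_step (e : R) : 0 < e -> exists2 u0 : R, 0 < u0 &
  forall u : R, `|u| <= u0 ->
  `|Ex P (fun w => cos (u * Y w)) - expR (- (u ^+ 2 * s2 / 2))|
  + `|Ex P (fun w => sin (u * Y w))| <= e * u ^+ 2.
Proof.
move=> e0.
have s0 := s2_ge0.
(* The threshold of the Taylor bounds. It costs [e / 8], and the tail, counted twice, another
   [e / 8]; sine, cosine and exponential then cost [e / 4] each. *)
pose h := Num.min 1 (e / (8 * (s2 + 1))).
have s81 : 0 < 8 * (s2 + 1) by lra.
have h0 : 0 < h by rewrite lt_min ltr01 divr_gt0.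
have h1 : h <= 1 by rewrite ge_min lexx.
have hs : h * s2 <= e / 8.
  have : h * (8 * (s2 + 1)) <= e by rewrite -ler_pdivlMr// ge_min lexx orbT.
  have := ltW h0; nra.
have mnY : measurable_fun setT (fun w => `|Y w|) by meas.
have Y20 w : 0 <= Y w ^+ 2 by exact: sqr_ge0.
have e16 : 0 < e / 16 by rewrite divr_gt0.
have [K K0 tail] := Ex_tail mnY Ly2 Y20 e16.
have mK : measurable_fun setT (fun w => (K < `|Y w|)%R%:R : R) by meas.
have LK : L1 P (fun w => Y w ^+ 2 * (K < `|Y w|)%R%:R).
  apply: (@L1_dominated _ _ _ _ _ (fun w => Y w ^+ 2)) => //; first by meas.
  by move=> w; case: (K < _)%R; rewrite ?mulr1 ?mulr0 ?Y20 ?lexx.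
have := tail K (lexx K); set tl := Ex P _ => tlK.
(* [h / K] makes [|u * Y| > h] imply [|Y| > K]; the other two bounds control the quadratic remainder
   of the exponential. *)
pose u0 := Num.min (h / K) (Num.min 1 (e / (s2 ^+ 2 + 1))).
have s21 : 0 < s2 ^+ 2 + 1 by have := sqr_ge0 s2; lra.
exists u0; first by rewrite !lt_min ltr01 !divr_gt0.
move=> u; rewrite !le_min => /and3P[uhK u1 ues].
have uh w : (h < `|u * Y w|)%R%:R <= (K < `|Y w|)%R%:R :> R.
  rewrite ler_nat; case: (ltP h `|u * Y w|) => // hu.
  suff -> : (K < `|Y w|)%R by [].
  have : h < h / K * `|Y w|.
    by apply: (lt_le_trans hu); rewrite normrM ler_wpM2r.
  by rewrite mulrAC -mulrA ltr_pMr// ltr_pdivlMr// mul1r.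
pose D w := u ^+ 2 * (h * Y w ^+ 2 + 2 * (Y w ^+ 2 * (K < `|Y w|)%R%:R)).
have hb : 0 < h <= 1 by rewrite h0.
have DP w (z : R) : `|z| <= (u * Y w) ^+ 2 * (h + 2 * (h < `|u * Y w|)%R%:R) -> `|z| <= D w.
  move/le_trans; apply; rewrite /D exprMn -mulrA ler_wpM2l ?sqr_ge0//.
  by rewrite mulrDr [_ * h]mulrC lerD2l mulrCA ler_pM2l// ler_wpM2l ?sqr_ge0.
have LhY := L1Z h Ly2; have L2K := L1Z 2 LK; have LhK := L1D LhY L2K.
have LD : L1 P D by exact: L1Z.
have ED : Ex P D <= u ^+ 2 * (e / 8 + e / 8).
  rewrite /D (ExZ _ LhK) (ExD LhY L2K) (ExZ _ Ly2) (ExZ _ LK).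
  rewrite ler_wpM2l ?sqr_ge0//; apply: lerD => //; rewrite -/tl; lra.
have muY : measurable_fun setT (fun w => u * Y w) by meas.
have mcos : measurable_fun setT (fun w => cos (u * Y w)) by meas.
have Lc := L1_cosf muY; have Ls := L1_sinf muY.
have LuY := L1Z u LY; have Lu2 := L1Z (u ^+ 2 / 2) Ly2.
have L1u := L1B (L1_cst P 1) Lu2.
have Hs : `|Ex P (fun w => sin (u * Y w))| <= Ex P D.
  have -> : Ex P (fun w => sin (u * Y w)) = Ex P (fun w => sin (u * Y w) - u * Y w).
    by rewrite (ExB Ls LuY) (ExZ _ LY) [Ex P Y]Ey mulr0 subr0.
  have LB := L1B Ls LuY.
  apply: (le_trans (norm_Ex LB)); apply: le_Ex => //; first exact: L1_norm.
  by move=> w; apply: DP; exact: sin_taylor.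
have Hc : `|Ex P (fun w => cos (u * Y w)) - (1 - u ^+ 2 / 2 * s2)| <= Ex P D.
  have -> : 1 - u ^+ 2 / 2 * s2 = Ex P (fun w => 1 - u ^+ 2 / 2 * Y w ^+ 2).
    by rewrite (ExB (L1_cst P 1) Lu2) Ex_cst (ExZ _ Ly2).
  rewrite -(ExB Lc L1u); have LB := L1B Lc L1u.
  apply: (le_trans (norm_Ex LB)); apply: le_Ex => //; first exact: L1_norm.
  move=> w; apply: DP; have := cos_taylor (u * Y w) hb.
  by rewrite exprMn [_ * Y w ^+ 2 / 2]mulrAC.
have He : `|(1 - u ^+ 2 / 2 * s2) - expR (- (u ^+ 2 * s2 / 2))| <= u ^+ 2 * (e / 4).
  set z := u ^+ 2 * s2 / 2.
  have z0 : 0 <= z by rewrite /z divr_ge0// mulr_ge0 ?sqr_ge0.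
  have -> : u ^+ 2 / 2 * s2 = z by rewrite /z mulrAC.
  have zz : z ^+ 2 <= u ^+ 2 * (e / 4).
    rewrite /z; have -> : (u ^+ 2 * s2 / 2) ^+ 2 = u ^+ 2 * (u ^+ 2 * s2 ^+ 2 / 4) by field.
    rewrite ler_wpM2l ?sqr_ge0// ler_pM2r//.
    have un := normr_ge0 u.
    have u2 : u ^+ 2 <= e / (s2 ^+ 2 + 1).
      rewrite -[u ^+ 2]real_normK ?num_real// (le_trans _ ues)//.
      by rewrite expr2 ler_piMl.
    apply: (@le_trans _ _ (e / (s2 ^+ 2 + 1) * s2 ^+ 2)).
      by apply: ler_wpM2r => //; exact: sqr_ge0.
    rewrite mulrAC -mulrA ler_piMr//; first exact: ltW.
    by rewrite ler_pdivrMr// mul1r; lra.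
  exact: le_trans (expRN_taylor2 z0) zz.
have := ler_distD (1 - u ^+ 2 / 2 * s2) (Ex P (fun w => cos (u * Y w)))
   (expR (- (u ^+ 2 * s2 / 2))).
have := sqr_ge0 u; have eu : 0 <= e * u ^+ 2 by rewrite mulr_ge0 ?sqr_ge0 ?ltW.
lra.
Qed.

(** The addition formula peels off one step. The factors multiplying the one-step errors are
    expectations of a cosine and a sine, at most 1, and [q <= 1], so the errors only add up. *)
Lemma Ex_cos_walk (u b : R) n :
  `|Ex P (fun w => cos (u * walk zeta y n w + b))
    - expR (- (u ^+ 2 * s2 / 2)) ^+ n * cos b| <=
  n%:R * (`|Ex P (fun w => cos (u * Y w)) - expR (- (u ^+ 2 * s2 / 2))|
          + `|Ex P (fun w => sin (u * Y w))|).
Proof.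
set q := expR _; set dlt : R := `|_ - q| + _.
elim: n => [|n IH].
  rewrite (_ : (fun w => _) = (fun=> cos b)).
    by rewrite Ex_cst expr0 mul1r subrr normr0 mul0r.
  by apply/funext => w; rewrite walk0 mulr0 add0r.
have aw : adapted zeta n (walk zeta y n) := adapted_walk my (leqnn n).
have ac : adapted zeta n (fun w => cos (u * walk zeta y n w + b)).
  by rewrite /adapted in aw *; meas.
have as_ : adapted zeta n (fun w => sin (u * walk zeta y n w + b)).
  by rewrite /adapted in aw *; meas.
have mw := measurable_walk zeta_iid n my.
have muw : measurable_fun setT (fun w => u * walk zeta y n w + b) by meas.
have muY : measurable_fun setT (fun w => u * Y w) by meas.
have mc : measurable_fun setT (fun s => cos (u * y s)) by meas.
have ms : measurable_fun setT (fun s => sin (u * y s)) by meas.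
have Lc := L1_cosf muw; have Ls := L1_sinf muw.
have LcY := L1_cosf muY; have LsY := L1_sinf muY.
have Lcc := adapted_L1M zeta_iid ac mc Lc LcY.
have Lss := adapted_L1M zeta_iid as_ ms Ls LsY.
have Ecc := adapted_ExM zeta_iid ac mc Lc LcY.
have Ess := adapted_ExM zeta_iid as_ ms Ls LsY.
have -> : Ex P (fun w => cos (u * walk zeta y n.+1 w + b)) =
    Ex P (fun w => cos (u * walk zeta y n w + b)) * Ex P (fun w => cos (u * Y w))
    - Ex P (fun w => sin (u * walk zeta y n w + b)) * Ex P (fun w => sin (u * Y w)).
  rewrite -Ecc -Ess -(ExB Lcc Lss); congr (Ex P); apply/funext => w.
  by rewrite walkS mulrDr addrAC cosD.
have B1 : `|Ex P (fun w => cos (u * walk zeta y n w + b))| <= 1.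
  apply: (le_trans (norm_Ex Lc)); rewrite -[leRHS](Ex_cst P).
  apply: le_Ex; [exact: L1_norm|exact: L1_cst|move=> w].
  by rewrite ler_norml cos_geN1 cos_le1.
have B2 : `|Ex P (fun w => sin (u * walk zeta y n w + b))| <= 1.
  apply: (le_trans (norm_Ex Ls)); rewrite -[leRHS](Ex_cst P).
  apply: le_Ex; [exact: L1_norm|exact: L1_cst|move=> w].
  by rewrite ler_norml sin_geN1 sin_le1.
move: IH B1 B2; rewrite /dlt.
move: (Ex P (fun w => cos (u * Y w))) (Ex P (fun w => sin (u * Y w))) => cY sY.
move: (Ex P (fun w => cos (_ + _))) (Ex P (fun w => sin (_ + _))) => A B IH B1 B2.
have q01 : 0 <= q <= 1.
  by rewrite expR_ge0 expR_le1 oppr_le0 divr_ge0// mulr_ge0 ?sqr_ge0.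
rewrite exprS -natr1 mulrDl mul1r.
have -> : A * cY - B * sY - q * q ^+ n * cos b =
    q * (A - q ^+ n * cos b) + (A * (cY - q) - B * sY) by ring.
apply: (le_trans (ler_normD _ _)); apply: lerD.
  case/andP: q01 => q0 q1; rewrite normrM (ger0_norm q0).
  by apply: le_trans IH; rewrite ler_piMl.
apply: (le_trans (ler_normB _ _)); rewrite !normrM; apply: lerD.
  by rewrite ler_piMl.
by rewrite ler_piMl.
Qed.

Theorem walk_clt_cos (mu th b e : R) : 0 < mu -> 0 < e ->
  exists2 t0 : R, 1 <= t0 & forall t n, t0 <= t -> n%:R <= t / mu < n.+1%:R ->
  `|Ex P (fun w => cos (th * (walk zeta y n w / Num.sqrt t) + b))
    - cos b * expR (- (th ^+ 2 * (s2 / mu) / 2))| <= e.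
Proof.
move=> mu0 e0.
have th20 : 0 <= th ^+ 2 := sqr_ge0 _.
have e0' := ltW e0; have mu0' := ltW mu0.
have th1 : 0 < th ^+ 2 + 1 by have := sqr_ge0 th; lra.
(* Tolerance per step, chosen so that [n <= t / mu] steps with [u ^+ 2 = th ^+ 2 / t] cost at most
   [e / 2]; the [+ 1] covers [th = 0]. *)
have e1 : 0 < e * mu / (2 * (th ^+ 2 + 1)) by rewrite divr_gt0 ?mulr_gt0.
have [u0 u00 H] := Ex_cos_sin_step e1.
have s20 := s2_ge0.
pose c := th ^+ 2 * s2 / e.
have c0 : 0 <= c by nonneg.
(* [c] makes the error of replacing [n] by [t / mu] in the exponent at most [e / 2]; the last term
   forces [|u| <= u0]. *)
pose t0 := 1 + c + th ^+ 2 / u0 ^+ 2.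
have tu0 : 0 <= th ^+ 2 / u0 ^+ 2 by rewrite divr_ge0// sqr_ge0.
exists t0; first by rewrite /t0; lra.
move=> t n t0t /andP[nt tn].
have t_gt0 : 0 < t by rewrite /t0 in t0t; lra.
have t0' := ltW t_gt0.
have st0 : 0 < Num.sqrt t by rewrite sqrtr_gt0.
pose u := th / Num.sqrt t.
have u2 : u ^+ 2 = th ^+ 2 / t by rewrite /u expr_div_n sqr_sqrtr// ltW.
have uu0 : `|u| <= u0.
  rewrite -(@ler_pXn2r _ 2) ?nnegrE ?(ltW u00)// real_normK ?num_real// u2.
  rewrite ler_pdivrMr// mulrC -ler_pdivrMr ?exprn_gt0//.
  by rewrite /t0 in t0t; lra.
have -> : (fun w => cos (th * (walk zeta y n w / Num.sqrt t) + b)) =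
    (fun w => cos (u * walk zeta y n w + b)).
  by apply/funext => w; congr (cos (_ + _)); rewrite /u mulrCA mulrC.
have h1 := Ex_cos_walk u b n.
have n0 : 0 <= n%:R :> R by exact: ler0n.
have h2 := ler_wpM2l n0 (H u uu0).
have h3 : n%:R * (e * mu / (2 * (th ^+ 2 + 1)) * u ^+ 2) <= e / 2.
  rewrite u2; apply: (@le_trans _ _ (t / mu * (e * mu / (2 * (th ^+ 2 + 1)) * (th ^+ 2 / t)))).
    by apply: ler_wpM2r => //; nonneg.
  have -> : t / mu * (e * mu / (2 * (th ^+ 2 + 1)) * (th ^+ 2 / t)) =
     e / 2 * (th ^+ 2 / (th ^+ 2 + 1)).
    by field; rewrite !gt_eqF.
  rewrite ler_piMr//; first by nonneg.
  by rewrite ler_pdivrMr// mul1r; lra.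
have h4 : `|expR (- (u ^+ 2 * s2 / 2)) ^+ n * cos b
     - cos b * expR (- (th ^+ 2 * (s2 / mu) / 2))| <= e / 2.
  rewrite mulrC -mulrBr normrM; apply: (@le_trans _ _ (1 *
    `|n%:R * (u ^+ 2 * s2 / 2) - th ^+ 2 * (s2 / mu) / 2|)).
    apply: ler_pM => //; first by rewrite ler_norml cos_geN1 cos_le1.
    rewrite -expRM_natl mulrN; apply: expRN_lipschitz.
      by nonneg.
    by nonneg.
  rewrite mul1r u2.
  have -> : n%:R * (th ^+ 2 / t * s2 / 2) - th ^+ 2 * (s2 / mu) / 2 =
      (n%:R - t / mu) * (th ^+ 2 * s2 / t / 2).
    by field; rewrite !gt_eqF.
  have v0 : 0 <= th ^+ 2 * s2 / t by nonneg.
  rewrite normrM [X in _ * X]ger0_norm; last by rewrite divr_ge0.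
  apply: (@le_trans _ _ (1 * (th ^+ 2 * s2 / t / 2))).
    apply: ler_wpM2r; first by nonneg.
    move: nt tn; rewrite -natr1; move: (t / mu) (n%:R) => v k a1 a2.
    by rewrite distrC ger0_norm; lra.
  rewrite mul1r ler_pM2r// ler_pdivrMr// [e * t]mulrC -ler_pdivrMr//.
  by rewrite -/c; rewrite /t0 in t0t; lra.
have := ler_distD (expR (- (u ^+ 2 * s2 / 2)) ^+ n * cos b)
  (Ex P (fun w => cos (u * walk zeta y n w + b)))
  (cos b * expR (- (th ^+ 2 * (s2 / mu) / 2))).
move: h1 h2 h3 h4; lra.
Qed.

End walk_cosine.

(** * Weak convergence from cosines *)

Section clamp.
Context {R : realType}.

(** For [c >= 0] this is the truncation of [v] to [[- c, c]]; written with absolute values it is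
    visibly continuous. *)
Definition clamp (c v : R) := (`|v + c| - `|v - c|) / 2.

Lemma clamp_id c v : `|v| <= c -> clamp c v = v.
Proof.
rewrite ler_norml => /andP[v1 v2]; rewrite /clamp ger0_norm ?ler0_norm; lra.
Qed.

Lemma norm_clamp c v : 0 <= c -> `|clamp c v| <= c.
Proof.
move=> c0; rewrite /clamp normrM (ger0_norm (_ : 0 <= 2^-1))// ler_pdivrMr//.
apply: (le_trans (ler_dist_dist _ _)).
by rewrite (_ : v + c - (v - c) = c * 2) ?ger0_norm ?mulr_ge0//; ring.
Qed.

Lemma norm_clamp_le c v : 0 <= c -> `|clamp c v| <= `|v|.
Proof.
move=> c0; have [vc|cv] := lerP `|v| c; first by rewrite clamp_id.
exact: le_trans (norm_clamp _ c0) (ltW cv).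
Qed.

Lemma continuous_clamp c : continuous (clamp c).
Proof.
move=> v; apply: cvgMl; apply: cvgB; apply: cvg_norm.
  by apply: cvgD; [exact: cvg_id|exact: cvg_cst].
by apply: cvgB; [exact: cvg_id|exact: cvg_cst].
Qed.

End clamp.

(** * Bernstein polynomials and uniform approximation on the unit interval *)

Section bernstein.
Context {R : realType}.

(* [bernstein u n g] is the expectation of [g] under the binomial law B(n, u). *)
Fixpoint bernstein (u : R) n (g : nat -> R) : R :=
  if n is m.+1 then
    u * bernstein u m (fun k => g k.+1) + (1 - u) * bernstein u m g
  else g 0%N.

Lemma bernstein_le (u : R) n f g : 0 <= u <= 1 -> (forall k, f k <= g k) ->
  bernstein u n f <= bernstein u n g.
Proof.
move=> /andP[u0 u1]; elim: n f g => [|n IH] f g fg /=; first exact: fg.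
by apply: lerD; apply: ler_wpM2l; rewrite ?subr_ge0//; apply: IH.
Qed.

Lemma bernstein_norm (u : R) n g (M : R) : 0 <= u <= 1 -> (forall k, `|g k| <= M) ->
  `|bernstein u n g| <= M.
Proof.
move=> /andP[u0 u1]; elim: n g => [|n IH] g gM /=; first exact: gM.
have v0 : 0 <= 1 - u by rewrite subr_ge0.
apply: (le_trans (ler_normD _ _)); rewrite !normrM (ger0_norm u0) (ger0_norm v0).
have := ler_wpM2l u0 (IH (fun k => g k.+1) (fun k => gM k.+1)).
by have := ler_wpM2l v0 (IH g gM); lra.
Qed.

Lemma bernstein_affine u n a b f :
  bernstein u n (fun k => a * f k + b) = a * bernstein u n f + b.
Proof. by elim: n f => [//|n IH] f /=; rewrite !IH; ring. Qed.

Lemma bernstein_variance u n c :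
  bernstein u n (fun k => (k%:R - c) ^+ 2) =
  n%:R * u * (1 - u) + (n%:R * u - c) ^+ 2.
Proof.
elim: n c => [|n IH] c /=; first by ring.
have -> : (fun k : nat => (k.+1%:R - c) ^+ 2) = (fun k => (k%:R - (c - 1)) ^+ 2).
  by apply/funext => k; congr (_ ^+ 2); rewrite -natr1; ring.
by rewrite !IH -natr1; ring.
Qed.

(** Heine-Cantor with only [u] confined to the interval: [v] will be [k / n] for every natural [k],
    since [bernstein_le] compares functions at all of them. *)
Lemma continuous_uniform_itv (F : R -> R) (e : R) : continuous F -> 0 < e ->
  exists2 d : R, 0 < d & forall u v : R, 0 <= u <= 1 -> `|u - v| < d -> `|F u - F v| < e.
Proof.
move=> cF e0.
have /compact_near_coveringP cov := @segment_compact R 0 1.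
have : \forall d \near (0 : R)^'+, `[0, 1] `<=` (fun u => forall v, `|u - v| < d ->
    `|F u - F v| < e).
  apply: cov => u _.
  have e2 : 0 < e / 2 by rewrite divr_gt0.
  have /cvgrPdist_lt/(_ _ e2)/nbhs_ballP[r /= r0 Fr] := cF u.
  have r2 : 0 < r / 2 by rewrite divr_gt0.
  exists (ball u (r / 2), [set d | 0 < d < r / 2]) => /=.
    split; first by apply: nbhsx_ballx.
    near=> d => /=; apply/andP; split; near: d; first exact: nbhs_right_gt.
    exact: nbhs_right_lt.
  move=> [u' d] /= [uu' /andP[d0 dr]] v u'v.
  have h1 : `|F u - F u'| < e / 2 by apply: Fr; apply: lt_trans uu' _; lra.
  have h2 : `|F u - F v| < e / 2.
    apply: Fr => /=; rewrite /ball/=.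
    have := ler_distD u' u v; have : `|u - u'| < r / 2 by exact: uu'.
    lra.
  by have := ler_distD (F u) (F u') (F v); rewrite (distrC (F u') (F u)); lra.
move=> [r /= r0 H]; exists (r / 2); first by rewrite divr_gt0.
move=> u v u01 uv.
have r2 : 0 < r / 2 by rewrite divr_gt0.
have rr : r / 2 < r by lra.
apply: (H (r / 2)) => //=.
by rewrite sub0r normrN gtr0_norm.
Unshelve. all: by end_near. Qed.

(** Bernstein's proof by Chebyshev's argument: [|F u - F v|] is at most [e / 2] plus
    [2 * M / d ^+ 2] times the squared distance, whose binomial mean is at most [1 / n]. *)
Lemma bernstein_approx (F : R -> R) (M e : R) : continuous F ->
  (forall u, `|F u| <= M) -> 0 < e -> exists n, forall u : R, 0 <= u <= 1 ->
  `|F u - bernstein u n (fun k => F (k%:R / n%:R))| <= e.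
Proof.
move=> cF FM e0; have e2 : 0 < e / 2 by rewrite divr_gt0.
have [d d0 Fd] := continuous_uniform_itv cF e2.
have M0 : 0 <= M by exact: le_trans (FM 0).
pose c := 2 * M / d ^+ 2.
have d20 : 0 < d ^+ 2 by rewrite exprn_gt0.
have c0 : 0 <= c by rewrite divr_ge0 ?mulr_ge0// ltW.
pose n := (Num.truncn (2 * c / e)).+1.
have n0 : 0 < n%:R :> R by rewrite ltr0n.
have cn : c / n%:R <= e / 2.
  have : 2 * c / e < n%:R by apply: truncnS_gt.
  rewrite ltr_pdivrMr// => h; rewrite ler_pdivrMr//; lra.
exists n => u u01; have /andP[u0 u1] := u01.
have Fuv v : `|F u - F v| <= e / 2 + c * (v - u) ^+ 2.
  have q0 : 0 <= c * (v - u) ^+ 2 by rewrite mulr_ge0 ?sqr_ge0.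
  have [uv|uv] := ltP `|u - v| d; first by have := ltW (Fd _ _ u01 uv); lra.
  apply: (@le_trans _ _ (2 * M)).
    by have := ler_normB (F u) (F v); have := FM u; have := FM v; lra.
  have : c * d ^+ 2 <= c * (v - u) ^+ 2.
    apply: ler_wpM2l => //; rewrite -[(v - u) ^+ 2]real_normK ?num_real// distrC.
    by rewrite lerXn2r ?nnegrE ?(ltW d0).
  by rewrite /c divfK ?gt_eqF//; lra.
have var : bernstein u n (fun k => (k%:R / n%:R - u) ^+ 2) <= n%:R^-1.
  have -> : (fun k : nat => (k%:R / n%:R - u) ^+ 2) =
      (fun k => n%:R ^- 2 * (k%:R - n%:R * u) ^+ 2 + 0).
    by apply/funext => k; field; rewrite gt_eqF.
  rewrite bernstein_affine bernstein_variance subrr expr0n !addr0.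
  rewrite (_ : _ * _ = n%:R^-1 * (u * (1 - u))); last by field; rewrite gt_eqF.
  by rewrite ler_piMr ?invr_ge0 ?(ltW n0)//; nra.
have bnd : bernstein u n (fun k => e / 2 + c * (k%:R / n%:R - u) ^+ 2) <= e.
  rewrite (_ : (fun k => _) = (fun k => c * (k%:R / n%:R - u) ^+ 2 + e / 2)).
    by rewrite bernstein_affine; have := ler_wpM2l c0 var; lra.
  by apply/funext => k; rewrite addrC.
set g := fun k : nat => F (k%:R / n%:R).
have h1 : bernstein u n (fun k => 1 * g k + - F u) <= e.
  apply: le_trans bnd; apply: bernstein_le => // k.
  have := Fuv (k%:R / n%:R); rewrite distrC ler_norml => /andP[_]; rewrite /g; lra.
have h2 : bernstein u n (fun k => -1 * g k + F u) <= e.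
  apply: le_trans bnd; apply: bernstein_le => // k.
  have := Fuv (k%:R / n%:R); rewrite ler_norml => /andP[_]; rewrite /g; lra.
move: h1 h2; rewrite !bernstein_affine => h1 h2.
rewrite ler_norml; apply/andP; split; lra.
Qed.

End bernstein.

(** * A continuity theorem of Levy type: cosines and tightness imply weak convergence *)

Section levy_continuity.
Context {d : measure_display} {Omega : measurableType d} {R : realType}.
Variables (P : probability Omega R) (X : R -> Omega -> R).
Variable nu : probability (measurableTypeR R) R.
Hypothesis mX : forall t, measurable_fun setT (X t).

Definition weak_test (h : R -> R) :=
  [/\ continuous h, exists M : R, forall x : R, `|h x| <= M &
      Ex P (fun w => h (X t w)) @[t --> +oo] --> Ex nu h].

Lemma L1_test_P (h : R -> R) t : continuous h -> (exists M : R, forall x : R, `|h x| <= M) ->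
  L1 P (fun w => h (X t w)).
Proof.
move=> ch [M hM]; apply: (@L1_bounded _ _ _ _ _ M) => //.
exact: (mf_cont ch (mX t)).
Qed.

Lemma L1_test_nu (h : R -> R) : continuous h -> (exists M : R, forall x : R, `|h x| <= M) ->
  L1 nu h.
Proof.
move=> ch [M hM]; apply: (@L1_bounded _ _ _ _ _ M) => //.
exact: continuous_measurable_fun.
Qed.

Lemma weak_test_lin (a b : R) f g : weak_test f -> weak_test g ->
  weak_test (fun x => a * f x + b * g x).
Proof.
move=> [cf bf vf] [cg bg vg]; split.
- move=> x; apply: cvgD; apply: cvgMr; [exact: cf|exact: cg].
- have [M fM] := bf; have [M' gM] := bg.
  exists (`|a| * M + `|b| * M') => x; apply: (le_trans (ler_normD _ _)).
  by rewrite !normrM; apply: lerD; apply: ler_wpM2l.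
- have Lf t := L1_test_P t cf bf; have Lg t := L1_test_P t cg bg.
  have Nf := L1_test_nu cf bf; have Ng := L1_test_nu cg bg.
  rewrite (ExD (L1Z a Nf) (L1Z b Ng)) (ExZ _ Nf) (ExZ _ Ng).
  under eq_fun do rewrite (ExD (L1Z a (Lf _)) (L1Z b (Lg _))) (ExZ _ (Lf _)) (ExZ _ (Lg _)).
  by apply: cvgD; apply: cvgMr.
Qed.

Hypothesis cos_test : forall th b : R, weak_test (fun x => cos (th * x + b)).

(** The sine moved into [[0, 1]], where it can serve as the success probability in [bernstein]. *)
Definition sin_coord (c x : R) := (1 + sin (c * x)) / 2.

(* Multiplying by [sin (c x)] shifts the frequency of a cosine by [+- c]. *)
Lemma weak_test_cos_bernstein c n g th b :
  weak_test (fun x => cos (th * x + b) * bernstein (sin_coord c x) n g).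
Proof.
elim: n g th b => [|n IH] g th b /=.
  have := weak_test_lin (g 0%N) 0 (cos_test th b) (cos_test th b).
  by congr weak_test; apply/funext => x; rewrite mul0r addr0 mulrC.
have T1 := weak_test_lin (1 / 4) (1 / 4) (IH (fun k => g k.+1) (c + th) (b - pi / 2))
  (IH (fun k => g k.+1) (c - th) (- b - pi / 2)).
have T2 := weak_test_lin (- (1 / 4)) (- (1 / 4)) (IH g (c + th) (b - pi / 2))
  (IH g (c - th) (- b - pi / 2)).
have T3 := weak_test_lin (1 / 2) (1 / 2) (IH (fun k => g k.+1) th b) (IH g th b).
have := weak_test_lin 1 1 T3 (weak_test_lin 1 1 T1 T2).
congr weak_test; apply/funext => x.
have E1 : (c + th) * x + (b - pi / 2) = (c * x + (th * x + b)) - pi / 2 by ring.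
have E2 : (c - th) * x + (- b - pi / 2) = (c * x - (th * x + b)) - pi / 2 by ring.
by rewrite E1 E2 !cosBpihalf sinD sinB /sin_coord; field.
Qed.

Lemma weak_test_bernstein c n g : weak_test (fun x => bernstein (sin_coord c x) n g).
Proof.
have := weak_test_cos_bernstein c n g 0 0.
by congr weak_test; apply/funext => x; rewrite mul0r addr0 cos0 mul1r.
Qed.

Hypothesis tight : forall e : R, 0 < e -> exists2 L : R, 0 < L &
  \forall t \near +oo, Ex P (fun w => (L < `|X t w|)%R%:R) <= e.

Lemma tight_nu (e : R) : 0 < e -> exists2 L : R, 0 < L &
  forall K : R, L <= K -> Ex nu (fun x : R => (K < `|x|)%R%:R) <= e.
Proof.
move=> e0; have mn : measurable_fun setT (fun x : measurableTypeR R => `|x : R|).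
  exact: mf_norm.
have [L L0 H] := Ex_tail mn (L1_cst nu 1) (fun=> ler01) e0.
exists L => // K LK; have := ltW (H K LK).
by rewrite (_ : (fun w => 1 * _) = (fun x : R => (K < `|x|)%R%:R))//;
  apply/funext => x; rewrite mul1r.
Qed.

(* With [c = pi / (4 L)] the map [x |-> sin (c x)] is invertible on [-L, L]. *)
Lemma sin_coord_section (f : R -> R) (M L : R) : continuous f ->
  (forall x, `|f x| <= M) -> 0 < L ->
  exists (F : R -> R) (c : R), [/\ continuous F, forall u : R, `|F u| <= M &
    forall x, `|x| <= L -> F (sin_coord c x) = f x].
Proof.
move=> cf fM L0; have pi0 := pi_gt0 R.
pose c := pi / 4 / L; pose s := sin (pi / 4) : R.
have c0 : 0 < c by rewrite !divr_gt0.
have pi4 : (pi / 4 : R) \in `[- (pi / 2), pi / 2] by rewrite in_itv/=; apply/andP; split; lra.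
have pi2 : (pi / 2 : R) \in `[- (pi / 2), pi / 2] by rewrite in_itv/=; apply/andP; split; lra.
have s0 : 0 < s by apply: sin_gt0_pihalf; apply/andP; split; lra.
have s1 : s < 1 by rewrite -sin_pihalf /s ltr_sin//; lra.
pose F (u : R) : R := f (asin (clamp s (2 * u - 1)) / c).
exists F, c; split.
- move=> u; have nc := norm_clamp (2 * u - 1) (ltW s0).
  apply: (@continuous_comp R R R (fun u => asin (clamp s (2 * u - 1)) / c) f); last exact: cf.
  apply: cvgMl; apply: (@continuous_comp R R R (fun u => clamp s (2 * u - 1)) asin).
    apply: (@continuous_comp R R R (fun u => 2 * u - 1) (clamp s)).
      by apply: cvgB; [apply: cvgMr; exact: cvg_id|exact: cvg_cst].
    exact: continuous_clamp.
  apply: continuous_asin; move: nc; rewrite ler_norml => /andP[]; set v := clamp _ _.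
  by move=> h1 h2; apply/andP; split; lra.
- by move=> u; exact: fM.
- move=> x xL; rewrite /F /sin_coord.
  rewrite (_ : 2 * _ - 1 = sin (c * x)); last by field.
  have cx : `|c * x| <= pi / 4.
    rewrite normrM (gtr0_norm c0); apply: (le_trans (ler_wpM2l (ltW c0) xL)).
    by rewrite /c divfK// gt_eqF.
  move: (cx); rewrite ler_norml => /andP[cx1 cx2].
  have cxI : c * x \in `[- (pi / 2), pi / 2] by rewrite in_itv/=; apply/andP; split; lra.
  rewrite clamp_id ?sinK//; first by rewrite mulrAC divff ?mul1r// gt_eqF.
  have Npi4 : (- (pi / 4) : R) \in `[- (pi / 2), pi / 2].
    by rewrite in_itv/=; apply/andP; split; lra.
  have les : {in `[- (pi / 2), pi / 2] &, {mono (@sin R) : x y / x <= y}}.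
    by apply: le_mono_in => v w vI wI; rewrite ltr_sin.
  by rewrite ler_norml /s -sinN !les//; apply/andP; split; lra.
Qed.

Lemma sin_coord01 c x : 0 <= sin_coord c x <= 1.
Proof.
rewrite /sin_coord; have := sin_geN1 (c * x); have := sin_le1 (c * x).
by move=> h1 h2; apply/andP; split; lra.
Qed.

Lemma Ex_approx_compact {d'} {T : measurableType d'} (Q : probability T R) (Z : T -> R)
    (f g : R -> R) (e M L : R) :
  measurable_fun setT Z -> continuous f -> continuous g -> 0 <= e -> 0 <= M ->
  (forall x, `|f x| <= M) -> (forall x, `|g x| <= M) ->
  (forall x, `|x| <= L -> `|f x - g x| <= e) ->
  `|Ex Q (fun w => f (Z w)) - Ex Q (fun w => g (Z w))|
    <= e + 2 * M * Ex Q (fun w => (L < `|Z w|)%R%:R).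
Proof.
move=> mZ cf cg e0 M0 fM gM fg.
have mf : measurable_fun setT (fun w => f (Z w)) by exact: mf_cont.
have mg : measurable_fun setT (fun w => g (Z w)) by exact: mf_cont.
have Lf : L1 Q (fun w => f (Z w)) by apply: (@L1_bounded _ _ _ _ _ M).
have Lg : L1 Q (fun w => g (Z w)) by apply: (@L1_bounded _ _ _ _ _ M).
have LI : L1 Q (fun w => (L < `|Z w|)%R%:R).
  apply: (@L1_bounded _ _ _ _ _ 1); first by meas.
  by move=> w; rewrite ger0_norm ?ler0n// lern1 leq_b1.
have LfB := L1B Lf Lg; have LI' := L1Z (2 * M) LI.
rewrite -(ExB Lf Lg) -(ExZ _ LI) -[X in X + _](Ex_cst Q e) -(ExD (L1_cst Q e) LI').
apply: (le_trans (norm_Ex LfB)); apply: le_Ex.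
- exact: L1_norm.
- by apply: L1D => //; exact: L1_cst.
- move=> w; case: (ltP L `|Z w|) => ZL; rewrite ?mulr1 ?mulr0 ?addr0; last exact: fg.
  have := ler_normB (f (Z w)) (g (Z w)); have := fM (Z w); have := gM (Z w); lra.
Qed.

(** On [[- L, L]] the function is close to a polynomial in a sine. Off it, that polynomial is still
    bounded by [M], being an average of values of [F], so tightness of the family and of [nu]
    controls the rest. *)
Theorem weak_test_bounded_continuous (f : R -> R) : continuous f ->
  (exists M : R, forall x : R, `|f x| <= M) -> weak_test f.
Proof.
move=> cf bf; split => //; have [M fM] := bf.
have M0 : 0 <= M by exact: le_trans (fM 0).
apply/cvgrPdist_le => e e0.
(* Each of the two approximations costs [e' + 2 * M * e'] and the limit costs [e']: together less
   than [e]. *)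
pose e' : R := e / (5 + 4 * M).
have M1 : 0 < 5 + 4 * M by lra.
have e'0 : 0 < e' by rewrite divr_gt0.
have [L1' L10 tP] := tight e'0; have [L2' L20 tN] := tight_nu e'0.
pose L := Num.max L1' L2'.
have L0 : 0 < L by rewrite lt_max L10.
have [F [c [cF FM Ff]]] := sin_coord_section cf fM L0.
have [n Fn] := bernstein_approx cF FM e'0.
pose g x := bernstein (sin_coord c x) n (fun k => F (k%:R / n%:R)).
have [cg bg vg] := weak_test_bernstein c n (fun k => F (k%:R / n%:R)).
have gM x : `|g x| <= M.
  by apply: bernstein_norm; [exact: sin_coord01|move=> k; exact: FM].
have fg (x : R) : `|x| <= L -> `|f x - g x| <= e'.
  by move=> xL; rewrite -(Ff _ xL); apply: Fn; exact: sin_coord01.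
have HN := Ex_approx_compact nu (@measurable_id _ (measurableTypeR R) setT) cf cg (ltW e'0) M0 fM gM fg.
have hN : `|Ex nu f - Ex nu g| <= e' + 2 * M * e'.
  apply: (le_trans HN); rewrite lerD2l ler_wpM2l ?mulr_ge0//.
  by apply: tN; rewrite le_max lexx orbT.
move/cvgrPdist_le : vg => /(_ _ e'0) vg.
near=> t.
have h1 : `|Ex nu g - Ex P (fun w => g (X t w))| <= e' by near: t.
have h2 : Ex P (fun w => (L1' < `|X t w|)%R%:R) <= e' by near: t.
have h3 : `|Ex P (fun w => f (X t w)) - Ex P (fun w => g (X t w))| <= e' + 2 * M * e'.
  apply: (le_trans (Ex_approx_compact P (mX t) cf cg (ltW e'0) M0 fM gM fg)).
  rewrite lerD2l ler_wpM2l ?mulr_ge0//; apply: le_trans h2.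
  have mXt := mX t; apply: le_Ex.
  - apply: (@L1_bounded _ _ _ _ _ 1); first by meas.
    by move=> w; rewrite ger0_norm ?ler0n// lern1 leq_b1.
  - apply: (@L1_bounded _ _ _ _ _ 1); first by meas.
    by move=> w; rewrite ger0_norm ?ler0n// lern1 leq_b1.
  - move=> w; rewrite ler_nat; case: (ltP L `|X t w|) => // LX.
    by rewrite (_ : (L1' < `|X t w|)%R)// (le_lt_trans _ LX)// le_max lexx.
have e'E : e = (5 + 4 * M) * e' by rewrite mulrC divfK// gt_eqF.
have := ler_distD (Ex nu g) (Ex nu f) (Ex P (fun w => f (X t w))).
have := ler_distD (Ex P (fun w => g (X t w))) (Ex nu g) (Ex P (fun w => f (X t w))).
rewrite (distrC (Ex P (fun w => g (X t w)))).
have : 0 <= M * e' by rewrite mulr_ge0// ltW.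
lra.
Unshelve. all: by end_near. Qed.

End levy_continuity.

(** * Convergence of moments *)

Section moment_convergence.
Context {d : measure_display} {Omega : measurableType d} {R : realType}.

(** Monotone convergence; integrability of [f] is obtained together with the bound. *)
Lemma Ex_le_of_truncations {d'} {T : measurableType d'} (Q : probability T R)
    (f g : T -> R) (B : R) :
  measurable_fun setT f -> measurable_fun setT g -> (forall w, 0 <= f w) ->
  (forall n, L1 Q (fun w => f w * (g w <= n%:R)%R%:R)) ->
  (forall n, Ex Q (fun w => f w * (g w <= n%:R)%R%:R) <= B) ->
  L1 Q f /\ Ex Q f <= B.
Proof.
move=> mf mg f0 Lf fB.
have := @cvg_monotone_convergence _ _ _ Q setT measurableT
  (fun n w => (f w * (g w <= n%:R)%R%:R)%:E).
have E w : limn (fun n => (f w * (g w <= n%:R)%R%:R)%:E) = (f w)%:E.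
  apply: cvg_lim => //; apply: cvg_near_cst; near=> n.
  rewrite (_ : g w <= n%:R) ?mulr1//.
  by apply: ltW; near: n; exact: nbhs_infty_gtr.
under eq_integral do rewrite E.
move=> cv; have {}cv : (\int[Q]_w (f w * (g w <= n%:R)%R%:R)%:E @[n --> \oo] -->
    \int[Q]_w (f w)%:E)%E.
  apply: cv.
  - by move=> n; apply/measurable_EFinP; meas.
  - by move=> n w _; rewrite lee_fin mulr_ge0.
  - move=> w _ m n mn; rewrite lee_fin ler_wpM2l// ler_nat.
    case: (leP (g w)) => // gm; rewrite (le_trans gm)// ler_nat//.
have le_B : (\int[Q]_w (f w)%:E <= B%:E)%E.
  rewrite -(cvg_lim _ cv)//; apply: lime_le; first by apply/cvg_ex; eexists; exact: cv.
  by near=> n; rewrite (Ex_EFin (Lf n)) lee_fin.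
have Lf' : L1 Q f by apply: L1_ge0 => //; exact: le_lt_trans (ltry B).
by split => //; rewrite -lee_fin -(Ex_EFin Lf').
Unshelve. all: by end_near. Qed.

Variables (P : probability Omega R) (X : R -> Omega -> R).
Variable nu : probability (measurableTypeR R) R.
Variable r : R.
Hypothesis mX : forall t, measurable_fun setT (X t).
Hypothesis weak : forall f : R -> R, continuous f ->
  (exists M : R, forall x : R, `|f x| <= M) ->
  Ex P (fun w => f (X t w)) @[t --> +oo] --> Ex nu f.
Hypothesis r1 : 1 <= r.
Hypothesis LX : forall t : R, 1 <= t -> L1 P (fun w => `|X t w| `^ r).
Hypothesis ui : forall e : R, 0 < e -> exists2 K : R, 0 < K & forall t : R, 1 <= t ->
  Ex P (fun w => `|X t w| `^ r * (K < `|X t w| `^ r)%R%:R) <= e.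

Let midR := @measurable_id _ (measurableTypeR R) setT.

Lemma moment_bound : exists B : R, forall t : R, 1 <= t ->
  Ex P (fun w => `|X t w| `^ r) <= B.
Proof.
have [K K0 HK] := ui (@ltr01 R); exists (K + 1) => t t1.
have mXt := mX t; have L := LX t1.
have LI : L1 P (fun w => `|X t w| `^ r * (K < `|X t w| `^ r)%R%:R).
  apply: (L1_dominated _ L); first by meas.
  by move=> w; case: (_ < _); rewrite ?mulr1 ?mulr0 powR_ge0 ?lexx.
apply: le_trans (_ : Ex P (fun w => K + `|X t w| `^ r * (K < `|X t w| `^ r)%R%:R) <= _).
  apply: le_Ex => //; first exact: L1D (L1_cst _ _) LI.
  by move=> w; case: ltP; rewrite ?mulr1 ?mulr0; have := ltW K0; lra.
by rewrite (ExD (L1_cst _ _) LI) Ex_cst; have := HK _ t1; lra.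
Qed.

(** Away from 0 the power is derivable; at 0 the radius is the power [s^-1] of [e]. *)
Lemma continuous_norm_powR (s : R) : 0 < s -> continuous (fun x : R => `|x| `^ s).
Proof.
move=> s0 x; have [->|x0] := eqVneq x 0.
  rewrite /continuous_at normr0 powR0 ?gt_eqF//; apply/cvgrPdist_lt => e e0.
  near=> z; rewrite sub0r normrN ger0_norm ?powR_ge0//.
  rewrite (_ : e = (e `^ s^-1) `^ s); last by rewrite -powRrM mulVf ?gt_eqF// powRr1 ?ltW.
  rewrite gt0_ltr_powR ?nnegrE ?powR_ge0//.
  near: z; have es : 0 < e `^ s^-1 by rewrite powR_gt0.
  exists (e `^ s^-1) => // z /=; by rewrite sub0r normrN.
apply: (@continuous_comp R R R (fun u => `|u|) (fun u => u `^ s)).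
  exact: norm_continuous.
apply/differentiable_continuous/derivable1_diffP/derivable_powR.
by rewrite in_itv/= normr_gt0 x0.
Unshelve. all: by end_near. Qed.

Lemma norm_clamp_powR_bounded (c : R) : 0 <= c ->
  exists M : R, forall x : R, `| `|clamp c x| `^ r| <= M.
Proof.
move=> c0; exists (c `^ r) => x; rewrite ger0_norm ?powR_ge0//.
by have rr := r1; apply: powR_mono => //; [lra|exact: norm_clamp].
Qed.

(** The r-th power of [|clamp n x|] is a bounded continuous test function, so its mean under [nu]
    inherits the uniform bound; then [n] tends to infinity. *)
Lemma L1_nu_pow : L1 nu (fun x => `|x| `^ r).
Proof.
have [B HB] := moment_bound; have r0 : 0 < r by have := r1; lra.
have mid := midR.
have mN : measurable_fun setT (fun x : measurableTypeR R => `|x|) by exact: mf_norm.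
have mp : measurable_fun setT (fun x : measurableTypeR R => `|x| `^ r) by exact: mf_pow.
have mcl (c : R) : measurable_fun setT (fun x : measurableTypeR R => `|clamp c x| `^ r).
  by apply/mf_pow/mf_norm; exact: (mf_cont (@continuous_clamp R c)).
have Ln (n : nat) : L1 nu (fun x => `|x| `^ r * (`|x| <= n%:R)%R%:R).
  apply: (@L1_bounded _ _ _ _ _ (n%:R `^ r)); first by meas.
  move=> x; rewrite ger0_norm; last by rewrite mulr_ge0// powR_ge0.
  case: (leP `|x| n%:R) => xn; rewrite ?mulr1 ?mulr0 ?powR_ge0//.
  exact: powR_mono (ltW r0) _ xn.
apply: (proj1 (Ex_le_of_truncations mp mN _ Ln (B := B) _)) => [x|n]; first exact: powR_ge0.
have n0 : 0 <= n%:R :> R by exact: ler0n.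
have Lc : L1 nu (fun x => `|clamp n%:R x| `^ r).
  have [M hM] := norm_clamp_powR_bounded n0; exact: (L1_bounded nu (mcl _) hM).
apply: (@le_trans _ _ (Ex nu (fun x => `|clamp n%:R x| `^ r))).
  apply: le_Ex => // x; case: (leP `|x| n%:R) => xn; rewrite ?mulr1 ?mulr0 ?powR_ge0//.
  by rewrite clamp_id.
have cc : continuous (fun x : R => `|clamp n%:R x| `^ r).
  move=> x; apply: (@continuous_comp R R R (clamp n%:R) (fun u => `|u| `^ r)).
    exact: continuous_clamp.
  exact: continuous_norm_powR.
have W := weak cc (norm_clamp_powR_bounded n0).
apply: (cvgr_to_le W); near=> t.
have t1 : 1 <= t by near: t; exact: nbhs_pinfty_ge.
have mXt := mX t; apply: le_trans (HB t t1); apply: le_Ex; last first.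
- by move=> w; rewrite powR_mono ?(ltW r0)// norm_clamp_le.
- exact: LX.
- apply: (L1_dominated (mf_cont cc mXt) (LX t1)) => w.
  by rewrite powR_ge0 powR_mono ?(ltW r0)// norm_clamp_le.
Unshelve. all: by end_near. Qed.

Lemma L1_growth {d'} {T : measurableType d'} (Q : probability T R) (V : T -> R)
    (g : R -> R) (s : R) :
  measurable_fun setT V -> L1 Q (fun w => `|V w| `^ r) -> continuous g ->
  0 < s <= r -> (forall x : R, `|g x| <= `|x| `^ s) -> L1 Q (fun w => g (V w)).
Proof.
move=> mV LV cg /andP[s0 sr] gs.
apply: (@L1_le _ _ _ _ _ (fun w => 1 + `|V w| `^ r)).
- exact: (mf_cont cg mV).
- by move=> w; apply: (le_trans (gs _)); apply: powR_le1D => //; rewrite (ltW s0).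
- by apply: L1D => //; exact: L1_cst.
Qed.

(** The two sides differ only where [|V| > c]. There [c >= 1] allows the order [s] to be raised to
    [r], and [r >= 1] puts the r-th power of [|V|] above [K]. *)
Lemma Ex_clamp_close {d'} {T : measurableType d'} (Q : probability T R) (V : T -> R)
    (g : R -> R) (s c K : R) :
  measurable_fun setT V -> L1 Q (fun w => `|V w| `^ r) -> continuous g ->
  0 < s <= r -> (forall x : R, `|g x| <= `|x| `^ s) -> 1 <= c -> K <= c ->
  `|Ex Q (fun w => g (V w)) - Ex Q (fun w => g (clamp c (V w)))| <=
  2 * Ex Q (fun w => `|V w| `^ r * (K < `|V w| `^ r)%R%:R).
Proof.
move=> mV LV cg sr gs c1 Kc; have /andP[s0 sr'] := sr.
have r0 : 0 < r by have := r1; lra.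
have c0 : 0 <= c by lra.
have mcV : measurable_fun setT (fun w => clamp c (V w)).
  exact: (mf_cont (@continuous_clamp R c) mV).
have LcV : L1 Q (fun w => `|clamp c (V w)| `^ r).
  apply: (L1_dominated _ LV); first by meas.
  by move=> w; rewrite powR_ge0 powR_mono ?(ltW r0)// norm_clamp_le.
have Lg := L1_growth mV LV cg sr gs; have Lgc := L1_growth mcV LcV cg sr gs.
have LI : L1 Q (fun w => `|V w| `^ r * (K < `|V w| `^ r)%R%:R).
  apply: (L1_dominated _ LV); first by meas.
  by move=> w; case: (_ < _); rewrite ?mulr1 ?mulr0 powR_ge0 ?lexx.
rewrite -(ExB Lg Lgc) -(ExZ _ LI); apply: (le_trans (norm_Ex (L1B Lg Lgc))).
apply: le_Ex; [exact/L1_norm/L1B|exact: L1Z|move=> w].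
have [Vc|cV] := leP `|V w| c.
  rewrite clamp_id// subrr normr0 mulr_ge0// mulr_ge0// powR_ge0//.
have V1 : 1 <= `|V w| by lra.
have Vr : `|V w| <= `|V w| `^ r by rewrite le1r_powR.
rewrite (_ : K < _) ?mulr1; last by lra.
have h1 := gs (V w).
have h2 : `|V w| `^ s <= `|V w| `^ r by apply: ler_powR.
have h3 := gs (clamp c (V w)).
have h4 : `|clamp c (V w)| `^ s <= `|V w| `^ s.
  by rewrite powR_mono ?(ltW s0)// norm_clamp_le.
have := ler_normB (g (V w)) (g (clamp c (V w))); lra.
Qed.

(** [g] composed with [clamp c] is a bounded test function. Clamping costs [2 * (e / 8)] under [P],
    uniformly in [t], and as much under [nu]; weak convergence costs [e / 2]. *)
Theorem moment_convergence (g : R -> R) (s : R) : continuous g -> 0 < s <= r ->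
  (forall x : R, `|g x| <= `|x| `^ s) ->
  Ex P (fun w => g (X t w)) @[t --> +oo] --> Ex nu g.
Proof.
move=> cg sr gs; apply/cvgrPdist_le => e e0; have /andP[s0 sr'] := sr.
have e80 : 0 < e / 8 by rewrite divr_gt0.
have [K1 K10 HK1] := ui e80.
have mid := midR.
have mp : measurable_fun setT (fun x : measurableTypeR R => `|x| `^ r).
  by apply/mf_pow/mf_norm.
have [K2 K20 HK2] := Ex_tail mp L1_nu_pow (fun x => powR_ge0 _ _) e80.
pose c := Num.max 1 (Num.max K1 K2).
have c1 : 1 <= c by rewrite le_max lexx.
have cK1 : K1 <= c by rewrite !le_max lexx orbT.
have cK2 : K2 <= c by rewrite !le_max lexx !orbT.
have c0 : 0 <= c by lra.
have cgc : continuous (fun x : R => g (clamp c x)).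
  move=> x; apply: (@continuous_comp R R R (clamp c) g); [exact: continuous_clamp|exact: cg].
have bgc : exists M : R, forall x : R, `|g (clamp c x)| <= M.
  exists (c `^ s) => x; apply: (le_trans (gs _)); apply: powR_mono => //; first exact: ltW.
  exact: norm_clamp.
have := weak cgc bgc; move/cvgrPdist_le => /(_ (e / 2)).
move=> /(_ (divr_gt0 e0 (ltr0n _ 2))) W.
have hN := Ex_clamp_close midR L1_nu_pow cg sr gs c1 cK2.
have hN2 := HK2 _ (lexx K2).
near=> t.
have t1 : 1 <= t by near: t; exact: nbhs_pinfty_ge.
have h1 := Ex_clamp_close (mX t) (LX t1) cg sr gs c1 cK1.
have h2 := HK1 _ t1.
have h3 : `|Ex nu (fun x => g (clamp c x)) - Ex P (fun w => g (clamp c (X t w)))| <= e / 2.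
  by near: t.
have := ler_distD (Ex nu (fun x => g (clamp c x))) (Ex nu g) (Ex P (fun w => g (X t w))).
have := ler_distD (Ex P (fun w => g (clamp c (X t w)))) (Ex nu (fun x => g (clamp c x)))
  (Ex P (fun w => g (X t w))).
rewrite (distrC (Ex P (fun w => g (clamp c (X t w))))); move: hN hN2 h1 h2 h3; lra.
Unshelve. all: by end_near. Qed.

End moment_convergence.

(** * The Gaussian characteristic function *)

Section gaussian_characteristic.
Context {R : realType}.
Local Notation mu := (@lebesgue_measure R).
Local Notation mT := [set: measurableTypeR R].
Local Notation Lint f := (mu.-integrable setT (EFin \o f)).

Definition bell (k x : R) := expR (- (k * x ^+ 2)).

Lemma continuous_bell k : continuous (bell k).
Proof.
move=> x; apply: (@continuous_comp R R R (fun x => - (k * x ^+ 2)) expR).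
  by apply: cvgN; apply: cvgM; [exact: cvg_cst|exact: exprn_continuous].
exact: continuous_expR.
Qed.

Lemma is_derive_bell k (x : R) : is_derive x 1 (bell k) (- (2 * k * x) * bell k x).
Proof.
have dq : is_derive x (1 : R) (fun x => - (k * x ^+ 2)) (- (2 * k * x)).
  by apply: is_derive_eq; rewrite /GRing.scale/=; ring.
have := @is_derive1_comp R expR (fun x => - (k * x ^+ 2)) x _ _ (is_derive_expR _) dq.
by rewrite mulrC.
Qed.

Lemma measurable_bell k : measurable_fun setT (bell k).
Proof. by apply: continuous_measurable_fun; exact: continuous_bell. Qed.

Lemma bell_normal_pdf s x : 0 < s ->
  normal_pdf 0 s x = normal_peak s * bell (s ^+ 2 * 2)^-1 x.
Proof.
move=> s0; rewrite normal_pdfE ?gt_eqF// /normal_fun /bell subr0.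
by congr (_ * expR _); rewrite mulNr mulrC mulr_natr.
Qed.

Lemma integrable_bell (k : R) : 0 < k -> Lint (bell k).
Proof.
(* The standard deviation of the centered normal density proportional to [bell k]. *)
move=> k0; pose s := Num.sqrt (k * 2)^-1.
have k20 : 0 < (k * 2)^-1 by rewrite invr_gt0 mulr_gt0.
have s0 : 0 < s by rewrite sqrtr_gt0.
have sk : (s ^+ 2 * 2)^-1 = k.
  by rewrite sqr_sqrtr ?(ltW k20)// invfM invrK mulfK.
have p0 := normal_peak_gt0 (lt0r_neq0 s0).
have := integrableZl measurableT (normal_peak s)^-1 (integrable_normal_pdf 0 s).
apply: eq_integrable => // x _ /=; rewrite -EFinM; congr EFin.
by rewrite (bell_normal_pdf _ s0) sk mulKf// gt_eqF.
Qed.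

(** Half of the exponent, through [expR (- u) <= 1 / (1 + u)], absorbs [|x|]; the other half stays
    integrable. *)
Lemma integrable_norm_bell (k : R) : 0 < k -> Lint (fun x => `|x| * bell k x).
Proof.
move=> k0; have k20 : 0 < k / 2 by rewrite divr_gt0.
pose C := 1 + (k / 2)^-1.
have := integrableZl measurableT C (integrable_bell k20).
apply: le_integrable => //.
  apply/measurable_EFinP; apply: measurable_funM; first exact: mf_norm.
  exact: measurable_bell.
move=> x _ /=; rewrite lee_fin !normrM normr_id ger0_norm ?expR_ge0// ger0_norm; last first.
  by rewrite addr_ge0// invr_ge0 ltW.
rewrite ger0_norm ?expR_ge0//.
have -> : bell k x = bell (k / 2) x * bell (k / 2) x.
  by rewrite /bell -expRD; congr expR; field.
rewrite mulrA ler_wpM2r ?expR_ge0//.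
have u0 : 0 <= k / 2 * x ^+ 2 by rewrite mulr_ge0 ?sqr_ge0// ltW.
have := expRN_le_inv u0; rewrite -/(bell _ _) => B.
apply: le_trans (_ : `|x| / (1 + k / 2 * x ^+ 2) <= _); first by rewrite ler_wpM2l.
rewrite ler_pdivrMr; last by lra.
have : C * (1 + k / 2 * x ^+ 2) = 1 + k / 2 * x ^+ 2 + (k / 2)^-1 + x ^+ 2.
  by rewrite /C; field; rewrite gt_eqF.
have : 0 < (k / 2)^-1 by rewrite invr_gt0.
have := sqr_ge0 (`|x| - 1); rewrite sqrrB real_normK ?num_real// => q i ->.
by move: u0 q i; set z := k / 2 * x ^+ 2; set z' := (k / 2)^-1; nra.
Qed.

Section fixed_scale.
Variable k : R.
Hypothesis k0 : 0 < k.

Lemma measurable_cos_affine (th b : R) : measurable_fun setT (fun x : R => cos (th * x + b)).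
Proof. by apply: (mf_cont (@continuous_cos R)); apply: measurable_funD => //; exact: measurable_funM. Qed.

Lemma measurable_sin_affine (th b : R) : measurable_fun setT (fun x : R => sin (th * x + b)).
Proof. by apply: (mf_cont (@continuous_sin R)); apply: measurable_funD => //; exact: measurable_funM. Qed.

Lemma integrable_cos_bell (th b : R) : Lint (fun x => cos (th * x + b) * bell k x).
Proof.
apply: le_integrable (integrable_bell k0) => //.
  apply/measurable_EFinP; apply: measurable_funM; last exact: measurable_bell.
  exact: measurable_cos_affine.
move=> x _ /=; rewrite lee_fin normrM ler_piMl//.
by rewrite ler_norml cos_geN1 cos_le1.
Qed.

Lemma integrable_sin_bell (th b : R) : Lint (fun x => x * sin (th * x + b) * bell k x).
Proof.
apply: le_integrable (integrable_norm_bell k0) => //.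
  apply/measurable_EFinP; apply: measurable_funM; last exact: measurable_bell.
  by apply: measurable_funM => //; exact: measurable_sin_affine.
move=> x _ /=; rewrite lee_fin !normrM normr_id ler_wpM2r// ler_piMr//.
by rewrite ler_norml sin_geN1 sin_le1.
Qed.

(* The derivative of [sin (th * x + b) * bell k x] has integral 0. *)
Lemma bell_stein (th b : R) :
  2 * k * (\int[mu]_x (x * sin (th * x + b) * bell k x))%R =
  th * (\int[mu]_x (cos (th * x + b) * bell k x))%R.
Proof.
pose H x := sin (th * x + b) * bell k x.
pose h x := th * (cos (th * x + b) * bell k x) - 2 * k * (x * sin (th * x + b) * bell k x).
have dH (x : R) : is_derive x (1 : R) H (h x).
  have dq : is_derive x (1 : R) (fun x => th * x + b) th.
    by apply: is_derive_eq; rewrite /GRing.scale/=; ring.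
  have dc := @is_derive1_comp R sin (fun x => th * x + b) x _ _ (is_derive_sin _) dq.
  have dm : is_derive x (1 : R) H _ := is_deriveM dc (is_derive_bell k x).
  apply: (is_derive_eq dm).
  rewrite /GRing.scale/= /h; ring.
have ic := integrableZl measurableT th (integrable_cos_bell th b).
have is' := integrableZl measurableT (2 * k) (integrable_sin_bell th b).
have ih : Lint h by have := integrableB measurableT ic is'; apply: eq_integrable.
suff : (\int[mu]_x h x)%R = 0.
  rewrite RintegralB// RintegralZl ?integrable_cos_bell// RintegralZl ?integrable_sin_bell//.
  by move/subr0_eq.
have dHx (x : R) : derivable H x 1 by have [] := dH x.
have cH : continuous H.
  by move=> x; apply/differentiable_continuous/derivable1_diffP/dHx.
have ccos : continuous (fun x : R => cos (th * x + b)).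
  move=> x; apply: (@continuous_comp R R R (fun x => th * x + b) cos).
    by apply: cvgD; [apply: cvgMr|exact: cvg_cst].
  exact: continuous_cos.
have csin : continuous (fun x : R => sin (th * x + b)).
  move=> x; apply: (@continuous_comp R R R (fun x => th * x + b) sin).
    by apply: cvgD; [apply: cvgMr|exact: cvg_cst].
  exact: continuous_sin.
have ch : continuous h.
  move=> x; apply: cvgB; apply: cvgMr; apply: cvgM.
  - exact: ccos.
  - exact: continuous_bell.
  - by apply: cvgM; [exact: cvg_id|exact: csin].
  - exact: continuous_bell.
pose A (n : nat) : set R := `[- n.+1%:R, n.+1%:R]%classic.
have FTC (n : nat) : (\int[mu]_(x in A n) (h x)%:E)%E =
    (H n.+1%:R - H (- n.+1%:R))%:E.
  rewrite /A (@continuous_FTC2 _ h H) ?EFinB//.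
  - by rewrite -subr_gt0 opprK addr_gt0.
  - exact: continuous_subspaceT.
  - split => //.
      by apply: cvg_at_right_filter; exact: cH.
    by apply: cvg_at_left_filter; exact: cH.
  - by move=> x _; rewrite derive1E; have [_ ->] := dH x.
have Hn (x : R) : `|H x| <= bell k x.
  rewrite normrM (ger0_norm (expR_ge0 _)) ler_piMl ?expR_ge0//.
  by rewrite ler_norml sin_geN1 sin_le1.
have Bn (n : nat) : bell k n.+1%:R <= k^-1 / n.+1%:R.
  have n0 : 0 < n.+1%:R :> R by rewrite ltr0n.
  have n1 : 1 <= n.+1%:R :> R by rewrite ler1n.
  move: (n.+1%:R) n0 n1 => u u0 u1.
  apply: (le_trans (expRN_le_inv _)); first by rewrite mulr_ge0 ?sqr_ge0// ltW.
  rewrite -invfM lef_pV2 ?posrE ?mulr_gt0//; last by rewrite addr_gt0// mulr_gt0 ?exprn_gt0.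
  apply: (@le_trans _ _ (k * u ^+ 2)); last by rewrite lerDr.
  by rewrite ler_pM2l// expr2 ler_peMr// ltW.
have lim0 : (H n.+1%:R - H (- n.+1%:R))%:E @[n --> \oo] --> 0%E.
  apply: cvg_EFin; first exact: nearW.
  apply/cvgr0Pnorm_le => e e0; near=> n => /=.
  apply: (le_trans (ler_normB _ _)).
  have Hn' := Hn (- n.+1%:R); rewrite /bell sqrrN -/(bell _ _) in Hn'.
  suff Bne : k^-1 / n.+1%:R <= e / 2.
    by rewrite (splitr e) lerD// (le_trans _ (le_trans (Bn n) Bne)).
  rewrite ler_pdivrMr ?ltr0n// mulrC -ler_pdivrMr ?divr_gt0//.
  apply: le_trans (_ : n%:R <= _); last by rewrite ler_nat.
  by apply: ltW; near: n; exact: nbhs_infty_gtr.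
have lim1 : (\int[mu]_(x in A n) (h x)%:E @[n --> \oo] --> \int[mu]_x (h x)%:E)%E.
  under eq_fun do rewrite integral_mkcond.
  apply: (@dominated_cvg _ _ _ mu setT measurableT (fun n => (EFin \o h) \_ (A n))
    (EFin \o h) (abse \o (EFin \o h))) => //.
  - move=> n; apply/(measurable_restrictT _ _).1 => //.
      exact: measurable_itv.
    by apply: measurable_funTS; apply/measurable_EFinP; exact: continuous_measurable_fun.
  - move=> x _; apply: cvg_near_cst; near=> n; rewrite /patch mem_set//.
    rewrite /A/= in_itv/= -ler_norml; apply: le_trans (_ : n%:R <= _); last by rewrite ler_nat.
    by apply: ltW; near: n; exact: nbhs_infty_gtr.
  - exact: integrable_abse.
  - by move=> n x _; rewrite /patch; case: ifP => //= _; rewrite normr0 lee_fin.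
rewrite /Rintegral; have -> // : (\int[mu]_x (h x)%:E = 0)%E.
have lim0' : (\int[mu]_(x in A n) (h x)%:E @[n --> \oo] --> 0)%E.
  by under eq_fun do rewrite FTC.
exact: (cvg_unique _ lim1 lim0').
Unshelve. all: by end_near. Qed.

Lemma is_derive_cos_bell (b th : R) :
  is_derive th 1 (fun t => (\int[mu]_x (cos (t * x + b) * bell k x))%R)
    (- (\int[mu]_x (x * sin (th * x + b) * bell k x))%R).
Proof.
pose f (t x : R) := cos (t * x + b) * bell k x.
have df (t x : R) : is_derive t (1 : R) (f ^~ x) (- (x * sin (t * x + b) * bell k x)).
  have dq : is_derive t (1 : R) (fun t => t * x + b) x.
    by apply: is_derive_eq; rewrite /GRing.scale/=; ring.
  have dc := @is_derive1_comp R cos (fun t => t * x + b) t _ _ (is_derive_cos _) dq.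
  have dm : is_derive t (1 : R) (f ^~ x) _ := is_deriveM dc (is_derive_cst (bell k x) t 1).
  apply: (is_derive_eq dm).
  rewrite /GRing.scale/=; ring.
have dfE (t x : R) : partial1of2 f t x = - (x * sin (t * x + b) * bell k x).
  by rewrite /partial1of2 derive1E; have [_ ->] := df t x.
have thI : `]th - 1, th + 1[%classic th by rewrite /= in_itv/=; apply/andP; split; lra.
have intf (t : R) : `]th - 1, th + 1[%classic t -> Lint (f t).
  by move=> _; exact: integrable_cos_bell.
have derf (t x : R) : `]th - 1, th + 1[%classic t -> setT x -> derivable (f ^~ x) t 1.
  by move=> _ _; have [] := df t x.
have fub (t x : R) : `]th - 1, th + 1[%classic t -> setT x ->
    `|partial1of2 f t x| <= `|x| * bell k x.
  move=> _ _; rewrite dfE normrN !normrM (ger0_norm (expR_ge0 _)).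
  by rewrite ler_wpM2r ?expR_ge0// ler_piMr// ler_norml sin_geN1 sin_le1.
have g0 (x : R) : 0 <= `|x| * bell k x by rewrite mulr_ge0 ?expR_ge0.
split.
  exact: (derivable_under_integral measurableT thI intf derf g0 (integrable_norm_bell k0) fub).
have := differentiation_under_integral measurableT thI intf derf g0 (integrable_norm_bell k0) fub.
rewrite derive1E => ->; under eq_Rintegral do rewrite dfE.
rewrite -[in RHS]mulN1r -RintegralZl ?integrable_sin_bell//.
by apply: eq_Rintegral => x _; rewrite mulN1r.
Qed.

(** By [bell_stein] the integral [Phi] satisfies [Phi' = - t / (2 * k) * Phi], so its product with
    [expR (t ^+ 2 / (4 * k))] is constant. *)
Lemma integral_cos_bell (th b : R) :
  (\int[mu]_x (cos (th * x + b) * bell k x))%R =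
  cos b * expR (- (th ^+ 2 / (4 * k))) * (\int[mu]_x (bell k x))%R.
Proof.
pose Phi t := (\int[mu]_x (cos (t * x + b) * bell k x))%R.
pose G t := Phi t * expR (t ^+ 2 / (4 * k)).
have dG t : is_derive t (1 : R) G 0.
  have dP := is_derive_cos_bell b t; have st := bell_stein t b.
  apply: is_derive_eq; rewrite /GRing.scale/=.
  have -> : (\int[mu]_x (x * sin (t * x + b) * bell k x))%R = t * Phi t / (2 * k).
    by rewrite /Phi -st mulrC mulKf// mulf_neq0// gt_eqF.
  by field; rewrite gt_eqF.
have := is_derive_0_is_cst th 0 dG; rewrite /G expr0n mul0r expR0 mulr1.
have -> : Phi 0 = cos b * (\int[mu]_x (bell k x))%R.
  rewrite /Phi -RintegralZl//; last exact: integrable_bell.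
  by apply: eq_Rintegral => x _; rewrite mul0r add0r.
move=> E; rewrite expRN -mulrA (mulrC _^-1) mulrA -E mulfK//.
by rewrite gt_eqF// expR_gt0.
Qed.

End fixed_scale.

(** Change of variables with the Radon-Nikodym derivative, which equals [normal_pdf] almost
    everywhere because both have the same integral over every measurable set. *)
Lemma integral_normal_prob (s : R) (f : R -> R) : 0 < s ->
  L1 (normal_prob 0 s : probability (measurableTypeR R) R) f ->
  Ex (normal_prob 0 s : probability (measurableTypeR R) R) f =
  (\int[mu]_x (f x * normal_pdf 0 s x))%R.
Proof.
move=> s0 Lf; congr fine; have mf := L1_measurable Lf.
have dom := normal_prob_dominates 0 s.
rewrite -(Radon_Nikodym_change_of_variables dom)//=.
under [RHS]eq_integral do rewrite EFinM.
have mpdf : measurable_fun setT (EFin \o normal_pdf 0 s).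
  by apply/measurable_EFinP; exact: measurable_normal_pdf.
apply: ae_eq_integral => //.
- apply: emeasurable_funM; first exact/measurable_EFinP.
  by apply: (measurable_int mu); exact: Radon_Nikodym_integrable.
- by apply: emeasurable_funM => //; exact/measurable_EFinP.
- apply: ae_eqe_mul2l => /=.
  rewrite Radon_NikodymE//=; case: cid => /= h [h1 h2 h3].
  apply: integral_ae_eq => //=.
  by move=> E _ mE; rewrite -h3.
Qed.

Lemma Ex_cos_centered_normal (v th b : R) : 0 <= v ->
  Ex (centered_normal v) (fun x => cos (th * x + b)) =
  cos b * expR (- (th ^+ 2 * v / 2)).
Proof.
rewrite le_eqVlt => /predU1P[<-|v0]; rewrite /centered_normal.
  rewrite eqxx /Ex /Rintegral integral_dirac//; last first.
    by apply/measurable_EFinP; exact: measurable_cos_affine.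
  by rewrite diracT mul1e/= !mulr0 mul0r add0r oppr0 expR0 mulr1.
rewrite gt_eqF//; have s0 : 0 < Num.sqrt v by rewrite sqrtr_gt0.
have k0 : 0 < (Num.sqrt v ^+ 2 * 2)^-1 by rewrite invr_gt0 mulr_gt0 ?exprn_gt0.
rewrite integral_normal_prob//; last first.
  apply: (@L1_bounded _ _ _ _ _ 1); first exact: measurable_cos_affine.
  by move=> x; rewrite ler_norml cos_geN1 cos_le1.
have I1 : (\int[mu]_x (normal_pdf 0 (Num.sqrt v) x))%R = 1.
  by rewrite /Rintegral integral_normal_pdf.
have {}I1 : normal_peak (Num.sqrt v) *
    (\int[mu]_x (bell (Num.sqrt v ^+ 2 * 2)^-1 x))%R = 1.
  rewrite -[RHS]I1 -RintegralZl ?integrable_bell//.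
  by apply: eq_Rintegral => x _; rewrite bell_normal_pdf.
under eq_Rintegral do rewrite bell_normal_pdf// mulrCA.
rewrite RintegralZl ?integrable_cos_bell// integral_cos_bell//.
rewrite mulrCA I1 mulr1; congr (_ * expR (- _)).
rewrite sqr_sqrtr ?ltW//; field; rewrite gt_eqF//.
Qed.

End gaussian_characteristic.

(** * Regenerative processes in discrete form *)

Lemma powR_div_sqrt {R : realType} (a t p : R) : 0 <= a -> 0 < t ->
  (a / Num.sqrt t) `^ p = a `^ p / t `^ (p / 2).
Proof.
move=> a0 t0; rewrite powRM//.
have -> : (Num.sqrt t)^-1 = t `^ (- 2^-1) by rewrite powRN powR12_sqrt ?ltW.
by rewrite -powRrM -powRN; congr (_ * _ `^ _); field.
Qed.

(* Either [z <= 2 v], or [z <= 2 u] and on the tail [z ^ p <= z ^ (2 p) / c]. *)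
Lemma powR_split_tail {R : realType} (z u v c p : R) : 0 <= z -> 0 <= u -> 0 <= v -> 0 < c -> 0 <= p ->
  z <= u + v -> z `^ p * (c < z `^ p)%R%:R <= (2 * u) `^ (2 * p) / c + (2 * v) `^ p.
Proof.
move=> z0 u0 v0 c0 p0 zuv.
have A0 : 0 <= (2 * u) `^ (2 * p) / c by rewrite divr_ge0 ?powR_ge0// ltW.
have B0 : 0 <= (2 * v) `^ p by exact: powR_ge0.
case: (ltP c (z `^ p)) => cz; rewrite ?mulr1 ?mulr0 ?addr_ge0//.
have [uv|vu] := leP u v.
  rewrite -[leLHS]add0r lerD//; apply: powR_mono => //; lra.
rewrite -[leLHS]addr0 lerD// ler_pdivlMr//.
apply: (@le_trans _ _ (z `^ (2 * p))).
  rewrite (mulrC 2) powRrM powR_mulrn ?powR_ge0// expr2 ler_wpM2l ?powR_ge0//; exact: ltW.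
by apply: powR_mono; lra.
Qed.

Section regenerative_process.
Context {d dS : measure_display} {Omega : measurableType d}
  {St : measurableType dS} {R : realType}.
Variables (P : probability Omega R) (zeta : nat -> Omega -> St).
Hypothesis zeta_iid : iid P zeta.
(** Marks of one renewal interval: [x] is its length, [y] the centered increment over it, and [b]
    bounds the distance inside it from the process to the walk at its end. Paths enter this section
    only through [X_walk]. *)
Variables x y b : St -> R.
Hypotheses (mx : measurable_fun setT x) (my : measurable_fun setT y)
  (mb : measurable_fun setT b).
Hypothesis x_gt0 : forall i w, 0 < x (zeta i w).
Variable r : R.
Hypothesis r2 : 2 <= r.
Hypothesis Lx2 : L1 P (fun w => x (zeta 0%N w) ^+ 2).
Hypothesis Lyr : L1 P (fun w => `|y (zeta 0%N w)| `^ r).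
Hypothesis b0 : forall s, 0 <= b s.
Hypothesis Lbr : L1 P (fun w => b (zeta 0%N w) `^ r).
Hypothesis Ey0 : Ex P (fun w => y (zeta 0%N w)) = 0.
Variable X : R -> Omega -> R.
Hypothesis mX : forall t, measurable_fun setT (X t).
(* [null] stands for the indicator of an exceptional null event. *)
Variable null : Omega -> R.
Hypotheses (Lnull : L1 P null) (null0 : forall w, 0 <= null w) (Enull : Ex P null = 0).
Hypothesis X_walk : forall (t : R) k w, 1 <= t ->
  walk zeta x k w <= t < walk zeta x k.+1 w -> null w < 1 ->
  `|X t w * Num.sqrt t - walk zeta y k.+1 w| <= b (zeta k w).

Local Notation gap := (laplace_gap P zeta x).
Local Notation running := (running zeta x).
Local Notation stopped := (stopped zeta x).
Local Notation walk := (walk zeta).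

(** The last of [m.+1] nonincreasing terms is at most their average, and their sum is bounded by
    [sum_running]. *)
Lemma Ex_running_le (t : R) m : 1 <= t ->
  Ex P (running t m) <= expR 1 * (t / gap) / m.+1%:R.
Proof.
move=> t1; rewrite ler_pdivlMr ?ltr0n//.
apply: le_trans (sum_running zeta_iid mx x_gt0 t1 m.+1).
rewrite mulr_natr -[in leLHS](card_ord m.+1) -sumr_const; apply: ler_sum => i _.
apply: le_Ex; [exact: L1_running|exact: L1_running|].
by move=> w; apply: running_nonincreasing => //; rewrite -ltnS.
Qed.

(* [running t m] vanishes outside an event of probability O(1 / m), so that a bound valid
   where it vanishes survives the limit [m -> oo]. *)
Lemma Ex_le_of_running (F : Omega -> R) (t B : R) m0 : 1 <= t ->
  measurable_fun setT F -> (forall w, 0 <= F w) ->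
  (forall m, (m0 <= m)%N -> exists W : Omega -> R,
    [/\ L1 P W, Ex P W <= B, (forall w, 0 <= W w) &
        forall w, running t m w = 0 -> null w < 1 -> F w <= W w]) ->
  L1 P F /\ Ex P F <= B.
Proof.
move=> t1 mF F0 H.
have LF (n : nat) : L1 P (fun w => F w * (F w <= n%:R)%R%:R).
  apply: (@L1_bounded _ _ _ _ _ n%:R); first by meas.
  move=> w; case: (leP (F w) n%:R) => Fn; rewrite ?mulr1 ?mulr0 ?normr0//.
  by rewrite ger0_norm.
apply: (Ex_le_of_truncations mF mF F0 LF) => n; apply/ler_addgt0Pr => e e0.
pose C := expR 1 * (t / gap).
have [m [mm0 mC]] : exists m, (m0 <= m)%N /\ n%:R * (C / m.+1%:R) <= e.
  pose m := (m0 + Num.truncn (e^-1 * (n%:R * C)))%N.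
  exists m; split; first exact: leq_addr.
  rewrite mulrA ler_pdivrMr ?ltr0n// mulrC -ler_pdivrMl// mulrC.
  apply: ltW; apply: (lt_le_trans (truncnS_gt _)); rewrite ler_nat.
  by rewrite ltnS leq_addl.
have [W [LW EW W0 FW]] := H m mm0.
have Lr := L1_running zeta_iid mx t m.
have LB := L1D LW (L1Z n%:R (L1D Lr Lnull)).
apply: (@le_trans _ _ (Ex P (fun w => W w + n%:R * (running t m w + null w)))).
  apply: le_Ex => // w.
  case: (leP (F w) n%:R) => Fn; rewrite ?mulr1 ?mulr0; last first.
    by apply: addr_ge0 => //; apply: mulr_ge0 => //; apply: addr_ge0 => //;
      have /andP[] := running_bound zeta x t m w.
  have [r0|r1] := running_01 zeta x t m w.
    have [n1|n1] := ltP (null w) 1.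
      by rewrite (le_trans (FW w r0 n1))// lerDl r0 add0r mulr_ge0.
    by rewrite r0 add0r -[F w]add0r lerD// (le_trans Fn)// ler_peMr.
  by rewrite r1 -[F w]add0r lerD// (le_trans Fn)// ler_peMr// lerDl.
rewrite (ExD LW (L1Z n%:R (L1D Lr Lnull))) (ExZ _ (L1D Lr Lnull)) (ExD Lr Lnull) Enull addr0.
apply: lerD => //; apply: le_trans mC; apply: ler_wpM2l => //.
exact: Ex_running_le.
Qed.

Lemma X_stopped (t : R) m w : 1 <= t -> running t m w = 0 -> null w < 1 ->
  exists k, [/\ (k < m)%N, running t k w = 1 &
    `|X t w * Num.sqrt t - stopped t y m w| <= b (zeta k w)].
Proof.
move=> t1 r0 n1; have t0 : 0 <= t by exact: le_trans t1.
have [/eqP|[k km [kt Sk]]] := stopped_cases x_gt0 m w t0.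
  by rewrite r0 eq_sym oner_eq0.
exists k; split => //; last by rewrite Sk; exact: X_walk.
by rewrite /running; have /andP[-> _] := kt.
Qed.

Let r0 : 0 < r. Proof. by have := r2; lra. Qed.
Let r1 : 1 <= r. Proof. by have := r2; lra. Qed.

Let y0 w := y (zeta 0%N w).
Let my0 : measurable_fun setT y0. Proof. exact: (measurable_step zeta_iid). Qed.

(* [y] is split into a bounded centered part and a part with small [r]-th moment. *)
Definition small (K : R) s := y s * (`|y s| <= K)%R%:R.
Definition small_mean (K : R) := Ex P (fun w => small K (zeta 0%N w)).
Definition bounded_part (K : R) s := small K s - small_mean K.
Definition tail_part (K : R) s := y s - bounded_part K s.

Lemma measurable_small (K : R) : measurable_fun setT (small K).
Proof. by have my' := my; rewrite /small; meas. Qed.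

Lemma measurable_bounded_part (K : R) : measurable_fun setT (bounded_part K).
Proof. by have ms := measurable_small K; rewrite /bounded_part; meas. Qed.

Lemma measurable_tail_part (K : R) : measurable_fun setT (tail_part K).
Proof. by have my' := my; have mp := measurable_bounded_part K; rewrite /tail_part; meas. Qed.

Lemma norm_small (K : R) s : 0 <= K -> `|small K s| <= K.
Proof.
move=> K0; rewrite /small normrM; case: (leP `|y s| K) => yK.
  by rewrite normr1 mulr1.
by rewrite normr0 mulr0.
Qed.

Lemma L1_small (K : R) : 0 <= K -> L1 P (fun w => small K (zeta 0%N w)).
Proof.
move=> K0; apply: (@L1_bounded _ _ _ _ _ K); last by move=> w; exact: norm_small.
exact: (measurable_step zeta_iid 0 (measurable_small K)).
Qed.

Lemma Ex_bounded_part (K : R) : 0 <= K -> Ex P (fun w => bounded_part K (zeta 0%N w)) = 0.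
Proof.
by move=> K0; rewrite /bounded_part (ExB (L1_small K0) (L1_cst _ _)) Ex_cst subrr.
Qed.

Lemma norm_bounded_part (K : R) s : 0 <= K -> `|bounded_part K s| <= 2 * K.
Proof.
move=> K0; rewrite mulr2n mulrDl mul1r; apply: (le_trans (ler_normB _ _)); apply: lerD.
  exact: norm_small.
apply: (le_trans (norm_Ex (L1_small K0))); rewrite -[leRHS](Ex_cst P).
apply: le_Ex; [exact/L1_norm/L1_small|exact: L1_cst|by move=> w; exact: norm_small].
Qed.

Let Ly0 : L1 P y0. Proof. exact: L1_of_pow my0 r1 Lyr. Qed.

Lemma L1_bounded_part (K : R) : 0 <= K -> L1 P (fun w => bounded_part K (zeta 0%N w)).
Proof. by move=> K0; exact: L1B (L1_small K0) (L1_cst _ _). Qed.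

Lemma Ex_tail_part (K : R) : 0 <= K -> Ex P (fun w => tail_part K (zeta 0%N w)) = 0.
Proof.
by move=> K0; rewrite /tail_part (ExB Ly0 (L1_bounded_part K0)) Ex_bounded_part// subr0.
Qed.

Let tail_moment (K : R) := Ex P (fun w => `|y0 w| `^ r * (K < `|y0 w|)%R%:R).

Let L1_tail (K : R) : L1 P (fun w => `|y0 w| `^ r * (K < `|y0 w|)%R%:R).
Proof.
have my' := my0; apply: (L1_dominated _ Lyr); first by meas.
by move=> w; case: (K < _); rewrite ?mulr1 ?mulr0 powR_ge0 ?lexx.
Qed.

(** As [y] is centered, the mean of the kept part is minus that of the removed part, where
    [|y| > K >= 1] is at most its r-th power. *)
Lemma small_mean_le (K : R) : 1 <= K -> `|small_mean K| <= tail_moment K.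
Proof.
move=> K1; have K0 : 0 <= K by exact: le_trans K1.
have Ls := L1_small K0.
have -> : small_mean K = - Ex P (fun w => y0 w - small K (zeta 0%N w)).
  by rewrite (ExB Ly0 Ls) Ey0 sub0r opprK.
rewrite normrN; apply: (le_trans (norm_Ex (L1B Ly0 Ls))).
apply: le_Ex => //; first exact/L1_norm/L1B.
move=> w; rewrite /small -/(y0 w) ltNge; case: (leP `|y0 w| K) => yK /=.
  by rewrite mulr1 subrr normr0 mulr0.
by rewrite mulr0 subr0 mulr1 le1r_powR// (le_trans K1)// ltW.
Qed.

(** The tail part is [y] on [|y| > K] plus the constant [small_mean K]. The r-th power of that
    constant is at most the tail moment, since the latter does not exceed 1. *)
Lemma Ex_tail_part_pow (K : R) : 1 <= K -> tail_moment K <= 1 ->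
  L1 P (fun w => `|tail_part K (zeta 0%N w)| `^ r) /\
  Ex P (fun w => `|tail_part K (zeta 0%N w)| `^ r) <= 2 `^ r * (2 * tail_moment K).
Proof.
move=> K1 T1; have K0 : 0 <= K by exact: le_trans K1.
have mt := measurable_step zeta_iid 0 (measurable_tail_part K).
have T0 : 0 <= tail_moment K.
  by apply: Ex_ge0 => w; rewrite mulr_ge0// powR_ge0.
have mr : `|small_mean K| `^ r <= tail_moment K.
  apply: (le_trans (powR_mono (ltW r0) _ (small_mean_le K1))) => //.
  have [T00|Tn0] := eqVneq (tail_moment K) 0; first by rewrite T00 powR0 ?gt_eqF.
  by rewrite ge1r_powR// lt_neqAle eq_sym Tn0 T0.
have LW := L1D (L1_tail K) (L1_cst P (`|small_mean K| `^ r)).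
have le w : `|tail_part K (zeta 0%N w)| `^ r <= 2 `^ r *
    (`|y0 w| `^ r * (K < `|y0 w|)%R%:R + `|small_mean K| `^ r).
  have -> : tail_part K (zeta 0%N w) = y0 w * (K < `|y0 w|)%R%:R + small_mean K.
    rewrite /tail_part /bounded_part /small -/(y0 w) ltNge.
    by case: (_ <= K) => /=; rewrite ?mulr1 ?mulr0; ring.
  apply: (le_trans (powR_normD_le _ _ (ltW r0))).
  rewrite ler_wpM2l ?powR_ge0// lerD2r normrM.
  by case: (K < _); rewrite ?normr1 ?normr0 ?mulr1 ?mulr0// powR0 ?gt_eqF.
have Lt : L1 P (fun w => `|tail_part K (zeta 0%N w)| `^ r).
  apply: (L1_dominated _ (L1Z (2 `^ r) LW)); first by meas.
  by move=> w; rewrite powR_ge0 le.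
split => //; apply: (@le_trans _ _ (Ex P (fun w => 2 `^ r *
    (`|y0 w| `^ r * (K < `|y0 w|)%R%:R + `|small_mean K| `^ r)))).
  by apply: le_Ex => //; exact: L1Z.
rewrite (ExZ _ LW) (ExD (L1_tail K) (L1_cst _ _)) Ex_cst ler_wpM2l ?powR_ge0//.
by rewrite mulr2n mulrDl mul1r lerD.
Qed.

Lemma stopped_parts (t : R) K m w : stopped t y m w =
  stopped t (bounded_part K) m w + stopped t (tail_part K) m w.
Proof.
rewrite -big_split/=; apply: eq_bigr => i _.
by rewrite -mulrDr /tail_part addrC subrK.
Qed.

(** The bound [b] is split like [y]: [b] is at most [K] plus an excess with small r-th moment. *)
Definition excess (K : R) s := b s * (K < b s)%R%:R.

Lemma measurable_excess (K : R) : measurable_fun setT (excess K).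
Proof. by have mb' := mb; rewrite /excess; meas. Qed.

Lemma excess_ge0 (K : R) s : 0 <= excess K s.
Proof. by rewrite mulr_ge0// b0. Qed.

Lemma le_excess (K : R) s : 0 <= K -> b s <= K + excess K s.
Proof.
move=> K0; rewrite /excess; have b00 := b0 s.
by case: (ltP K (b s)) => bK; rewrite ?mulr1 ?mulr0 ?addr0// lerDr.
Qed.

Lemma excess_powE (K : R) s (p : R) : 0 < p -> excess K s `^ p = b s `^ p * (K < b s)%R%:R.
Proof.
move=> p0; rewrite /excess; case: (K < b s); rewrite ?mulr1 ?mulr0//.
by rewrite powR0// gt_eqF.
Qed.

Let C1 := stopped_cst P zeta x (2 * r).
Let C2 := stopped_cst P zeta x r.
Let C3 := expR 1 / gap.
(** In [D1] and [D2] one power of 2 comes from [powR_split_tail], the other from [powR_normD_le]. *)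
Let D1 : R := 2 `^ (2 * r) * 2 `^ (2 * r).
Let D2 : R := 2 `^ r * 2 `^ r.

Let mb0 : measurable_fun setT (fun w => b (zeta 0%N w)).
Proof. exact: (measurable_step zeta_iid). Qed.

Let mexc (K : R) : measurable_fun setT (fun s => excess K s `^ r).
Proof. by have me := measurable_excess K; meas. Qed.

Let L1_exc (K : R) : L1 P (fun w => excess K (zeta 0%N w) `^ r).
Proof.
under eq_fun do rewrite (excess_powE _ _ r0).
have mb' := mb0; apply: (L1_dominated _ Lbr); first by meas.
by move=> w; case: (_ < _); rewrite ?mulr1 ?mulr0 powR_ge0 ?lexx.
Qed.

Lemma Ex_stopped_bounded_part (K t : R) m : 1 <= K -> 1 <= t ->
  L1 P (fun w => `|stopped t (bounded_part K) m w| `^ (2 * r)) /\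
  Ex P (fun w => `|stopped t (bounded_part K) m w| `^ (2 * r))
    <= C1 * (2 * K) `^ (2 * r) * t `^ r.
Proof.
move=> K1 t1; have p0 : 0 < 2 * r by rewrite mulr_gt0// r0.
have K0 : 0 <= K by exact: le_trans K1.
have A10 : 0 < (2 * K) `^ (2 * r) by rewrite powR_gt0//; lra.
have lebp w : `|bounded_part K (zeta 0%N w)| `^ (2 * r) <= (2 * K) `^ (2 * r).
  by apply: powR_mono; rewrite ?(ltW p0)//; exact: norm_bounded_part.
have mbp := measurable_bounded_part K; have mbp0 := measurable_step zeta_iid 0 mbp.
have Lbp : L1 P (fun w => `|bounded_part K (zeta 0%N w)| `^ (2 * r)).
  apply: (@L1_bounded _ _ _ _ _ ((2 * K) `^ (2 * r))); first by meas.
  by move=> w; rewrite ger0_norm ?powR_ge0.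
have Ebp : Ex P (fun w => `|bounded_part K (zeta 0%N w)| `^ (2 * r)) <= (2 * K) `^ (2 * r).
  by rewrite -[leRHS](Ex_cst P); apply: le_Ex => //; exact: L1_cst.
split; first exact: L1_stopped_pow.
have -> : t `^ r = t `^ (2 * r / 2) by congr (_ `^ _); field.
apply: (stopped_moment zeta_iid mx x_gt0 Lx2 m t1 _ A10 mbp _ Lbp Ebp).
  by have := r2; lra.
exact: Ex_bounded_part.
Qed.

Lemma Ex_stopped_tail_part (K eta t : R) m : 1 <= K -> 1 <= t -> 0 < eta <= 1 ->
  tail_moment K <= eta ->
  L1 P (fun w => `|stopped t (tail_part K) m w| `^ r) /\
  Ex P (fun w => `|stopped t (tail_part K) m w| `^ r)
    <= C2 * (2 `^ r * (2 * eta)) * t `^ (r / 2).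
Proof.
move=> K1 t1 /andP[eta0 eta1] tailK; have K0 : 0 <= K by exact: le_trans K1.
have [Lt Et] := Ex_tail_part_pow K1 (le_trans tailK eta1).
have mtp := measurable_tail_part K.
split; first exact: L1_stopped_pow.
apply: (stopped_moment zeta_iid mx x_gt0 Lx2 m t1 r2 _ mtp _ Lt).
- by rewrite !mulr_gt0// powR_gt0.
- exact: Ex_tail_part.
- by apply: (le_trans Et); rewrite ler_wpM2l ?powR_ge0// ler_wpM2l.
Qed.

(** Wald's identity gives order [t], at most the power [r / 2] of [t] because [t >= 1] and
    [r >= 2]. *)
Lemma Ex_stopped_excess (K eta t : R) m : 1 <= t ->
  Ex P (fun w => excess K (zeta 0%N w) `^ r) <= eta ->
  L1 P (stopped t (fun s => excess K s `^ r) m) /\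
  Ex P (stopped t (fun s => excess K s `^ r) m) <= C3 * eta * t `^ (r / 2).
Proof.
move=> t1 Eex; have me := mexc K; have L := L1_exc K.
have g0 := laplace_gap_gt0 zeta_iid mx x_gt0.
split; first by have [] := Ex_stopped zeta_iid mx t m me L.
apply: (le_trans (Ex_stopped_le zeta_iid mx x_gt0 m t1 me L (fun s => powR_ge0 _ _))).
have E0 : 0 <= Ex P (fun w => excess K (zeta 0%N w) `^ r).
  by apply: Ex_ge0 => w; exact: powR_ge0.
have C30 : 0 <= expR 1 / gap by rewrite divr_ge0 ?expR_ge0// ltW.
apply: ler_pM; [exact: mulr_ge0|exact: le_trans t1|exact: ler_wpM2l|].
by rewrite le1r_powR//; have := r2; lra.
Qed.

(** [powR_split_tail] with everything bounded, the walk of [bounded_part] and [K], as [u], and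
    everything small, the walk of [tail_part] and the excess, as [v]. *)
Lemma X_pow_tail (K c t : R) m w : 0 <= K -> 0 < c -> 1 <= t ->
  running t m w = 0 -> null w < 1 ->
  `|X t w| `^ r * (c < `|X t w| `^ r)%R%:R <=
  D1 / c * (`|stopped t (bounded_part K) m w| `^ (2 * r) / t `^ r + K `^ (2 * r))
  + D2 * ((`|stopped t (tail_part K) m w| `^ r
           + stopped t (fun s => excess K s `^ r) m w) / t `^ (r / 2)).
Proof.
move=> K0 c0 t1 rm nw; have t0 : 0 < t by exact: lt_le_trans t1.
have s0 : 0 < Num.sqrt t by rewrite sqrtr_gt0.
have s1 : 1 <= Num.sqrt t by rewrite -(@sqrtr1 R) ler_wsqrtr.
have [k [km rk Xk]] := X_stopped t1 rm nw.
have bk := le_excess (zeta k w) K0.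
have exk : excess K (zeta k w) `^ r <= stopped t (fun s => excess K s `^ r) m w.
  by apply: (le_stopped (v := fun s => excess K s `^ r) _ km rk) => s; exact: powR_ge0.
move: (stopped t (fun s => _) m w) exk => E3 exk.
have e0 := excess_ge0 K (zeta k w); move: (excess K (zeta k w)) e0 exk bk => ek e0 exk bk.
rewrite (stopped_parts t K) in Xk.
move: (stopped t (bounded_part K) m w) (stopped t (tail_part K) m w) Xk => B1 B2 Xk.
have rr := r0.
have v0 : 0 <= (`|B2| + ek) / Num.sqrt t by rewrite divr_ge0// addr_ge0.
have u0 : 0 <= `|B1| / Num.sqrt t + K by rewrite addr_ge0// divr_ge0.
have zuv : `|X t w| <= (`|B1| / Num.sqrt t + K) + (`|B2| + ek) / Num.sqrt t.
  have : `|X t w| * Num.sqrt t <= `|B1| + `|B2| + (K + ek).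
    rewrite -[X in _ * X]ger0_norm ?(ltW s0)// -normrM.
    have := ler_normD (X t w * Num.sqrt t - (B1 + B2)) (B1 + B2); rewrite subrK.
    move=> /le_trans; apply; rewrite addrC.
    by apply: lerD; [exact: ler_normD|exact: le_trans Xk bk].
  rewrite -ler_pdivlMr// => /le_trans; apply.
  have -> : (`|B1| + `|B2| + (K + ek)) / Num.sqrt t =
      `|B1| / Num.sqrt t + K / Num.sqrt t + (`|B2| + ek) / Num.sqrt t.
    by field; rewrite gt_eqF.
  by rewrite lerD2r lerD2l ler_pdivrMr// ler_peMr.
apply: (le_trans (powR_split_tail (normr_ge0 _) u0 v0 c0 (ltW rr) zuv)).
have p0 : 0 <= 2 * r by rewrite mulr_ge0// ltW.
apply: lerD.
  rewrite mulrAC ler_pM2r ?invr_gt0// powRM// /D1 -mulrA ler_wpM2l ?powR_ge0//.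
  have := powR_normD_le (`|B1| / Num.sqrt t) K p0.
  rewrite (ger0_norm u0) (ger0_norm K0) (ger0_norm (divr_ge0 (normr_ge0 B1) (ltW s0))).
  by rewrite powR_div_sqrt// (_ : 2 * r / 2 = r)//; field.
rewrite powRM// /D2 -mulrA ler_wpM2l ?powR_ge0// powR_div_sqrt//; last by rewrite addr_ge0.
rewrite mulrA ler_wpM2r ?invr_ge0 ?powR_ge0//.
have := powR_normD_le `|B2| ek (ltW rr).
rewrite normr_id (ger0_norm e0) ger0_norm ?addr_ge0// => /le_trans; apply.
by rewrite ler_wpM2l ?powR_ge0// lerD2l.
Qed.

Lemma Ex_X_pow_tail (K eta c t : R) : 1 <= K -> 0 < eta <= 1 -> 0 < c -> 1 <= t ->
  tail_moment K <= eta -> Ex P (fun w => excess K (zeta 0%N w) `^ r) <= eta ->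
  L1 P (fun w => `|X t w| `^ r * (c < `|X t w| `^ r)%R%:R) /\
  Ex P (fun w => `|X t w| `^ r * (c < `|X t w| `^ r)%R%:R) <=
  D1 * (C1 * (2 * K) `^ (2 * r) + K `^ (2 * r)) / c + D2 * (C2 * (2 `^ r * 2) + C3) * eta.
Proof.
move=> K1 eta01 c0 t1 tailK excK; have mXt := mX t; have K0 : 0 <= K by lra.
have t0 : 0 < t by lra.
apply: (@Ex_le_of_running _ t _ 0 t1); first by meas.
  by move=> w; rewrite mulr_ge0// powR_ge0.
move=> m _.
have [L1' E1] := Ex_stopped_bounded_part m K1 t1.
have [L2 E2] := Ex_stopped_tail_part m K1 t1 eta01 tailK.
have [L3 E3] := Ex_stopped_excess m t1 excK.
have tr0 : 0 < t `^ r by exact: powR_gt0.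
have th0 : 0 < t `^ (r / 2) by exact: powR_gt0.
have D1c : 0 <= D1 / c by rewrite divr_ge0 ?mulr_ge0 ?powR_ge0// ltW.
have D20 : 0 <= D2 by rewrite mulr_ge0 ?powR_ge0.
exists (fun w => (D1 / c) * ((t `^ r)^-1 * `|stopped t (bounded_part K) m w| `^ (2 * r)
    + K `^ (2 * r))
  + (D2 * (t `^ (r / 2))^-1) * (`|stopped t (tail_part K) m w| `^ r
    + stopped t (fun s => excess K s `^ r) m w)).
have La := L1D (L1Z (t `^ r)^-1 L1') (L1_cst P (K `^ (2 * r))).
have Lb := L1D L2 L3.
split.
- exact: L1D (L1Z _ La) (L1Z _ Lb).
- rewrite (ExD (L1Z _ La) (L1Z _ Lb)) (ExZ _ La) (ExZ _ Lb).
  rewrite (ExD (L1Z _ L1') (L1_cst _ _)) (ExZ _ L1') (ExD L2 L3) Ex_cst.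
  apply: lerD.
    by rewrite [leRHS]mulrAC ler_wpM2l// lerD2r [leLHS]mulrC ler_pdivrMr.
  rewrite -2!mulrA ler_wpM2l// [leLHS]mulrC ler_pdivrMr//.
  apply: (le_trans (lerD E2 E3)); rewrite -mulrDl ler_pM2r//.
  by rewrite le_eqVlt; apply/orP; left; apply/eqP; ring.
- move=> w; apply: addr_ge0; apply: mulr_ge0 => //.
  + by rewrite addr_ge0 ?powR_ge0// mulr_ge0 ?powR_ge0// invr_ge0 ltW.
  + by rewrite mulr_ge0// invr_ge0 ltW.
  + rewrite addr_ge0 ?powR_ge0//; apply: sumr_ge0 => i _.
    by rewrite mulr_ge0 ?powR_ge0//; have /andP[] := running_bound zeta x t i w.
- move=> w rm nw; apply: (le_trans (X_pow_tail K0 c0 t1 rm nw)).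
  by rewrite [_ / t `^ r]mulrC [_ / t `^ (r / 2)]mulrC mulrA.
Qed.

(** The order of choices matters: [eta] first, as its coefficient is free of [K]; then [K] from the
    moments of one interval; last [c], which beats the term growing with [K]. *)
Theorem uniform_tail (e : R) : 0 < e -> exists2 c : R, 0 < c & forall t : R, 1 <= t ->
  L1 P (fun w => `|X t w| `^ r * (c < `|X t w| `^ r)%R%:R) /\
  Ex P (fun w => `|X t w| `^ r * (c < `|X t w| `^ r)%R%:R) <= e.
Proof.
move=> e0; have [eta [eta01 Qeta]] : exists eta : R, 0 < eta <= 1 /\
    D2 * (C2 * (2 `^ r * 2) + C3) * eta <= e / 2.
  move: (D2 * (C2 * (2 `^ r * 2) + C3)) => Q.
  have Q1 : 0 < `|Q| + 1 by rewrite ltr_wpDl.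
  exists (Num.min 1 (e / 2 / (`|Q| + 1))).
  have m0 : 0 < Num.min 1 (e / 2 / (`|Q| + 1)) by rewrite lt_min ltr01/= !divr_gt0.
  split; first by rewrite m0 ge_min lexx.
  apply: (@le_trans _ _ ((`|Q| + 1) * Num.min 1 (e / 2 / (`|Q| + 1)))).
    by rewrite ler_pM2r// (le_trans (ler_norm Q))// lerDl.
  by rewrite mulrC -ler_pdivlMr// ge_min lexx orbT.
have eta0 : 0 < eta by lra.
have [K1 K10 HK1] := Ex_tail (mf_norm my0) Lyr (fun w => powR_ge0 _ _) eta0.
have [K2 K20 HK2] := Ex_tail mb0 Lbr (fun w => powR_ge0 _ _) eta0.
have [K [K1' KK1 KK2]] : exists K : R, [/\ 1 <= K, K1 <= K & K2 <= K].
  by exists (1 + K1 + K2); split; lra.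
have excK : Ex P (fun w => excess K (zeta 0%N w) `^ r) <= eta.
  by under eq_fun do rewrite (excess_powE _ _ r0); apply: ltW; exact: HK2.
have [c [c0 Mc]] : exists c : R, 0 < c /\
    D1 * (C1 * (2 * K) `^ (2 * r) + K `^ (2 * r)) / c <= e / 2.
  move: (D1 * (C1 * (2 * K) `^ (2 * r) + K `^ (2 * r))) => M.
  have e20 : 0 < e / 2 by rewrite divr_gt0.
  have c0 : 0 < `|M| / (e / 2) + 1 by rewrite ltr_wpDl// divr_ge0// ltW.
  exists (`|M| / (e / 2) + 1); split => //.
  rewrite ler_pdivrMr// mulrC -ler_pdivrMr//.
  by rewrite (le_trans (ler_wpM2r _ (ler_norm M))) ?lerDl// invr_ge0 ltW.
exists c => // t t1.
have [L E] := Ex_X_pow_tail K1' eta01 c0 t1 (ltW (HK1 K KK1)) excK.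
by split => //; apply: (le_trans E); rewrite (splitr e) lerD.
Qed.

Theorem L1_X_pow (t : R) : 1 <= t -> L1 P (fun w => `|X t w| `^ r).
Proof.
move=> t1; have [c c0 /(_ t t1)[L _]] := uniform_tail (@ltr01 R).
have mXt := mX t; apply: (L1_dominated _ (L1D (L1_cst P c) L)); first by meas.
move=> w; rewrite powR_ge0/=; case: ltP => cX; rewrite ?mulr1 ?mulr0 ?addr0//.
by rewrite lerDr ltW.
Qed.

Theorem X_tight (e : R) : 0 < e -> exists2 L : R, 0 < L &
  \forall t \near +oo, Ex P (fun w => (L < `|X t w|)%R%:R) <= e.
Proof.
(* Above [1 + c] the r-th power of [|X|] exceeds both 1 and [c], so the indicator is at most the
   tail integrand. *)
move=> e0; have [c c0 Hc] := uniform_tail e0; exists (1 + c); first by lra.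
near=> t; have t1 : 1 <= t by near: t; exact: nbhs_pinfty_ge.
have [L E] := Hc t t1; apply: le_trans E; have mXt := mX t.
apply: le_Ex => //.
  apply: (@L1_bounded _ _ _ _ _ 1); first by meas.
  by move=> w; rewrite ger0_norm ?ler0n// lern1 leq_b1.
move=> w; case: (ltP (1 + c)) => cX; last by rewrite mulr_ge0// powR_ge0.
have X1 : 1 <= `|X t w| by rewrite (le_trans _ (ltW cX))// lerDl ltW.
have XX := le1r_powR X1 r1.
rewrite (_ : c < _) ?mulr1 ?(le_trans X1)//.
by apply: lt_le_trans XX; apply: lt_trans cX; rewrite ltrDr.
Unshelve. all: by end_near. Qed.

Let mu := Ex P (fun w => x (zeta 0%N w)).
Let s2 := Ex P (fun w => y (zeta 0%N w) ^+ 2).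

Let mu0 : 0 < mu. Proof. exact: (mean_gt0 zeta_iid mx x_gt0 Lx2). Qed.

Let Ly2 : L1 P (fun w => y (zeta 0%N w) ^+ 2).
Proof. exact: L1_sqr my0 r2 Lyr. Qed.

Let Lb2 : L1 P (fun w => b (zeta 0%N w) ^+ 2).
Proof.
apply: (L1_sqr mb0 r2); have := Lbr.
by under [X in _ -> L1 P X]eq_fun do rewrite (ger0_norm (b0 _)).
Qed.

Lemma cos_lipschitz (u v : R) : `|cos u - cos v| <= `|u - v|.
Proof.
pose p := (u + v) / 2; pose q := (u - v) / 2.
have -> : u = p + q by rewrite /p /q; field.
have -> : v = p - q by rewrite /p /q; field.
rewrite cosD cosB (_ : _ - _ = - (2 * (sin p * sin q))); last by ring.
rewrite normrN !normrM (ger0_norm (ler0n R 2)) (_ : p + q - (p - q) = 2 * q); last by ring.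
rewrite [leRHS]normrM (ger0_norm (ler0n R 2)) ler_wpM2l// -[leRHS]mul1r.
by apply: ler_pM; rewrite ?norm_sin_le// ler_norml sin_geN1 sin_le1.
Qed.

(** Cosine is 1-Lipschitz, and [X] differs from the rescaled walk at [n] by the walk between [n] and
    the stopping index plus a mark of the straddling interval. The three terms are of order -1/4 and
    -1/2 in [t], and of the size of the root of [eta]. *)
Lemma Ex_cos_X_sub_walk (th bb K eta t : R) n : 0 <= K -> 1 <= t ->
  n%:R <= t / mu < n.+1%:R -> Ex P (fun w => excess K (zeta 0%N w) ^+ 2) <= eta ->
  `|Ex P (fun w => cos (th * X t w + bb))
    - Ex P (fun w => cos (th * (walk y n w / Num.sqrt t) + bb))| <=
  `|th| / Num.sqrt t * (Num.sqrt ((overshoot_cst P zeta x / mu * Num.sqrt t + 1) * s2)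
    + (K + Num.sqrt (C3 * eta * t))).
Proof.
move=> K0 t1 nt excK; have t0 : 0 < t by lra.
have s0 : 0 < Num.sqrt t by rewrite sqrtr_gt0.
have mXt := mX t; have mw := measurable_walk zeta_iid n my.
have L1c : L1 P (fun w => cos (th * X t w + bb)).
  by apply: (@L1_bounded _ _ _ _ _ 1) => [|w]; [meas|rewrite ler_norml cos_geN1 cos_le1].
have L2c : L1 P (fun w => cos (th * (walk y n w / Num.sqrt t) + bb)).
  by apply: (@L1_bounded _ _ _ _ _ 1) => [|w]; [meas|rewrite ler_norml cos_geN1 cos_le1].
rewrite -(ExB L1c L2c); apply: (le_trans (norm_Ex (L1B L1c L2c))).
have mexc2 : measurable_fun setT (fun s => excess K s ^+ 2).
  by have me := measurable_excess K; meas.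
have Lexc2 : L1 P (fun w => excess K (zeta 0%N w) ^+ 2).
  have mb' := mb0; apply: (L1_dominated _ Lb2).
    by rewrite /excess; meas.
  move=> w; rewrite sqr_ge0/= /excess.
  by case: (_ < _); rewrite ?mulr1 ?mulr0 ?expr0n/= ?sqr_ge0.
(* Starting at [n.+1] ensures [t <= mu * m]. *)
apply: (proj2 (@Ex_le_of_running _ t _ n.+1 t1 _ _ _)); first by meas.
  by move=> w; exact: normr_ge0.
move=> m nm.
have tm : t <= mu * m%:R.
  rewrite mulrC -ler_pdivrMr//; have /andP[_ /ltW tn] := nt.
  by apply: (le_trans tn); rewrite ler_nat.
have [Ld Ed] := Ex_stopped_sub_walk zeta_iid mx x_gt0 Lx2 t1 tm nt (ltnW nm) my Ey0 Ly2.
have ms := measurable_stopped zeta_iid mx t m my.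
have md : measurable_fun setT (fun w => stopped t y m w - walk y n w) by meas.
have Ed' := le_trans (Ex_norm_le_sqrt md Ld) (ler_wsqrtr Ed).
have L1d := L1_norm (L1_of_sqr md Ld).
have [Le _] := Ex_stopped zeta_iid mx t m mexc2 Lexc2.
have stop0 w : 0 <= stopped t (fun s => excess K s ^+ 2) m w.
  apply: sumr_ge0 => i _.
  by rewrite mulr_ge0 ?sqr_ge0//; have /andP[] := running_bound zeta x t i w.
have Ee := Ex_stopped_le zeta_iid mx x_gt0 m t1 mexc2 Lexc2 (fun s => sqr_ge0 _).
have [Lse Ese] := Ex_sqrt_le Le stop0.
have C30 : 0 <= C3 by rewrite divr_ge0 ?expR_ge0// ltW// (laplace_gap_gt0 zeta_iid mx).
have Ese' : Ex P (fun w => Num.sqrt (stopped t (fun s => excess K s ^+ 2) m w)) <=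
    Num.sqrt (C3 * eta * t).
  apply: (le_trans Ese); apply: ler_wsqrtr; apply: (le_trans Ee).
  by rewrite ler_wpM2r ?(ltW t0)// ler_wpM2l.
exists (fun w => (`|th| / Num.sqrt t) * (`|stopped t y m w - walk y n w|
    + (K + Num.sqrt (stopped t (fun s => excess K s ^+ 2) m w)))).
have LK := L1D (L1_cst P K) Lse.
have ths : 0 <= `|th| / Num.sqrt t by rewrite divr_ge0// ltW.
split.
- exact: L1Z (L1D L1d LK).
- rewrite (ExZ _ (L1D L1d LK)) (ExD L1d LK) (ExD (L1_cst _ _) Lse) Ex_cst.
  by rewrite ler_wpM2l// lerD// lerD2l.
- by move=> w; rewrite mulr_ge0// addr_ge0// addr_ge0// sqrtr_ge0.
- move=> w rm nw; apply: (le_trans (cos_lipschitz _ _)).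
  have [k [km rk Xk]] := X_stopped t1 rm nw.
  have bk := le_excess (zeta k w) K0.
  have exk : excess K (zeta k w) <= Num.sqrt (stopped t (fun s => excess K s ^+ 2) m w).
    rewrite -(ger0_norm (excess_ge0 K (zeta k w))) -sqrtr_sqr ler_wsqrtr//.
    by apply: (le_stopped (v := fun s => excess K s ^+ 2) _ km rk) => s; exact: sqr_ge0.
  have -> : th * X t w + bb - (th * (walk y n w / Num.sqrt t) + bb) =
      th / Num.sqrt t * (X t w * Num.sqrt t - walk y n w).
    by field; rewrite gt_eqF.
  rewrite normrM normf_div (ger0_norm (ltW s0)) ler_wpM2l//.
  rewrite -(subrK (stopped t y m w) (X t w * Num.sqrt t)) -addrA addrC.
  apply: (le_trans (ler_normD _ _)); apply: lerD => //.
  by apply: (le_trans Xk); apply: (le_trans bk); rewrite lerD2l.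
Qed.

Lemma cos_X_sub_walk (th bb e : R) : 0 < e -> exists2 t0 : R, 1 <= t0 &
  forall (t : R) n, t0 <= t -> n%:R <= t / mu < n.+1%:R ->
  `|Ex P (fun w => cos (th * X t w + bb))
    - Ex P (fun w => cos (th * (walk y n w / Num.sqrt t) + bb))| <= e.
Proof.
move=> e0; have g0 := laplace_gap_gt0 zeta_iid mx x_gt0.
have C30 : 0 <= C3 by rewrite divr_ge0 ?expR_ge0// ltW.
have e30 : 0 < e / 3 by rewrite divr_gt0.
(* The term with [eta] does not decay in [t], so it is made at most [e / 3] before [K] and [t] are
   chosen. *)
have [eta eta0 Heta] : exists2 eta : R, 0 < eta & th ^+ 2 * (C3 * eta) <= (e / 3) ^+ 2.
  have q0 : 0 < th ^+ 2 * C3 + 1 by rewrite ltr_wpDl// mulr_ge0// sqr_ge0.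
  exists ((e / 3) ^+ 2 / (th ^+ 2 * C3 + 1)); first by rewrite divr_gt0// exprn_gt0.
  by rewrite mulrA mulrCA ler_piMr ?sqr_ge0// ler_pdivrMr// mul1r lerDl.
have [K0' K00 HK] := Ex_tail mb0 Lb2 (fun w => sqr_ge0 _) eta0.
have excK : Ex P (fun w => excess K0' (zeta 0%N w) ^+ 2) <= eta.
  apply: le_trans (ltW (HK K0' (lexx _))); rewrite le_eqVlt; apply/orP; left; apply/eqP.
  congr (Ex P); apply/funext => w; rewrite /excess exprMn; congr (_ * _).
  by case: (_ < _); rewrite ?expr1n ?expr0n.
pose oc : R := `|overshoot_cst P zeta x / mu|.
have s20 : 0 <= s2 by apply: Ex_ge0 => w; exact: sqr_ge0.
(* [B1] and [B2] are the values of [Num.sqrt t] beyond which the two decaying terms are at most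
   [e / 3]. *)
pose B1 : R := th ^+ 2 * ((oc + 1) * s2) / (e / 3) ^+ 2.
pose B2 : R := `|th| * K0' / (e / 3).
have oc0 : 0 <= oc + 1 by rewrite addr_ge0 ?normr_ge0.
have B10 : 0 <= B1.
  by rewrite /B1; nonneg.
have B20 : 0 <= B2 by rewrite /B2; nonneg.
have t01 : 1 <= (1 + B1 + B2) ^+ 2 by rewrite -[leLHS](expr1n R 2) lerXn2r ?nnegrE; lra.
exists ((1 + B1 + B2) ^+ 2) => // t n t0t nt.
have t1 : 1 <= t by exact: le_trans t0t.
have ss : 1 + B1 + B2 <= Num.sqrt t.
  by rewrite -[leLHS]ger0_norm -?sqrtr_sqr ?ler_wsqrtr//; lra.
have tE : t = Num.sqrt t ^+ 2 by rewrite sqr_sqrtr//; lra.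
apply: (le_trans (Ex_cos_X_sub_walk th bb (ltW K00) t1 nt excK)).
move: ss tE; move: (Num.sqrt t : R) => s ss tE; rewrite tE.
have s0 : 0 < s by lra.
have ths : 0 <= `|th| / s by rewrite divr_ge0// ltW.
have sqr_le (z : R) : (`|th| / s) ^+ 2 * z <= (e / 3) ^+ 2 -> `|th| / s * Num.sqrt z <= e / 3.
  move=> zle; rewrite -(ger0_norm ths) -sqrtr_sqr -sqrtrM ?sqr_ge0//.
  by rewrite -[leRHS](ger0_norm (ltW e30)) -[leRHS]sqrtr_sqr ler_wsqrtr.
have thE : (`|th| / s) ^+ 2 = th ^+ 2 / s ^+ 2.
  by rewrite exprMn exprVn real_normK ?num_real.
have b1 : `|th| / s * Num.sqrt ((overshoot_cst P zeta x / mu * s + 1) * s2) <= e / 3.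
  apply: sqr_le; rewrite thE.
  apply: (@le_trans _ _ (th ^+ 2 * ((oc + 1) * s2) / s)).
    apply: (@le_trans _ _ (th ^+ 2 / s ^+ 2 * ((oc + 1) * s * s2))).
      apply: ler_wpM2l; first by nonneg.
      apply: ler_wpM2r => //; rewrite [leRHS]mulrDl mul1r; apply: lerD; last by lra.
      by apply: ler_wpM2r; [exact: ltW|exact: ler_norm].
    by rewrite le_eqVlt; apply/orP; left; apply/eqP; field; rewrite gt_eqF.
  by rewrite ler_pdivrMr// [leRHS]mulrC -ler_pdivrMr ?exprn_gt0// -/B1; lra.
have b2 : `|th| / s * K0' <= e / 3.
  by rewrite mulrAC ler_pdivrMr// [leRHS]mulrC -ler_pdivrMr// -/B2; lra.
have b3 : `|th| / s * Num.sqrt (C3 * eta * s ^+ 2) <= e / 3.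
  apply: sqr_le; rewrite thE; apply: le_trans Heta.
  by rewrite le_eqVlt; apply/orP; left; apply/eqP; field; rewrite gt_eqF.
rewrite mulrDr mulrDr; lra.
Qed.

Local Notation nu := (centered_normal (s2 / mu)).

Lemma weak_test_cos (th bb : R) : weak_test P X nu (fun x => cos (th * x + bb)).
Proof.
have v0 : 0 <= s2 / mu by rewrite divr_ge0 ?(ltW mu0)// Ex_ge0// => w; exact: sqr_ge0.
split.
- move=> u; apply: (@continuous_comp R R R (fun x => th * x + bb) cos).
    by apply: cvgD; [apply: cvgMr|exact: cvg_cst].
  exact: continuous_cos.
- by exists 1 => u; rewrite ler_norml cos_geN1 cos_le1.
rewrite Ex_cos_centered_normal//; apply/cvgrPdist_le => e e0.
have e20 : 0 < e / 2 by rewrite divr_gt0.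
have [t1 t11 H1] := cos_X_sub_walk th bb e20.
have [t2 t21 H2] := walk_clt_cos zeta_iid my Ey0 Ly2 th bb mu0 e20.
near=> t; have tt1 : t1 <= t by near: t; apply: nbhs_pinfty_ge; rewrite num_real.
have tt2 : t2 <= t by near: t; apply: nbhs_pinfty_ge; rewrite num_real.
have tmu : 0 <= t / mu by rewrite divr_ge0 ?(ltW mu0)//; lra.
have nt := truncn_itv tmu.
have h1 := H1 t _ tt1 nt; have h2 := H2 t _ tt2 nt.
rewrite distrC; apply: (le_trans (ler_distD _ _ _)); rewrite (splitr e).
by apply: lerD; [exact: h1|exact: h2].
Unshelve. all: by end_near. Qed.

Theorem weak_convergence (f : R -> R) : continuous f ->
  (exists M : R, forall u : R, `|f u| <= M) ->
  Ex P (fun w => f (X t w)) @[t --> +oo] --> Ex nu f.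
Proof.
move=> cf bf; have [_ _ h] := weak_test_bounded_continuous mX weak_test_cos X_tight cf bf.
exact: h.
Qed.

Theorem growth_convergence (g : R -> R) (s : R) : continuous g -> 0 < s <= r ->
  (forall u : R, `|g u| <= `|u| `^ s) ->
  [/\ forall t : R, 1 <= t -> L1 P (fun w => g (X t w)), L1 nu g &
      Ex P (fun w => g (X t w)) @[t --> +oo] --> Ex nu g].
Proof.
move=> cg sr gs.
have ui (e : R) : 0 < e -> exists2 K : R, 0 < K & forall t : R, 1 <= t ->
    Ex P (fun w => `|X t w| `^ r * (K < `|X t w| `^ r)%R%:R) <= e.
  by move=> e0; have [c c0 H] := uniform_tail e0; exists c => // t /H[].
split.
- by move=> t t1; exact: L1_growth (mX t) (L1_X_pow t1) cg sr gs.
- have := L1_nu_pow mX weak_convergence r1 L1_X_pow ui => Lnu.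
  exact: (L1_growth (@measurable_id _ (measurableTypeR R) setT) Lnu cg sr gs).
- exact: (moment_convergence mX weak_convergence r1 L1_X_pow ui cg sr gs).
Qed.

End regenerative_process.

(** * Path functionals *)

Section path_functionals.
Context {R : realType}.
Implicit Types s : R * path_space R.

Lemma measurable_evaluation (t : R) : 0 <= t ->
  measurable_fun setT (fun f : path_space R => (f : R -> R) t).
Proof.
move=> t0 _ B mB; rewrite setTI; apply: sub_sigma_algebra.
by exists t; split => //; exists B.
Qed.

Lemma measurable_path (t : R) : 0 <= t ->
  measurable_fun setT (fun s => (s.2 : R -> R) t).
Proof.
by move=> t0; apply: (measurableT_comp (measurable_evaluation t0)); exact: measurable_snd.
Qed.

(* Increments are stopped paths, hence eventually constant. *)
Definition endpoint s : R := fine (limn_esup (fun n => ((s.2 : R -> R) n%:R)%:E)).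

Lemma measurable_endpoint : measurable_fun setT endpoint.
Proof.
apply: measurableT_comp; first exact: fine_measurable.
apply: (@measurable_fun_limn_esup _ _ _ _ (fun n s => ((s.2 : R -> R) n%:R)%:E)) => n.
by apply/measurable_EFinP; exact: measurable_path.
Qed.

Lemma endpointE s (l : R) : (forall t, s.1 <= t -> (s.2 : R -> R) t = l) -> endpoint s = l.
Proof.
move=> H; rewrite /endpoint; suff cv : ((s.2 : R -> R) n%:R)%:E @[n --> \oo] --> l%:E.
  by have [_ ->] := cvg_limn_einf_sup cv.
apply: cvg_near_cst; near=> n; rewrite H//.
by apply: ltW; near: n; exact: nbhs_infty_gtr.
Unshelve. all: by end_near. Qed.

(** An enumeration with repetitions of the nonnegative rationals; numbers that code no rational give
    0. *)
Definition rational_time (n : nat) : R := `|ratr (odflt 0%R (choice.unpickle n : option rat))|.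

Lemma rational_time_ge0 n : 0 <= rational_time n.
Proof. exact: normr_ge0. Qed.

Lemma rational_time_between (u v : R) : 0 <= u < v -> exists n, u < rational_time n < v.
Proof.
move=> /andP[u0 uv]; have [q /[!in_itv]/= /andP[uq qv]] := rat_in_itvoo uv.
exists (choice.pickle q); rewrite /rational_time choice.pickleK/= ger0_norm ?uq//.
exact/ltW/(le_lt_trans u0).
Qed.

(* A countable supremum is measurable, and by right-continuity it bounds the whole path. *)
Definition path_sup s : \bar R := esups (fun n => (`|(s.2 : R -> R) (rational_time n)|)%:E) 0.

Lemma measurable_path_sup : measurable_fun setT path_sup.
Proof.
apply: (@measurable_fun_esups _ _ _ _ (fun n s => (`|(s.2 : R -> R) (rational_time n)|)%:E)) => n.
apply/measurable_EFinP; apply: mf_norm; apply: measurable_path; exact: rational_time_ge0.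
Qed.

Lemma le_path_sup s n : ((`|(s.2 : R -> R) (rational_time n)|)%:E <= path_sup s)%E.
Proof. by apply: ereal_sup_ubound; exists n. Qed.

Lemma path_sup_ge0 s : (0 <= path_sup s)%E.
Proof. by apply: le_trans (le_path_sup s 0). Qed.

Lemma path_sup_le s (M : \bar R) :
  (forall t : R, 0 <= t -> ((`|(s.2 : R -> R) t|)%:E <= M)%E) -> (path_sup s <= M)%E.
Proof.
move=> H; apply: ge_ereal_sup => _ [n _ <-]; apply: H; exact: rational_time_ge0.
Qed.

Lemma right_continuous_le_path_sup s (t : R) : 0 <= t -> 
  (s.2 : R -> R) u @[u --> t^'+] --> (s.2 : R -> R) t ->
  ((`|(s.2 : R -> R) t|)%:E <= path_sup s)%E.
Proof.
move=> t0 rc; case E : (path_sup s) => [M| |]; last 2 first.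
- exact: leey.
- by have := path_sup_ge0 s; rewrite E.
rewrite lee_fin; apply/ler_addgt0Pr => e e0.
move/cvgrPdist_le : rc => /(_ _ e0)[d /= d0 Hd].
have [|n /andP[tn nd]] := @rational_time_between t (t + d).
  by rewrite t0 ltrDl.
have h : `|(s.2 : R -> R) t - (s.2 : R -> R) (rational_time n)| <= e.
  by apply: Hd => //=; rewrite ltr_norml; apply/andP; split; lra.
have hM : `|(s.2 : R -> R) (rational_time n)| <= M.
  by rewrite -lee_fin -E le_path_sup.
rewrite -(subrK ((s.2 : R -> R) (rational_time n)) ((s.2 : R -> R) t)) addrC.
by apply: (le_trans (ler_normD _ _)); exact: lerD.
Qed.

End path_functionals.

Section regenerative_increments.
Context {d : measure_display} {Omega : measurableType d} {R : realType}.
Variables (xi : nat -> Omega -> R) (Z : R -> Omega -> R).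
Hypothesis xi_gt0 : forall n w, 0 < xi n w.
Hypothesis Z0 : forall w, Z 0 w = 0.
Hypothesis cZ : forall w, cadlag (fun t => Z t w).

Local Notation zeta := (increment xi Z).
Local Notation renewal := (renewal_time xi).

Lemma renewal_time_ge0 n w : 0 <= renewal n w.
Proof. by apply: sumr_ge0 => i _; exact: ltW. Qed.

Lemma renewal_timeS n w : renewal n.+1 w = xi n w + renewal n w.
Proof. by rewrite /renewal_time big_ord_recr addrC. Qed.

Lemma renewal_time1 w : renewal 1 w = xi 0 w.
Proof. by rewrite /renewal_time big_ord1. Qed.

Lemma endpoint_increment n w :
  endpoint (zeta n w) = Z (renewal n.+1 w) w - Z (renewal n w) w.
Proof.
by apply: endpointE => t xt /=; rewrite renewal_timeS min_r.
Qed.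

Lemma endpoint_increment0 w : endpoint (zeta 0 w) = Z (renewal 1 w) w.
Proof. by rewrite endpoint_increment {2}/renewal_time big_ord0 Z0 subr0. Qed.

Lemma walk_endpoint n w : walk zeta endpoint n w = Z (renewal n w) w.
Proof.
elim: n => [|n IH]; first by rewrite walk0 /renewal_time big_ord0 Z0.
by rewrite walkS IH endpoint_increment addrC subrK.
Qed.

(** Before [xi n w] the stopped path is right-continuous because [Z] is. At [xi n w] it is frozen,
    and any later rational time reads the same value. *)
Lemma path_sup_increment n w (u : R) : 0 <= u <= xi n w ->
  ((`|Z (u + renewal n w) w - Z (renewal n w) w|)%:E <= path_sup (zeta n w))%E.
Proof.
move=> /andP[u0]; have T0 := renewal_time_ge0 n w; rewrite le_eqVlt => /predU1P[->|ux].
  have [|k /andP[xk _]] := @rational_time_between R (xi n w) (xi n w + 1).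
    by rewrite (ltW (xi_gt0 n w)) ltrDl ltr01.
  by have := le_path_sup (zeta n w) k; rewrite /= min_r ?(ltW xk).
have -> : Z (u + renewal n w) w - Z (renewal n w) w = ((zeta n w).2 : R -> R) u.
  by rewrite /= min_l// ltW.
apply: right_continuous_le_path_sup => //=; rewrite (min_l (ltW ux)).
apply: cvgB; last exact: cvg_cst.
have [/(_ (u + renewal n w))rc _] := cZ w.
have {rc} := rc (addr_ge0 u0 T0).
move/cvgrPdist_le => H; apply/cvgrPdist_le => e e0; have [dd /= dd0 Hd] := H _ e0.
exists (Num.min dd (xi n w - u)) => [|v /=]; first by rewrite /= lt_min dd0 subr_gt0.
rewrite lt_min => /andP[uv uv'] ltuv.
rewrite min_l; last by move: uv'; rewrite ltr_norml => /andP[]; lra.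
apply: Hd => /=; last by rewrite ltrD2r.
by rewrite opprD addrACA subrr addr0.
Qed.

Lemma path_sup_increment0 w : path_sup (zeta 0 w) = sup_norm_upto Z (renewal 1) w.
Proof.
have T0 : renewal 0 w = 0 by rewrite /renewal_time big_ord0.
have x0 := xi_gt0 0 w.
apply/eqP; rewrite eq_le; apply/andP; split.
  apply: path_sup_le => t t0 /=; rewrite T0 Z0 subr0 addr0.
  apply: ereal_sup_ubound; exists (Num.min t (xi 0 w)) => //=.
  by rewrite in_itv/= renewal_time1 ge_min lexx orbT le_min t0 ltW.
apply: ge_ereal_sup => _ [t /= + <-]; rewrite in_itv/= renewal_time1 => tx.
by have := path_sup_increment tx; rewrite T0 Z0 subr0 addr0.
Qed.

Variable a : R.

Definition centered_endpoint (s : R * path_space R) := endpoint s - a * s.1.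
(** Two suprema, since both [Z t] and the value at the end of the interval are measured from its
    start. [fine] sends an infinite supremum to 0, so the bound is meaningful only where the
    supremum is finite. *)
Definition path_bound (s : R * path_space R) := 2 * fine (path_sup s) + `|a| * `|s.1|.

Lemma measurable_centered_endpoint : measurable_fun setT centered_endpoint.
Proof.
apply: measurable_funB; first exact: measurable_endpoint.
by apply: measurable_funM => //; exact: measurable_fst.
Qed.

Lemma measurable_path_bound : measurable_fun setT path_bound.
Proof.
apply: measurable_funD; apply: measurable_funM => //.
  apply: measurableT_comp; first exact: fine_measurable.
  exact: measurable_path_sup.
by apply: mf_norm; exact: measurable_fst.
Qed.

Lemma path_bound_ge0 s : 0 <= path_bound s.
Proof. by rewrite addr_ge0// mulr_ge0// fine_ge0// path_sup_ge0. Qed.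

Lemma walk_centered_endpoint n w :
  walk zeta centered_endpoint n w = Z (renewal n w) w - a * renewal n w.
Proof.
rewrite -walk_endpoint /renewal_time mulr_sumr /walk -sumrB.
by apply: eq_bigr.
Qed.

Lemma centered_process_walk (t : R) k w : walk zeta fst k w <= t < walk zeta fst k.+1 w ->
  (path_sup (zeta k w) < +oo)%E ->
  `|Z t w - a * t - walk zeta centered_endpoint k.+1 w| <= path_bound (zeta k w).
Proof.
rewrite -[walk _ _ k w]/(renewal k w) -[walk _ _ k.+1 w]/(renewal k.+1 w).
move=> /andP[kt tk] fin; have x0 := xi_gt0 k w.
have Mf : path_sup (zeta k w) \is a fin_num by rewrite ge0_fin_numE// path_sup_ge0.
have M (u : R) : 0 <= u <= xi k w ->
    `|Z (u + renewal k w) w - Z (renewal k w) w| <= fine (path_sup (zeta k w)).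
  by move=> /path_sup_increment; rewrite -lee_fin fineK.
rewrite renewal_timeS in tk.
have h1 := M (t - renewal k w); rewrite subrK in h1.
have h2 := M (xi k w); rewrite -renewal_timeS in h2.
rewrite walk_centered_endpoint.
have -> : Z t w - a * t - (Z (renewal k.+1 w) w - a * renewal k.+1 w) =
   (Z t w - Z (renewal k w) w) - (Z (renewal k.+1 w) w - Z (renewal k w) w)
   + a * (renewal k.+1 w - t) by ring.
apply: (le_trans (ler_normD _ _)); apply: lerD.
  apply: (le_trans (ler_normB _ _)); rewrite mulr2n mulrDl mul1r; apply: lerD.
    by apply: h1; lra.
  by apply: h2; lra.
rewrite normrM ler_wpM2l//= ger0_norm; last by rewrite renewal_timeS; lra.
by rewrite renewal_timeS ger0_norm; lra.
Qed.

End regenerative_increments.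

(** * Return from real expectations to extended-real expectations and uniform integrability *)

Section conclusions.
Context {d : measure_display} {Omega : measurableType d} {R : realType}.
Variable P : probability Omega R.

Lemma expectation_Ex (f : Omega -> R) : L1 P f -> 'E_P[f]%E = (Ex P f)%:E.
Proof. by move=> Lf; rewrite unlock Ex_EFin. Qed.

Lemma cvg_expectation (X : R -> Omega -> R) (nu : probability (measurableTypeR R) R)
    (g : R -> R) : (forall t : R, 1 <= t -> L1 P (fun w => g (X t w))) -> L1 nu g ->
  Ex P (fun w => g (X t w)) @[t --> +oo] --> Ex nu g ->
  'E_P[fun w => g (X t w)]%E @[t --> +oo] --> 'E_nu[g]%E.
Proof.
move=> Lg Lnu cv.
have -> : 'E_nu[g]%E = (Ex nu g)%:E by rewrite unlock Ex_EFin.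
have cvE : (Ex P (fun w => g (X t w)))%:E @[t --> +oo] --> (Ex nu g)%:E.
  by apply: cvg_EFin => //; exact: nearW.
apply: cvg_trans cvE; apply: near_eq_cvg; near=> t.
by rewrite expectation_Ex//; apply: Lg; near: t; exact: nbhs_pinfty_ge.
Unshelve. all: by end_near. Qed.

(** Tails decrease in the level, so a bound at one [c0] persists beyond it; the supremum is
    nonnegative because [t = 1] belongs to the index set. *)
Lemma uniformly_integrable_tails (F : R -> Omega -> R) : (forall t w, 0 <= F t w) ->
  (forall e : R, 0 < e -> exists2 c : R, 0 < c & forall t : R, 1 <= t ->
    L1 P (fun w => F t w * (c < F t w)%R%:R) /\ Ex P (fun w => F t w * (c < F t w)%R%:R) <= e) ->
  (forall t : R, 1 <= t -> L1 P (F t)) ->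
  uniformly_integrable P [set t : R | 1 <= t] F.
Proof.
move=> F0 tails LF; rewrite /uniformly_integrable.
have intE (c t : R) : 1 <= t ->
    (\int[P]_(w in [set w | (c < `|F t w|)%R]) (`|F t w|)%:E =
     (Ex P (fun w => F t w * (c < F t w)%R%:R))%:E)%E.
  move=> t1; have mF := L1_measurable (LF t t1).
  have L : L1 P (fun w => F t w * (c < F t w)%R%:R).
    apply: (L1_dominated _ (LF t t1)); first by meas.
    by move=> w; case: (c < _); rewrite ?mulr1 ?mulr0 F0 ?lexx.
  rewrite -(Ex_EFin L) integral_mkcond; apply: eq_integral => w _.
  rewrite /patch; case: (ltP c (F t w)) => cF.
    by rewrite mem_set /= ger0_norm// mulr1.
  by rewrite memNset/= ?mulr0//= ger0_norm// ltNge cF.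
have bnd (e : R) : 0 < e -> exists2 c0 : R, 0 < c0 & forall c, c0 <= c ->
    (0 <= ereal_sup [set \int[P]_(w in [set w | (c < `|F t w|)%R]) (`|F t w|)%:E
      | t in [set t : R | (1 <= t)%R]] <= e%:E)%E.
  move=> e0; have [c0 c00 Hc] := tails e e0; exists c0 => // c c0c; apply/andP; split.
    apply: le_trans (ereal_sup_ubound _); last by exists 1 => /=.
    by apply: integral_ge0 => w _; rewrite lee_fin.
  apply: ge_ereal_sup => _ [t /= t1 <-]; rewrite (intE _ _ t1) lee_fin.
  have [L E] := Hc t t1; apply: le_trans E; have mF := L1_measurable (LF t t1).
  apply: le_Ex => //.
    apply: (L1_dominated _ (LF t t1)); first by meas.
    by move=> w; case: (c < _); rewrite ?mulr1 ?mulr0 F0 ?lexx.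
  move=> w; apply: ler_wpM2l => //; rewrite ler_nat.
  by case: (ltP c (F t w)) => // cF; rewrite (le_lt_trans c0c).
apply/fine_cvgP; split.
  have [c0 c00 Hc] := bnd 1 ltr01; near=> c.
  have /andP[S0 S1] : (0 <= ereal_sup [set \int[P]_(w in [set w | (c < `|F t w|)%R])
    (`|F t w|)%:E | t in [set t : R | (1 <= t)%R]] <= 1%:E)%E.
    by apply: Hc; near: c; apply: nbhs_pinfty_ge; rewrite num_real.
  by rewrite ge0_fin_numE//; exact: le_lt_trans S1 (ltry _).
apply/cvgrPdist_le => e e0; have [c0 c00 Hc] := bnd e e0; near=> c.
have /andP[S0 S1] : (0 <= ereal_sup [set \int[P]_(w in [set w | (c < `|F t w|)%R])
    (`|F t w|)%:E | t in [set t : R | (1 <= t)%R]] <= e%:E)%E.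
  by apply: Hc; near: c; apply: nbhs_pinfty_ge; rewrite num_real.
rewrite sub0r normrN ger0_norm ?fine_ge0// -lee_fin fineK//.
by rewrite ge0_fin_numE//; exact: le_lt_trans S1 (ltry _).
Unshelve. all: by end_near. Qed.

End conclusions.

Section moments_of_bounds.
Context {d : measure_display} {Omega : measurableType d} {R : realType}.
Variable P : probability Omega R.

Lemma L1_pow_dominated (f : Omega -> R) (M : Omega -> \bar R) (p : R) : 0 < p ->
  measurable_fun setT f -> measurable_fun setT M ->
  (forall w, ((`|f w|)%:E <= M w)%E) -> (\int[P]_w (M w `^ p) < +oo)%E ->
  L1 P (fun w => `|f w| `^ p).
Proof.
move=> p0 mf mM fM Mp.
have mfp : measurable_fun setT (fun w => `|f w| `^ p) by meas.
apply: L1_ge0 => //.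
apply: le_lt_trans Mp; apply: ge0_le_integral => //.
- exact/measurable_EFinP.
- exact: (measurableT_comp (measurable_poweR p) mM).
move=> w _; rewrite -poweR_EFin; have := fM w; case: (M w) => [m| |] //.
  by rewrite lee_fin !poweR_EFin lee_fin => fm; apply: powR_mono => //; exact: ltW.
by move=> _; rewrite poweRyr ?gt_eqF// leey.
Qed.

Lemma L1_powZ (c : R) (f : Omega -> R) (p : R) :
  L1 P (fun w => `|f w| `^ p) -> L1 P (fun w => `|c * f w| `^ p).
Proof.
move=> Lf; under eq_fun do rewrite normrM powRM//.
exact: L1Z.
Qed.

Lemma variance_centered (f : Omega -> R) : L1 P f -> Ex P f = 0 ->
  ('V_P[f] = \int[P]_w (f w ^+ 2)%:E)%E.
Proof.
move=> Lf Ef; rewrite /variance covariance.unlock (expectation_Ex Lf) Ef expectation.unlock.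
by apply: eq_integral => w _; rewrite !fctE /= subr0 expr2.
Qed.

(** Finiteness is given for interval 0 only; equality in law carries it to each [k], and a countable
    union of null events is null. [null] is the indicator of that union. *)
Lemma iid_infinite_null {d'} {St : measurableType d'} (zeta : nat -> Omega -> St)
    (M : St -> \bar R) : iid P zeta -> measurable_fun setT M -> (forall s, (0 <= M s)%E) ->
  {ae P, forall w, (M (zeta 0%N w) < +oo)%E} ->
  exists null : Omega -> R, [/\ L1 P null, (forall w, 0 <= null w), Ex P null = 0 &
    forall w, null w < 1 -> forall k, (M (zeta k w) < +oo)%E].
Proof.
move=> [mz _ idz] mM M0 Mfin; pose B := M @^-1` [set +oo%E].
have mB : measurable B by rewrite -[B]setTI; apply: mM => //; exact: emeasurable_set1.
have mA k : measurable (zeta k @^-1` B) by rewrite -[_ @^-1` _]setTI; exact: mz.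
have nA k : P.-negligible (zeta k @^-1` B).
  apply/(negligibleP P (mA k)); rewrite [LHS](idz k 0%N B mB); apply/(negligibleP P (mA 0%N)).
  by apply: negligibleS Mfin => w /= -> .
have mN : measurable (\bigcup_k (zeta k @^-1` B)) by exact: bigcup_measurable.
have PN : P (\bigcup_k (zeta k @^-1` B)) = 0%E.
  by apply/(negligibleP P mN); exact: negligible_bigcup.
exists (\1_(\bigcup_k (zeta k @^-1` B))); split.
- by apply: (@L1_bounded _ _ _ _ _ 1) => [|w]; [exact: measurable_indic|
    rewrite indicE ger0_norm ?ler0n// lern1 leq_b1].
- by move=> w; rewrite indicE ler0n.
- by rewrite /Ex /Rintegral integral_indic// setIT [X in fine X]PN.
- move=> w + k; rewrite indicE ltey; apply: contraPneq => Mw.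
  by rewrite mem_set ?ltxx//; exists k.
Qed.

End moments_of_bounds.

Theorem theorem3p1 (R : realType) (d : measure_display)
    (Omega : measurableType d) (P : probability Omega R)
    (xi : nat -> {RV P >-> R}) (Z : R -> {RV P >-> R}) (r : R) :
  let T1 := renewal_time xi 1 in
  let ZT1 := at_time Z T1 in
  let M1 := sup_norm_upto Z T1 in
  let mu := fine 'E_P[T1] in
  let a := fine 'E_P[ZT1] / mu in
  let Y := (fun w => ZT1 w - a * T1 w) in
  let sigma2 := fine 'V_P[Y] in
  let X := (fun (t : R) (w : Omega) => (Z t w - a * t) / Num.sqrt t) in
  let N := centered_normal (sigma2 / mu) in
  2 <= r ->
  renewal_process P xi ->
  (forall w, cadlag (fun t => Z t w)) ->
  regenerative_increments P xi Z ->
  P.-integrable setT (EFin \o T1) ->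
  P.-integrable setT (EFin \o ZT1) ->
  ('V_P[Y] < +oo)%E ->
  {ae P, forall w, (M1 w < +oo)%E} ->
  ('E_P[fun w => (T1 w `^ r)%R] < +oo)%E ->
  (\int[P]_w (M1 w `^ r) < +oo)%E ->
  [/\ uniformly_integrable P [set t : R | 1 <= t] (fun t w => `|X t w| `^ r),
      cvg_in_distribution P X N,
      (forall s : R, 0 < s -> s <= r ->
        'E_P[fun w => (`|X t w| `^ s)%R]%E @[t --> +oo]
          --> 'E_N[fun x => (`|x| `^ s)%R]%E) &
      (forall k : nat, (1 <= k)%N -> k%:R <= r ->
        'E_P[fun w => (X t w ^+ k)%R]%E @[t --> +oo]
          --> 'E_N[fun x => (x ^+ k)%R]%E)].
Proof.
move=> T1 ZT1 M1 mu a Y sigma2 X N r2 [_ xi_gt0] cZ [Z0 zeta_iid] LT1 LZT1 _ M1fin ET1r EM1r.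
pose zeta := increment xi Z; rewrite -/zeta in zeta_iid.
pose y := @centered_endpoint R a; pose b := @path_bound R a.
have r0 : 0 < r by lra.
have r1 : 1 <= r by lra.
have T1E w : (zeta 0%N w).1 = T1 w by rewrite /T1 renewal_time1.
have ZT1E w : endpoint (zeta 0%N w) = ZT1 w by by rewrite /zeta endpoint_increment0.
have M1E w : path_sup (zeta 0%N w) = M1 w by by rewrite /zeta path_sup_increment0.
have yE : (fun w => y (zeta 0%N w)) = Y.
  by apply/funext => w; rewrite /y /centered_endpoint ZT1E T1E.
have mz : measurable_fun setT (zeta 0%N) by case: zeta_iid.
have mx : measurable_fun setT (fst : R * path_space R -> R) by exact: measurable_fst.
have my : measurable_fun setT y by exact: measurable_centered_endpoint.
have mb : measurable_fun setT b by exact: measurable_path_bound.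
have mT1 : measurable_fun setT T1 by exact: L1_measurable LT1.
have mZT1 : measurable_fun setT ZT1 by exact: L1_measurable LZT1.
have T1_gt0 w : 0 < T1 w by rewrite -T1E; exact: xi_gt0.
have LT1r : L1 P (fun w => `|T1 w| `^ r).
  have -> : (fun w => `|T1 w| `^ r) = (fun w => T1 w `^ r).
    by apply/funext => w; rewrite gtr0_norm.
  apply: L1_ge0; [exact: mf_pow|by move=> w; exact: powR_ge0|].
  by move: ET1r; rewrite unlock.
have Lx2 : L1 P (fun w => (zeta 0%N w).1 ^+ 2).
  by under eq_fun do rewrite T1E; exact: L1_sqr LT1r.
have mM : measurable_fun setT (fun w => path_sup (zeta 0%N w)).
  exact: (measurableT_comp measurable_path_sup mz).
have mfM : measurable_fun setT (fun w => fine (path_sup (zeta 0%N w))).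
  by apply: (measurableT_comp _ mM); exact: fine_measurable.
have fMr : L1 P (fun w => `|fine (path_sup (zeta 0%N w))| `^ r).
  apply: (L1_pow_dominated r0 mfM mM) => [w|].
    have := path_sup_ge0 (zeta 0%N w); case: (path_sup _) => [m| |]//= m0.
      by rewrite ger0_norm.
    by rewrite leey.
  by under eq_integral do rewrite M1E.
(* The supremum runs over a closed interval, so it dominates the value at [T1]. *)
have LZr : L1 P (fun w => `|ZT1 w| `^ r).
  apply: (L1_pow_dominated r0 mZT1 mM) => [w|].
    rewrite M1E; apply: ereal_sup_ubound; exists (T1 w) => //=.
    by rewrite in_itv/= lexx ltW.
  by under eq_integral do rewrite M1E.
have Lyr : L1 P (fun w => `|y (zeta 0%N w)| `^ r).
  have -> : (fun w => `|y (zeta 0%N w)| `^ r) = (fun w => `|ZT1 w + (- a) * T1 w| `^ r).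
    by apply/funext => w; rewrite [y _](congr1 (@^~ w) yE) mulNr.
  have maT : measurable_fun setT (fun w => (- a) * T1 w) by meas.
  exact: (L1_powD mZT1 maT (ltW r0) LZr (L1_powZ (- a) LT1r)).
have Lbr : L1 P (fun w => b (zeta 0%N w) `^ r).
  have -> : (fun w => b (zeta 0%N w) `^ r) =
      (fun w => `|2 * fine (path_sup (zeta 0%N w)) + `|a| * T1 w| `^ r).
    apply/funext => w; rewrite /b -[in LHS](ger0_norm (path_bound_ge0 a _)).
    by rewrite /path_bound T1E (gtr0_norm (T1_gt0 w)).
  have m1 : measurable_fun setT (fun w => 2 * fine (path_sup (zeta 0%N w))) by meas.
  have m2 : measurable_fun setT (fun w => `|a| * T1 w) by meas.
  exact: (L1_powD m1 m2 (ltW r0) (L1_powZ 2 fMr) (L1_powZ `|a| LT1r)).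
have muE : mu = Ex P (fun w => (zeta 0%N w).1).
  by rewrite /mu expectation_Ex//=; congr (Ex P); apply/funext => w; exact/esym/T1E.
have mu0 : 0 < mu.
  by rewrite /mu expectation_Ex//=; exact: Ex_gt0.
have LaT1 := L1Z a LT1.
have LY : L1 P Y by exact: L1B LZT1 LaT1.
have EY : Ex P Y = 0.
  rewrite (ExB LZT1 LaT1) (ExZ _ LT1) /a expectation_Ex//=.
  have -> : Ex P T1 = mu by rewrite /mu expectation_Ex.
  by rewrite divfK ?subrr// gt_eqF.
have Ey0 : Ex P (fun w => y (zeta 0%N w)) = 0 by rewrite yE.
have s2E : sigma2 = Ex P (fun w => y (zeta 0%N w) ^+ 2).
  rewrite /sigma2 variance_centered//; congr fine; apply: eq_integral => w _.
  by rewrite [y _](congr1 (@^~ w) yE).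
have mX t : measurable_fun setT (X t).
  by have mZ : measurable_fun setT (Z t) by []; rewrite /X; meas.
have M1fin' : {ae P, forall w, (path_sup (zeta 0%N w) < +oo)%E}.
  by apply: filterS M1fin => w; rewrite M1E.
(* Off this event [path_sup] is finite on every interval at once, as [centered_process_walk]
   requires for an arbitrary straddling index. *)
have [null [Lnull null0 Enull nullP]] :=
  iid_infinite_null zeta_iid measurable_path_sup path_sup_ge0 M1fin'.
have X_walk (t : R) k w : 1 <= t ->
  walk zeta fst k w <= t < walk zeta fst k.+1 w -> null w < 1 ->
  `|X t w * Num.sqrt t - walk zeta y k.+1 w| <= b (zeta k w).
  move=> t1 kt nw; rewrite /X divfK ?gt_eqF ?sqrtr_gt0 ?(lt_le_trans ltr01)//.
  by apply: centered_process_walk => //; exact: nullP.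
have x_gt0 i w : 0 < (zeta i w).1 by exact: xi_gt0.
have b0 := path_bound_ge0 a.
have UI := uniform_tail zeta_iid mx my mb x_gt0 r2 Lx2 Lyr b0 Lbr Ey0 mX Lnull null0 Enull X_walk.
have LX := L1_X_pow zeta_iid mx my mb x_gt0 r2 Lx2 Lyr b0 Lbr Ey0 mX Lnull null0 Enull X_walk.
have W := weak_convergence zeta_iid mx my mb x_gt0 r2 Lx2 Lyr b0 Lbr Ey0 mX Lnull null0 Enull X_walk.
have G := growth_convergence zeta_iid mx my mb x_gt0 r2 Lx2 Lyr b0 Lbr Ey0 mX Lnull null0 Enull X_walk.
rewrite -s2E -muE -/N in W G.
split.
- by apply: uniformly_integrable_tails => // t w; exact: powR_ge0.
- move=> f cf bf; apply: cvg_expectation.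
  + by move=> t _; exact: L1_test_P.
  + exact: L1_test_nu.
  + exact: W.
- move=> s s0 sr.
  have [||L1' L2' C] := G (fun u : R => `|u| `^ s) s (continuous_norm_powR s0).
  + by rewrite s0.
  + by move=> u; rewrite ger0_norm ?powR_ge0.
  exact: (cvg_expectation L1' L2' C).
- move=> k k1 kr.
  have [||L1' L2' C] := G (fun u : R => u ^+ k) k%:R (@exprn_continuous R k).
  + by rewrite ltr0n k1.
  + by move=> u; rewrite normrX powR_mulrn.
  exact: (cvg_expectation L1' L2' C).
Qed.
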